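(* Let $p$ be a variable exponent that is harmonic in $\mathbb{D}$ and log-Hölder continuous on $\overline{\mathbb{D}}$ with bounded conjugate. Let $\omega:\mathbb{D}\to\mathbb{D}$ be analytic with $|\omega(z)|\le|z|$ for all $z\in\mathbb{D}$. There is a constant $C$ such that for every $F\in H^{p(\cdot)}$, the function $f(z)=F(\omega(z))$ (that is, $f\prec_\omega F$) satisfies $f\in H^{p(\omega(\cdot))}$ and $$\|f\|_{H,p(\omega(\cdot))}\le C\|F\|_{H,p(\cdot)}.$$ Furthermore, $M_{p(\omega(\cdot))}(r,f)\le C\,M_{p(\cdot)}(r,F)$ for all $0\le r<1$.
   Context: $\mathbb{D}$ is the open unit disc; $p_-=\operatorname{ess\,inf}p$, $p_+=\operatorname{ess\,sup}p$; a variable exponent satisfies $0<p_-\le p_+<\infty$. An exponent $p$ on $\overline{\mathbb{D}}$ is log-Hölder continuous if there is a constant $C_0$ with $|p(z)-p(w)|\le C_0/\log\frac1{|z-w|}$ for all $z,w\in\overline{\mathbb{D}}$ with $|z-w|<1$; it is log-Hölder continuous with bounded conjugate if in addition the harmonic function in $\mathbb{D}$ with the same boundary values as $p$ has bounded harmonic conjugate. For an exponent $s$ on $\mathbb{D}$, $M_{s(\cdot)}(r,f)=\inf\{\lambda>0:\frac1{2\pi}\int_0^{2\pi}|f(re^{i\theta})/\lambda|^{s(re^{i\theta})}d\theta<1\}$, and $H^{s(\cdot)}$ is the set of analytic $f$ on $\mathbb{D}$ with $\sup_{0\le r<1}M_{s(\cdot)}(r,f)<\infty$. For $s=p$ log-Hölder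 continuous, $\|F\|_{H,p(\cdot)}=\lim_{r\to1}M_{p(\cdot)}(r,F)$ (the limit exists). For $s=p\circ\omega$, which need not be log-Hölder continuous, $\|f\|_{H,p(\omega(\cdot))}=\sup_{0\le r<1}M_{p(\omega(\cdot))}(r,f)$. Here $p(\omega(\cdot))$ denotes the exponent $z\mapsto p(\omega(z))$ on $\mathbb{D}$. *)

(* Defs.v *)
From HB Require Import structures.
From mathcomp Require Import all_boot all_order all_algebra.
From mathcomp Require Import all_classical all_reals all_analysis.
From mathcomp Require Import ess_sup_inf complex.

Set Implicit Arguments.
Unset Strict Implicit.
Unset Printing Implicit Defensive.

Import Order.TTheory GRing.Theory Num.Theory.
Import numFieldNormedType.Exports.

Local Open Scope classical_set_scope.
Local Open Scope ring_scope.
Local Open Scope complex_scope.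

(** Functions on the disc are total functions on [Cplx R]; only their values
    on the (open or closed) disc are ever used. The [^o] is what lets the
    topology and normed-module structures be inferred on [R[i]]. *)
Notation Cplx R := (R[i]^o).

(** Real-valued modulus; the norm of [R[i]] takes its values in [R[i]]. *)
Definition cabs (R : realType) (z : Cplx R) : R := Normc.normc z.

Definition disc (R : realType) : set (Cplx R) := [set z | cabs z < 1].
Definition closed_disc (R : realType) : set (Cplx R) := [set z | cabs z <= 1].
Definition circle (R : realType) : set (Cplx R) := [set z | cabs z = 1].

(** [derivable] is taken over the scalar field [R[i]]: this is complex
    differentiability. *)
Definition analytic_on (R : realType) (D : set (Cplx R))
    (f : Cplx R -> Cplx R) : Prop :=
  forall z, D z -> derivable f z 1.

Definition xslice (R : realType) (u : Cplx R -> R) (z : Cplx R) (t : R) : R :=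
  u (t +i* complex.Im z).
Definition yslice (R : realType) (u : Cplx R -> R) (z : Cplx R) (t : R) : R :=
  u (complex.Re z +i* t).

Definition d_x (R : realType) (u : Cplx R -> R) (z : Cplx R) : R :=
  derive1 (xslice u z) (complex.Re z).
Definition d_y (R : realType) (u : Cplx R -> R) (z : Cplx R) : R :=
  derive1 (yslice u z) (complex.Im z).

Definition C1_on (R : realType) (D : set (Cplx R)) (u : Cplx R -> R) : Prop :=
  forall z, D z ->
    [/\ derivable (xslice u z) (complex.Re z) 1,
        derivable (yslice u z) (complex.Im z) 1,
        {for z, continuous (d_x u)} & {for z, continuous (d_y u)}].

Definition harmonic_on (R : realType) (D : set (Cplx R)) (u : Cplx R -> R)
    : Prop :=
  [/\ C1_on D u, C1_on D (d_x u), C1_on D (d_y u) &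
      forall z, D z -> d_x (d_x u) z + d_y (d_y u) z = 0].

Definition harmonic_conjugate_on (R : realType) (D : set (Cplx R))
    (u v : Cplx R -> R) : Prop :=
  analytic_on D (fun z => u z +i* v z).

Definition plane_pt (R : realType) (x : R * R) : Cplx R := x.1 +i* x.2.

Lemma measurable_disc (R : realType) :
  measurable (@plane_pt R @^-1` @disc R).
Proof.
rewrite [X in measurable X](_ : _ =
    (fun x : R * R => x.1 ^+ 2 + x.2 ^+ 2) @^-1` `]-oo, 1[%classic).
  rewrite -[X in measurable X]setTI.
  have mf : measurable_fun setT (fun x : R * R => x.1 ^+ 2 + x.2 ^+ 2).
    by apply: measurable_realfun.measurable_funD;
      apply: measurable_realfun.measurable_funX.
  exact: mf.
apply/seteqP; split => -[x y] /=; rewrite /disc /cabs /= in_itv /=.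
- rewrite -[X in _ < X -> _]sqrtr1 ltr_sqrt ?ltr01 //.
- by move=> h; rewrite -[X in _ < X]sqrtr1 ltr_sqrt ?ltr01.
Qed.

(** Area measure of the unit disc, carried by [R * R]. *)
Definition disc_area (R : realType) : 
    {measure set (measurableTypeR R * measurableTypeR R) -> \bar R} :=
  mrestr (@lebesgue_measure R \x @lebesgue_measure R)%E (@measurable_disc R).

Definition p_minus (R : realType) (p : Cplx R -> R) : \bar R :=
  ess_inf (@disc_area R) (fun x => (p (plane_pt x))%:E).
Definition p_plus (R : realType) (p : Cplx R -> R) : \bar R :=
  ess_sup (@disc_area R) (fun x => (p (plane_pt x))%:E).

Definition variable_exponent (R : realType) (p : Cplx R -> R) : Prop :=
  (0 < p_minus p)%E /\ (p_minus p <= p_plus p)%E /\ (p_plus p < +oo)%E.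

(** For [z = w] the right-hand side is [C0 / ln 0^-1 = 0] since [0^-1 = 0],
    [ln 0 = 0] and [C0 / 0 = 0], in agreement with the usual convention. *)
Definition log_holder (R : realType) (p : Cplx R -> R) : Prop :=
  exists C0 : R, forall z w, closed_disc z -> closed_disc w ->
    cabs (z - w) < 1 -> `|p z - p w| <= C0 / ln (cabs (z - w))^-1.

(** [h] is the harmonic function in the disc with the boundary values of [p]. *)
Definition bounded_conjugate (R : realType) (p : Cplx R -> R) : Prop :=
  exists h q : Cplx R -> R,
    [/\ harmonic_on (@disc R) h,
        {within @closed_disc R, continuous h},
        (forall z, circle z -> h z = p z),
        harmonic_conjugate_on (@disc R) h q &
        exists B : R, forall z, disc z -> `|q z| <= B].

Definition log_holder_bounded_conjugate (R : realType) (p : Cplx R -> R)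
    : Prop :=
  log_holder p /\ bounded_conjugate p.

Definition circle_pt (R : realType) (r t : R) : Cplx R :=
  (r * cos t) +i* (r * sin t).

Definition modular (R : realType) (s : Cplx R -> R) (r : R)
    (f : Cplx R -> Cplx R) (l : R) : \bar R :=
  (((2 * pi)^-1)%R%:E *
   \int[lebesgue_measure]_(t in `[0%R, (2 * pi)%R]%classic)
     (((cabs (f (circle_pt r t)) / l) `^ s (circle_pt r t))%R)%:E)%E.

Definition Mmean (R : realType) (s : Cplx R -> R) (r : R)
    (f : Cplx R -> Cplx R) : \bar R :=
  ereal_inf [set l%:E | l in [set l : R | 0 < l /\ (modular s r f l < 1)%E]].

Definition supnorm (R : realType) (s : Cplx R -> R) (f : Cplx R -> Cplx R)
    : \bar R :=
  ereal_sup [set Mmean s r f | r in [set r : R | 0 <= r < 1]].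

Definition limnorm (R : realType) (s : Cplx R -> R) (f : Cplx R -> Cplx R)
    : \bar R :=
  lim (Mmean s r f @[r --> (1 : R)^'-]).

Definition Hardy (R : realType) (s : Cplx R -> R) : set (Cplx R -> Cplx R) :=
  [set f | analytic_on (@disc R) f /\ (supnorm s f < +oo)%E].

(* Main.v *)
Require Import Defs.
From HB Require Import structures.
From mathcomp Require Import all_boot all_order all_algebra.
From mathcomp Require Import all_classical all_reals all_analysis.
From mathcomp Require Import ess_sup_inf measurable_realfun complex.
From mathcomp Require Import ring lra.

(** The exponents only matter through two facts: on the disc they lie between
    two positive constants, and they are log-Hoelder continuous.  Write
    [avg f] for the mean of [f] over a period.

    Subordination.  Fix [s] so small that [q = p / s >= 2] and put
    [g = |F| `^ s].  Then [g] is subharmonic, so on the disc of radius [rho] it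
    is at most the Poisson integral of its values on the circle of radius
    [rho] ([dyadic_root_cabs_subharmonic]).  If [avg (g `^ q) <= 1] on that
    circle, then at every point [z] of the disc
      [g z `^ q z <= C * (Poisson integral of g `^ q at z + 1)];
    this is [key_estimate].  Jensen's inequality gives it when [q] is frozen at
    [q z]; to unfreeze it, cut [g] at height [1 / d] with [d] the distance from
    the boundary point to [z].  Below the cut, log-Hoelder continuity bounds
    [(1 / d) `^ |difference of exponents|]; above it [g <= d * g `^ q], and the
    factor [d] cancels the singularity of the Poisson kernel.  The right-hand
    side is harmonic, so its composite with [omega] is harmonic too, and its
    mean over a circle of radius [r < rho] is its value at [omega 0 = 0].
    Letting [rho] tend to [r], resp. to [1], gives both inequalities.

    Existence of the limit.  The norm of [F] is a limit as [r] tends to [1],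
    and the exponent being variable the means [avg (g `^ q)] need not be
    monotone in [r].  The means of [g ^+ 2] are, and they are bounded, so the
    variance of [g] on an outer circle, seen through the Poisson kernel from
    the inner circle, tends to zero ([J_variance]).  Hence the means of the
    truncated powers [(min g tau) `^ q] are Cauchy
    ([truncated_modular_cauchy]).  Truncation costs little uniformly in [r]: on
    the inner circle [g] is at most a constant plus the Poisson integral of the
    excess of [g] over a high level, and [key_estimate] turns the smallness of
    the excess in modular into the smallness of that integral
    ([uniformly_integrable]).

    Complex analysis.  All of it comes from the mean value property of
    complex differentiable functions ([mean_value]), which is Goursat's
    bisection argument in the coordinates [z = c + exp (x + i y)], where circles
    become segments and the two horizontal sides cancel by periodicity.
    Subharmonicity of [|F| `^ s] is obtained for [s] a power of one half by
    taking square roots of [F] near a point where [F] does not vanish, and the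
    comparison with the Poisson integral is a maximum principle
    ([submean_le_poisson]). *)

Set Implicit Arguments.
Unset Strict Implicit.
Unset Printing Implicit Defensive.

Import Order.TTheory GRing.Theory Num.Theory.
Import numFieldNormedType.Exports.

Local Open Scope classical_set_scope.
Local Open Scope ring_scope.

(** * Integrals of continuous functions on a segment *)

Section IntervalIntegral.
Variable R : realType.
Implicit Types (f g : R -> R) (a b c k : R).

(** Two-sided continuity, also at the endpoints: the functions integrated below
    are continuous beyond the segment. *)
Definition cont_on a b f := forall x, a <= x <= b -> {for x, continuous f}.

Definition itg f a b : R := Rintegral (@lebesgue_measure R) `[a, b]%classic f.

Lemma cont_on_integrable a b f : cont_on a b f ->
  (@lebesgue_measure R).-integrable `[a, b]%classic (EFin \o f).
Proof.
move=> cf; apply: continuous_compact_integrable; first exact: segment_compact.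
apply: continuous_in_subspaceT => x; rewrite inE /= in_itv /=; exact: cf.
Qed.

Lemma itgD f g a b : cont_on a b f -> cont_on a b g ->
  itg (fun x => f x + g x) a b = itg f a b + itg g a b.
Proof. by move=> cf cg; apply: RintegralD => //; exact: cont_on_integrable. Qed.

Lemma itgB f g a b : cont_on a b f -> cont_on a b g ->
  itg (fun x => f x - g x) a b = itg f a b - itg g a b.
Proof. by move=> cf cg; apply: RintegralB => //; exact: cont_on_integrable. Qed.

Lemma itgZ f a b k : cont_on a b f ->
  itg (fun x => k * f x) a b = k * itg f a b.
Proof. by move=> cf; apply: RintegralZl => //; exact: cont_on_integrable. Qed.

Lemma itg_cst a b k : a <= b -> itg (fun=> k) a b = k * (b - a).
Proof.
move=> ab; rewrite /itg Rintegral_cst//= lebesgue_measure_itv/= lte_fin.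
by case: ltP => //= ba; rewrite (@le_anti _ _ a b) ?ab ?ba// subrr.
Qed.

Lemma le_itg f g a b : cont_on a b f -> cont_on a b g ->
  (forall x, a <= x <= b -> f x <= g x) -> itg f a b <= itg g a b.
Proof.
by move=> cf cg fg; apply: le_Rintegral => //; exact: cont_on_integrable.
Qed.

Lemma itg_cat f a c b : a <= c <= b -> cont_on a b f ->
  itg f a b = itg f a c + itg f c b.
Proof.
move=> /andP[ac cb] cf.
have /(Rintegral_itvB (cont_on_integrable cf)) : (BLeft a <= BRight c)%O by [].
move=> /(_ ltac:(by [])) h; rewrite /itg.
have -> : Rintegral (@lebesgue_measure R) `[c, b] f =
          Rintegral (@lebesgue_measure R) `]c, b] f.
  rewrite Rintegral_itv_obnd_cbnd//.
  apply: integrableS (cont_on_integrable cf) => //.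
  by apply: subset_itv => //; rewrite bnd_simp.
by rewrite -h addrC subrK.
Qed.

End IntervalIntegral.

(** * Modulus and topology of the complex plane *)

Section Complex.
Variable R : realType.
Implicit Types (z w : Cplx R) (x y t : R).

Lemma cabsE z : cabs z = Num.sqrt (complex.Re z ^+ 2 + complex.Im z ^+ 2).
Proof. by case: z. Qed.

Lemma cabs_sqr z : cabs z ^+ 2 = complex.Re z ^+ 2 + complex.Im z ^+ 2.
Proof. by rewrite cabsE sqr_sqrtr// addr_ge0// sqr_ge0. Qed.

Lemma norm_cabsE z : `|z| = ((cabs z)%:C)%C :> R[i].
Proof. by []. Qed.

Lemma cabs_ge0 z : 0 <= cabs z.
Proof. by rewrite cabsE sqrtr_ge0. Qed.

Lemma cabsM z w : cabs (z * w) = cabs z * cabs w.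
Proof. exact: Normc.normcM. Qed.

Lemma cabsV z : cabs z^-1 = (cabs z)^-1.
Proof. exact: Normc.normcV. Qed.

Lemma cabsD z w : cabs (z + w) <= cabs z + cabs w.
Proof.
have := ler_normD (z : R[i]) w.
by rewrite !norm_cabsE -rmorphD lecR.
Qed.

Lemma cabsN z : cabs (- z) = cabs z.
Proof. by case: z => a b; rewrite /cabs/= !sqrrN. Qed.

Lemma cabsBC z w : cabs (z - w) = cabs (w - z).
Proof. by rewrite -cabsN opprB. Qed.

Lemma cabs0 : cabs (0 : Cplx R) = 0.
Proof. exact: Normc.normc0. Qed.

Lemma cabs1 : cabs (1 : Cplx R) = 1.
Proof. exact: Normc.normc1. Qed.

Lemma cabs_eq0 z : (cabs z == 0) = (z == 0).
Proof.
apply/eqP/eqP => [/Normc.eq0_normc //|->]; exact: cabs0.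
Qed.

Lemma cabs_gt0 z : (0 < cabs z) = (z != 0).
Proof. by rewrite lt_def cabs_ge0 andbT cabs_eq0. Qed.

Lemma cabs_triangle u z w : cabs (z - w) <= cabs (z - u) + cabs (u - w).
Proof. by rewrite -[z - w](subrKA u); exact: cabsD. Qed.

Lemma cabsB z w : cabs z - cabs w <= cabs (z - w).
Proof. by rewrite lerBlDr -{1}[z](subrK w); exact: cabsD. Qed.

Lemma cabs_real x : cabs ((x%:C)%C : Cplx R) = `|x|.
Proof. by rewrite cabsE /= expr0n addr0 sqrtr_sqr. Qed.

Lemma Re_le_cabs z : `|complex.Re z| <= cabs z.
Proof. by rewrite cabsE -sqrtr_sqr ler_sqrt ?lerDl ?addr_ge0 ?sqr_ge0. Qed.

Lemma Im_le_cabs z : `|complex.Im z| <= cabs z.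
Proof. by rewrite cabsE -sqrtr_sqr ler_sqrt ?lerDr ?addr_ge0 ?sqr_ge0. Qed.

Lemma cabs_le z : cabs z <= `|complex.Re z| + `|complex.Im z|.
Proof.
rewrite -(ler_pXn2r (ltn0Sn 1)) ?nnegrE ?cabs_ge0 ?addr_ge0//.
rewrite cabs_sqr sqrrD !real_normK ?num_real// lerD2r lerDl.
by rewrite mulrn_wge0// mulr_ge0.
Qed.

Definition eit t : Cplx R := (cos t +i* sin t)%C.

Lemma cabs_eit t : cabs (eit t) = 1.
Proof. by rewrite cabsE /= cos2Dsin2 sqrtr1. Qed.

Lemma circle_ptE (r t : R) : circle_pt r t = (r%:C)%C * eit t.
Proof.
by apply/eqP; rewrite eq_complex/= !mul0r subr0 addr0 !eqxx.
Qed.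

Lemma cabs_circle_pt (r t : R) : cabs (circle_pt r t) = `|r|.
Proof. by rewrite circle_ptE cabsM cabs_real cabs_eit mulr1. Qed.

Lemma near_cabsP z (P : set (Cplx R)) :
  (\forall w \near z, P w) <->
  exists2 d : R, 0 < d & forall w, cabs (w - z) < d -> P w.
Proof.
split.
  case/nbhs_normP => e /= e0 h.
  case: e e0 h => a b /= /andP[/eqP b0 a0] h; exists a => // w wd.
  apply: h => /=; rewrite -[_ - _]opprB normrN /= norm_cabsE.
  by rewrite /= b0 ltcE/= eqxx.
case=> d d0 h; apply/nbhs_normP; exists ((d%:C)%C); first by rewrite /= ltcR.
by move=> w /=; rewrite -[_ - _]opprB normrN norm_cabsE ltcR => /h.
Qed.

Lemma continuous_cabsP (phi : Cplx R -> R) z :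
  {for z, continuous phi} <->
  forall e : R, 0 < e -> exists2 d : R, 0 < d &
    forall w, cabs (w - z) < d -> `|phi w - phi z| < e.
Proof.
split.
  move=> /cvgrPdist_lt h e e0; have /near_cabsP[d d0 hd] := h e e0.
  by exists d => // w /hd; rewrite distrC.
move=> h; apply/(@cvgrPdist_lt _ _ _ (nbhs z)) => e e0; have [d d0 hd] := h e e0.
by apply/near_cabsP; exists d => // w /hd; rewrite distrC.
Qed.

Lemma continuous_ComplexP (T : topologicalType) (f : T -> Cplx R) (x : T) :
  {for x, continuous f} <->
  forall e : R, 0 < e -> \forall y \near x, cabs (f y - f x) < e.
Proof.
split.
  move=> h e e0; apply: (h [set w | cabs (w - f x) < e]).
  by apply/near_cabsP; exists e.
move=> h P /near_cabsP[d d0 hd]; rewrite /nbhs/=.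
by apply: filterS (h d d0) => y; exact: hd.
Qed.

Lemma continuous_Complex (T : topologicalType) (a b : T -> R) (x : T) :
  {for x, continuous a} -> {for x, continuous b} ->
  {for x, continuous (fun y : T => (a y +i* b y)%C : Cplx R)}.
Proof.
move=> ca cb; apply/continuous_ComplexP => e e0.
have e2 : 0 < e / 2 by rewrite divr_gt0.
move/cvgrPdist_lt : ca => /(_ _ e2) ca; move/cvgrPdist_lt : cb => /(_ _ e2) cb.
near=> y; apply: le_lt_trans (cabs_le _) _ => /=.
rewrite [e]splitr ltrD// distrC; [near: y; exact: ca|near: y; exact: cb].
Unshelve. all: by end_near. Qed.

Lemma continuous_cabs z : {for z, continuous (@cabs R)}.
Proof.
apply/continuous_cabsP => e e0; exists e => // w we.
rewrite ltr_norml; apply/andP; split; last first.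
  by apply: le_lt_trans we; exact: cabsB.
by rewrite ltrNl opprB; apply: le_lt_trans we; rewrite cabsBC; exact: cabsB.
Qed.

Lemma continuous_Re z : {for z, continuous (@complex.Re R : Cplx R -> R)}.
Proof.
apply/continuous_cabsP => e e0; exists e => // w we.
by apply: le_lt_trans we; rewrite -[X in `|X|]/(complex.Re w - complex.Re z);
  case: w z => [a b] [c d]; exact: (Re_le_cabs ((a - c) +i* (b - d))%C).
Qed.

Lemma continuous_Im z : {for z, continuous (@complex.Im R : Cplx R -> R)}.
Proof.
apply/continuous_cabsP => e e0; exists e => // w we.
by apply: le_lt_trans we; case: w z => [a b] [c d];
  exact: (Im_le_cabs ((a - c) +i* (b - d))%C).
Qed.

Lemma continuous_circle_pt (r : R) : continuous (@circle_pt R r).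
Proof.
move=> t.
apply: (@continuous_Complex R (fun t => r * cos t) (fun t => r * sin t));
  apply: cvgM;
  [exact: cvg_cst|exact: continuous_cos|exact: cvg_cst|exact: continuous_sin].
Qed.

Lemma compact_cdisc (r : R) : compact [set z : Cplx R | cabs z <= r].
Proof.
pose K : set (R * R) := `[-r, r]%classic `*` `[-r, r]%classic `&`
  [set u | Num.sqrt (u.1 ^+ 2 + u.2 ^+ 2) <= r].
have cf : continuous (fun u : R * R => Num.sqrt (u.1 ^+ 2 + u.2 ^+ 2)).
  move=> u; 
  apply: (@continuous_comp _ _ _ (fun u : R * R => u.1 ^+ 2 + u.2 ^+ 2)
    (@Num.sqrt R)); last exact: sqrt_continuous.
  apply: cvgD.
    apply: (@continuous_comp _ _ _ fst (fun a : R => a ^+ 2)).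
      exact: cvg_fst.
    exact: exprn_continuous.
  apply: (@continuous_comp _ _ _ snd (fun a : R => a ^+ 2)).
    exact: cvg_snd.
  exact: exprn_continuous.
have cK : compact K.
  apply: compact_closedI.
    by apply: compact_setX; exact: segment_compact.
  by apply: (continuous_closedP _).1 (@closed_le R r); exact: cf.
have cp : continuous (@plane_pt R).
  by move=> u; apply: (@continuous_Complex (R * R)%type fst snd); [exact: cvg_fst|exact:
    cvg_snd].
rewrite [X in compact X](_ : _ = @plane_pt R @` K); last first.
  apply/seteqP; split => [[a b] /= h|_ [[a b] [_ h]] <-//].
  exists (a, b) => //; split; last exact: h.
  split => /=; rewrite in_itv /= -ler_norml; apply: le_trans h.
    exact: (Re_le_cabs (a +i* b)%C).
  exact: (Im_le_cabs (a +i* b)%C).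
by apply: continuous_compact => //; exact: continuous_subspaceT.
Qed.

(** A form of uniform continuity made for integration against the Poisson
    kernel: the Poisson integral of the squared distance is explicit
    ([poisson_dist_sqr]), so points near and far from the pole need no separate
    treatment.  The constant [C] absorbs the pairs of distant points. *)
Lemma continuous_quadratic (K : set (Cplx R)) (phi : Cplx R -> R) (e : R) :
  compact K -> (forall z, K z -> {for z, continuous phi}) -> 0 < e ->
  exists2 C : R, 0 <= C & forall z w, K z -> K w ->
    `|phi z - phi w| <= e + C * cabs (z - w) ^+ 2.
Proof.
move=> cK cphi e0.
have /compact_near_coveringP := compact_setX cK cK.
move=> /(_ _ \oo (fun n u => `|phi u.1 - phi u.2| <=
          e + n%:R * cabs (u.1 - u.2) ^+ 2) _)[]; last first.
  move=> n _ h; exists n%:R => // z w Kz Kw.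
  exact: (h n (leqnn n) (z, w)).
move=> [z w] [/= Kz Kw].
have e2 : 0 < e / 2 by rewrite divr_gt0.
have hz := cphi _ Kz; have hw := cphi _ Kw.
have [zw|zw] := eqVneq z w.
  have /continuous_cabsP /(_ _ e2) [d d0 hd] := hz.
  have nd : \forall v \near z, `|phi v - phi z| < e / 2 by apply/near_cabsP; exists d.
  exists ((fun u => `|phi u.1 - phi z| < e / 2 /\ `|phi u.2 - phi z| < e / 2), setT).
    split; last exact: filterT.
    exists ([set v | `|phi v - phi z| < e / 2], [set v | `|phi v - phi z| < e / 2]).
      by split; [exact: nd|rewrite -zw; exact: nd].
    by move=> u; exact: id.
  move=> [[u v] n] /= [[h1 h2] _].
  rewrite -[phi u - phi v](subrKA (phi z)).
  apply: le_trans (ler_normD _ _) _; apply: (@le_trans _ _ e); last first.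
    by rewrite lerDl mulr_ge0// exprn_ge0// cabs_ge0.
  by rewrite [leRHS]splitr lerD// ltW// distrC.
pose d := cabs (z - w).
have d0 : 0 < d by rewrite cabs_gt0 subr_eq0.
have /continuous_cabsP /(_ _ ltr01) [d1 d10 hd1] := hz.
have /continuous_cabsP /(_ _ ltr01) [d2 d20 hd2] := hw.
pose M := `|phi z - phi w| + 2.
have nz : \forall v \near z, `|phi v - phi z| < 1 /\ cabs (v - z) < d / 4.
  apply/near_cabsP; exists (Num.min d1 (d / 4)).
    by rewrite lt_min d10 divr_gt0.
  by move=> v; rewrite lt_min => /andP[/hd1].
have nw : \forall v \near w, `|phi v - phi w| < 1 /\ cabs (v - w) < d / 4.
  apply/near_cabsP; exists (Num.min d2 (d / 4)).
    by rewrite lt_min d20 divr_gt0.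
  by move=> v; rewrite lt_min => /andP[/hd2].
have nn : \forall n \near \oo, M <= n%:R * (d / 2) ^+ 2.
  have q0 : 0 < (d / 2) ^+ 2 by rewrite exprn_gt0// divr_gt0.
  near=> n; rewrite -ler_pdivrMr//.
  by near: n; exact: nbhs_infty_ger.
exists ((fun u => (`|phi u.1 - phi z| < 1 /\ cabs (u.1 - z) < d / 4) /\
   (`|phi u.2 - phi w| < 1 /\ cabs (u.2 - w) < d / 4)),
   [set n | M <= n%:R * (d / 2) ^+ 2]).
  split; last exact: nn.
  exists ([set v | `|phi v - phi z| < 1 /\ cabs (v - z) < d / 4],
    [set v | `|phi v - phi w| < 1 /\ cabs (v - w) < d / 4]) => //.
move=> [[u v] n] /= [[[h1 h2] [h3 h4]] h5].
have h6 : d / 2 <= cabs (u - v).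
  have := cabs_triangle u z w; have := cabs_triangle v u w.
  rewrite (cabsBC z u) -/d => t1 t2; lra.
apply: (@le_trans _ _ (n%:R * (d / 2) ^+ 2)); last first.
  apply: (@le_trans _ _ (n%:R * cabs (u - v) ^+ 2)); last by rewrite lerDr ltW.
  by rewrite ler_wpM2l// lerXn2r// nnegrE ?cabs_ge0// divr_ge0// ltW.
apply: le_trans h5; rewrite /M.
have -> : phi u - phi v = (phi z - phi w) + (phi u - phi z) - (phi v - phi w) by ring.
apply: le_trans (ler_normB _ _) _; apply: le_trans (lerD (ler_normD _ _) (lexx _)) _.
by rewrite -addrA lerD2l; lra.
Unshelve. all: by end_near. Qed.

End Complex.

(** * Complex derivatives *)

Section ComplexDerivative.
Variable R : realType.
Implicit Types (z w : Cplx R) (F G : Cplx R -> Cplx R).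

Lemma normc_lt (z : Cplx R) (e : R[i]) : `|z| < e -> cabs z < complex.Re e.
Proof. by rewrite norm_cabsE; case: e => a b; rewrite ltcE /= => /andP[]. Qed.

Lemma lt_normc (z : Cplx R) (a : R) : cabs z < a -> `|z| < (a%:C)%C :> R[i].
Proof. by move=> h; rewrite norm_cabsE ltcE /=; apply/andP; split. Qed.

Lemma gt0_complex (a : R) : 0 < a -> 0 < (a%:C)%C :> R[i].
Proof. by move=> h; rewrite ltcE /=; apply/andP; split. Qed.

Lemma cderivableP F z : derivable F z 1 <->
  exists l : Cplx R, forall e : R, 0 < e -> exists2 d : R, 0 < d &
    forall w, cabs (w - z) < d ->
      cabs (F w - F z - l * (w - z)) <= e * cabs (w - z).
Proof.
split.
  move=> /cvg_ex[/= l hl]; exists l => e e0.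
  have ec0 : 0 < (e%:C)%C by exact: gt0_complex.
  move/(@cvgrPdist_lt _ _ _ (dnbhs (0 : R[i]^o))) : hl => /(_ _ ec0).
  move=> /near_cabsP[d d0 hd]; exists d => // w wd.
  have [->|wz] := eqVneq w z; first by rewrite !subrr mulr0 subr0 cabs0 mulr0.
  have wz0 : w - z != 0 by rewrite subr_eq0.
  have := hd (w - z); rewrite subr0 => /(_ wd wz0).
  move=> /normc_lt /= /ltW h.
  rewrite -[F w - F z](mulVKf wz0) mulrC -mulrBl cabsM.
  rewrite ler_wpM2r ?cabs_ge0// cabsBC; apply: le_trans h.
  by rewrite /shift /= scaler1 subrK.
case=> l hl; apply/cvg_ex; exists l.
apply/(@cvgrPdist_lt _ _ _ (dnbhs (0 : R[i]^o))) => e e0.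
case: e e0 => a b /=; rewrite ltcE /= => /andP[/eqP b0 a0]; subst b.
have a20 : 0 < a / 2 by rewrite divr_gt0.
have [d d0 hd] := hl _ a20.
apply/near_cabsP; exists d => // h; rewrite subr0 => hd0 h0.
have := hd (h + z); rewrite addrK => /(_ hd0) hh.
apply: lt_normc; rewrite /shift /= scaler1.
rewrite -(@ltr_pM2r _ (cabs h)) ?cabs_gt0//.
apply: (@le_lt_trans _ _ (a / 2 * cabs h)); last first.
  by rewrite ltr_pM2r ?cabs_gt0// ltr_pdivrMr// ltr_pMr// ltrDl.
rewrite cabsBC -cabsM mulrBl -[_ *: _]/(h^-1 * (F (h + z) - F z)).
by rewrite mulrAC mulVf// mul1r.
Qed.

Lemma cderivable_comp F G z : derivable G z 1 -> derivable F (G z) 1 ->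
  derivable (F \o G) z 1.
Proof.
move=> /derivable1_diffP dG /derivable1_diffP dF.
apply/derivable1_diffP.
exact: (@differentiable_comp R[i] R[i]^o R[i]^o R[i]^o G F z dG dF).
Qed.

Lemma cderivable_continuous F z : derivable F z 1 -> {for z, continuous F}.
Proof. by move=> /derivable1_diffP; exact: differentiable_continuous. Qed.

End ComplexDerivative.

(** * Goursat's lemma on a rectangle *)

Section Goursat.
Variable R : realType.
Implicit Types (A B : R -> R -> R).

Lemma cont_on_cst (a b k : R) : cont_on a b (fun=> k).
Proof. by move=> x _; exact: cvg_cst. Qed.

Lemma itg_bound (f : R -> R) (a b k : R) : a <= b -> cont_on a b f ->
  (forall x, a <= x <= b -> `|f x| <= k) -> `|itg f a b| <= k * (b - a).
Proof.
move=> ab cf fk; rewrite ler_norml -mulNr -!itg_cst//.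
have h x : a <= x <= b -> - k <= f x <= k by move/fk; rewrite ler_norml.
apply/andP; split; apply: le_itg => //; try exact: cont_on_cst.
  by move=> x /h /andP[].
by move=> x /h /andP[].
Qed.

Definition fderiv (A : R -> R -> R) (x y ax ay : R) :=
  forall e : R, 0 < e -> exists2 d : R, 0 < d & forall x' y',
    `|x' - x| < d -> `|y' - y| < d ->
    `|A x' y' - A x y - ax * (x' - x) - ay * (y' - y)|
       <= e * (`|x' - x| + `|y' - y|).

(** The integral of the form [B dx + A dy] along the boundary, counterclockwise. *)
Definition boundary_integral A B x1 x2 y1 y2 : R :=
  itg (A x2) y1 y2 - itg (A x1) y1 y2 - (itg (B^~ y2) x1 x2 - itg (B^~ y1) x1 x2).

(** [A] and [B] are affine up to an error small compared with the size of the
    rectangle, and the boundary integral of affine [A] and [B] vanishes because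
    they share the coefficient [ax]: this is the Cauchy-Riemann equation. *)
Lemma boundary_integral_affine A B x y h k X Y ax ay bx d e :
  0 <= h -> 0 <= k -> 0 <= e -> h + k < d ->
  x <= X <= x + h -> y <= Y <= y + k ->
  cont_on y (y + k) (A x) -> cont_on y (y + k) (A (x + h)) ->
  cont_on x (x + h) (B^~ y) -> cont_on x (x + h) (B^~ (y + k)) ->
  (forall s t, `|s - X| < d -> `|t - Y| < d ->
    `|A s t - A X Y - ax * (s - X) - ay * (t - Y)| <= e * (`|s - X| + `|t - Y|)) ->
  (forall s t, `|s - X| < d -> `|t - Y| < d ->
    `|B s t - B X Y - bx * (s - X) - ax * (t - Y)| <= e * (`|s - X| + `|t - Y|)) ->
  `|boundary_integral A B x (x + h) y (y + k)| <= 2 * e * (h + k) ^+ 2.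
Proof.
move=> h0 k0 e0 hkd hX hY cA1 cA2 cB1 cB2 dA dB.
have xh : x <= x + h by rewrite lerDl.
have yk : y <= y + k by rewrite lerDl.
have hd : h < d by apply: le_lt_trans hkd; rewrite lerDl.
have kd : k < d by apply: le_lt_trans hkd; rewrite lerDr.
(* both subtracted constants integrate to ax * h * k, and cancel *)
have -> : boundary_integral A B x (x + h) y (y + k) =
   itg (fun t => (A (x + h) t - A x t) - ax * h) y (y + k) -
   itg (fun s => (B s (y + k) - B s y) - ax * k) x (x + h).
  rewrite /boundary_integral !itgB//; try exact: cont_on_cst.
  - rewrite !itg_cst//; ring.
  - by move=> s hs; apply: cvgB; [exact: cB2|exact: cB1].
  - by move=> s hs; apply: cvgB; [exact: cA2|exact: cA1].
apply: le_trans (ler_normB _ _) _.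
have -> : 2 * e * (h + k) ^+ 2 =
   2 * e * (h + k) * (y + k - y) + 2 * e * (h + k) * (x + h - x) by ring.
have absle (s t T l : R) : t <= s <= t + l -> t <= T <= t + l -> `|s - T| <= l.
  move=> /andP[s1 s2] /andP[t1 t2]; rewrite ler_distl lerBlDr.
  by rewrite (le_trans t2) ?(le_trans s2)//; apply: lerD.
have xx : x <= x <= x + h by rewrite lexx.
have xx' : x <= x + h <= x + h by rewrite lexx andbT.
have yy : y <= y <= y + k by rewrite lexx.
have yy' : y <= y + k <= y + k by rewrite lexx andbT.
have two (u v w : R) : `|u| <= e * (h + k) -> `|v| <= e * (h + k) -> w = u - v ->
    `|w| <= 2 * e * (h + k).
  move=> hu hv ->; apply: le_trans (ler_normB _ _) _.
  by apply: le_trans (lerD hu hv) _; rewrite -mulrA mulr2n mulrDl mul1r.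
have sA s t : x <= s <= x + h -> y <= t <= y + k ->
    `|A s t - A X Y - ax * (s - X) - ay * (t - Y)| <= e * (h + k).
  move=> /absle /(_ hX) hs /absle /(_ hY) ht.
  apply: le_trans (dA _ _ (le_lt_trans hs hd) (le_lt_trans ht kd)) _.
  by rewrite ler_wpM2l// lerD.
have sB s t : x <= s <= x + h -> y <= t <= y + k ->
    `|B s t - B X Y - bx * (s - X) - ax * (t - Y)| <= e * (h + k).
  move=> /absle /(_ hX) hs /absle /(_ hY) ht.
  apply: le_trans (dB _ _ (le_lt_trans hs hd) (le_lt_trans ht kd)) _.
  by rewrite ler_wpM2l// lerD.
apply: lerD; apply: itg_bound => //.
- move=> s hs; apply: cvgB; last exact: cvg_cst.
  by apply: cvgB; [exact: cA2|exact: cA1].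
- by move=> t ht; apply: two (sA _ _ xx' ht) (sA _ _ xx ht) _; ring.
- move=> s hs; apply: cvgB; last exact: cvg_cst.
  by apply: cvgB; [exact: cB2|exact: cB1].
- by move=> s hs; apply: two (sB _ _ hs yy') (sB _ _ hs yy) _; ring.
Qed.

Section Bisection.
Variables (A B : R -> R -> R) (a b c d : R).
Hypothesis cA : forall x, a <= x <= b -> cont_on c d (A x).
Hypothesis cB : forall y, c <= y <= d -> cont_on a b (B^~ y).
Hypothesis AB : forall x y, a <= x <= b -> c <= y <= d ->
  exists ax ay bx, fderiv A x y ax ay /\ fderiv B x y bx ax.

Let cont_onS (f : R -> R) x1 x2 u v : u <= x1 -> x2 <= v ->
  cont_on u v f -> cont_on x1 x2 f.
Proof.
move=> ux xv cf t /andP[xt tx]; apply: cf.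
by rewrite (le_trans ux xt) (le_trans tx xv).
Qed.

(** The integrals along the sides interior to the rectangle cancel, so the four
    quarters share the boundary integral and one of them has a quarter of it. *)
Lemma boundary_integral_quarter x y h k (M : R) : 0 <= h -> 0 <= k -> a <= x -> x + h <= b ->
  c <= y -> y + k <= d ->
  M <= `|boundary_integral A B x (x + h) y (y + k)| ->
  exists x' y', [/\ x <= x', x' + h / 2 <= x + h, y <= y', y' + k / 2 <= y + k &
    M / 4 <= `|boundary_integral A B x' (x' + h / 2) y' (y' + k / 2)|].
Proof.
move=> h0 k0 ax xb cy yd.
set x1 := x + h / 2; set y1 := y + k / 2.
have ex : x1 + h / 2 = x + h by rewrite /x1; lra.
have ey : y1 + k / 2 = y + k by rewrite /y1; lra.
have xx1 : x <= x1 by rewrite /x1; lra.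
have x1x : x1 <= x + h by rewrite /x1; lra.
have yy1 : y <= y1 by rewrite /y1; lra.
have y1y : y1 <= y + k by rewrite /y1; lra.
have catA t : a <= t <= b -> itg (A t) y (y + k) = itg (A t) y y1 + itg (A t) y1 (y + k).
  move=> tab; apply: itg_cat; first by rewrite yy1 y1y.
  by apply: cont_onS (cA tab).
have catB t : c <= t <= d ->
    itg (B^~ t) x (x + h) = itg (B^~ t) x x1 + itg (B^~ t) x1 (x + h).
  move=> tab; apply: itg_cat; first by rewrite xx1 x1x.
  by apply: cont_onS (cB tab).
have -> : boundary_integral A B x (x + h) y (y + k) =
  boundary_integral A B x x1 y y1 + boundary_integral A B x1 (x + h) y y1 +
  (boundary_integral A B x x1 y1 (y + k) + boundary_integral A B x1 (x + h) y1 (y + k)).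
  rewrite /boundary_integral !catA ?catB; try lra.
move=> hM.
have tri := le_trans (le_trans hM (ler_normD _ _))
  (lerD (ler_normD _ _) (ler_normD _ _)).
have [h1|h1] := leP (M / 4) `|boundary_integral A B x x1 y y1|.
  by exists x, y; split => //; lra.
have [h2|h2] := leP (M / 4) `|boundary_integral A B x1 (x + h) y y1|.
  by exists x1, y; rewrite ex; split => //; lra.
have [h3|h3] := leP (M / 4) `|boundary_integral A B x x1 y1 (y + k)|.
  by exists x, y1; rewrite ey; split => //; lra.
by exists x1, y1; rewrite ex ey; split => //; lra.
Qed.

Hypotheses (ab : a <= b) (cd : c <= d).

(** Keep the quarter with the largest boundary integral.  Near the common point
    of the nested rectangles the form is affine and closed up to an error small
    compared with the size, so its boundary integral is small compared with the
    area, that is, with [4 ^- n]. *)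
Lemma goursat_rectangle : boundary_integral A B a b c d = 0.
Proof.
pose h0 := b - a; pose k0 := d - c; pose M := `|boundary_integral A B a b c d|.
have h00 : 0 <= h0 by rewrite subr_ge0.
have k00 : 0 <= k0 by rewrite subr_ge0.
have p2 n : 0 < 2 ^+ n :> R by rewrite exprn_gt0.
pose H n := h0 / 2 ^+ n; pose K n := k0 / 2 ^+ n.
have H_ge0 n : 0 <= H n by rewrite divr_ge0// ltW.
have K_ge0 n : 0 <= K n by rewrite divr_ge0// ltW.
have HS n : H n.+1 = H n / 2 by rewrite /H exprSr invfM mulrA.
have KS n : K n.+1 = K n / 2 by rewrite /K exprSr invfM mulrA.
pose good n (u : R * R) := [/\ a <= u.1, u.1 + H n <= b, c <= u.2, u.2 + K n <= d &
  M / 4 ^+ n <= `|boundary_integral A B u.1 (u.1 + H n) u.2 (u.2 + K n)|].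
have /choice[step stepP] : forall s : nat * (R * R), exists v : R * R,
    good s.1 s.2 -> good s.1.+1 v /\
    [/\ s.2.1 <= v.1, v.1 + H s.1.+1 <= s.2.1 + H s.1,
        s.2.2 <= v.2 & v.2 + K s.1.+1 <= s.2.2 + K s.1].
  move=> [n [x y]]; have [g|ng] := pselect (good n (x, y)); last first.
    by exists (0, 0) => /ng.
  case: g => /= ax xb cy yd /(boundary_integral_quarter (H_ge0 n) (K_ge0 n) ax xb cy yd).
  move=> [x' [y' [xx x'x yy y'y hM]]]; exists (x', y') => _ /=.
  rewrite /good /= HS KS; split; last by split.
  split; [exact: le_trans xx|exact: le_trans xb|exact: le_trans yy|exact: le_trans yd|].
  by rewrite exprSr invfM mulrA.
pose u := fix u n := if n is m.+1 then step (m, u m) else (a, c).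
have gu n : good n (u n).
  elim: n => [|n IH]; last by have [] := stepP (n, u n) IH.
  rewrite /good /= /H /K expr0 !divr1 /h0 /k0 !subrKC.
  by split => //; rewrite expr0 divr1.
have nst n : [/\ (u n).1 <= (u n.+1).1, (u n.+1).1 + H n.+1 <= (u n).1 + H n,
    (u n).2 <= (u n.+1).2 & (u n.+1).2 + K n.+1 <= (u n).2 + K n].
  by have [] := stepP (n, u n) (gu n).
have nested (v : nat -> R) (L : nat -> R) : (forall n, 0 <= L n) ->
    (forall n, v n <= v n.+1) -> (forall n, v n.+1 + L n.+1 <= v n + L n) ->
    exists X, forall n, v n <= X <= v n + L n.
  move=> L0 vS LS.
  have vm : {homo v : m n / (m <= n)%N >-> m <= n} by apply: homo_leq => //; exact: le_trans.
  have lm : {homo (fun n => v n + L n) : m n / (m <= n)%N >-> n <= m}.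
    by apply: (@homo_leq _ _ (fun x y => y <= x)) => // x y z h1 h2; exact: le_trans h2 h1.
  have ub m n : v m <= v n + L n.
    have [mn|nm] := leqP m n; first by rewrite (le_trans (vm _ _ mn))// lerDl.
    by apply: le_trans (lm _ _ (ltnW nm)); rewrite lerDl.
  exists (sup (range v)) => n; apply/andP; split.
    apply: sup_upper_bound; last by exists n.
    split; first by exists (v 0); exists 0.
    by exists (v 0 + L 0) => _ [m _ <-]; exact: ub.
  by apply: sup_le_ub; [exists (v 0), 0|move=> _ [m _ <-]; exact: ub].
have [X hX] : exists X, forall n, (u n).1 <= X <= (u n).1 + H n.
  by apply: (nested (fun n => (u n).1)) => // n; have [] := nst n.
have [Y hY] : exists Y, forall n, (u n).2 <= Y <= (u n).2 + K n.
  by apply: (nested (fun n => (u n).2)) => // n; have [] := nst n.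
have Xab : a <= X <= b.
  by have := hX 0; rewrite /= /H expr0 divr1 /h0 subrKC.
have Ycd : c <= Y <= d.
  by have := hY 0; rewrite /= /K expr0 divr1 /k0 subrKC.
have [ax [ay [bx [dA dB]]]] := AB Xab Ycd.
pose S := (h0 + k0) ^+ 2.
have key e : 0 < e -> M <= 2 * e * S.
  move=> e0; have [d1 d10 hd1] := dA e e0; have [d2 d20 hd2] := dB e e0.
  pose del := Num.min d1 d2.
  have del0 : 0 < del by rewrite lt_min d10.
  have [n hn] : exists n, (h0 + k0) / 2 ^+ n < del.
    have [n hn] : exists n : nat, (h0 + k0) / del < n%:R.
      by exists (Num.bound ((h0 + k0) / del)); apply: archi_boundP;
        apply: divr_ge0; [exact: addr_ge0|exact: ltW].
    exists n; rewrite ltr_pdivrMr// mulrC -ltr_pdivrMr//.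
    apply: lt_le_trans hn _.
    by rewrite -natrX ler_nat ltnW// ltn_expl.
  have [g1 g2 g3 g4 gM] := gu n.
  move: gM; have /andP[X1 X2] := hX n; have /andP[Y1 Y2] := hY n.
  move: g1 g2 g3 g4 X1 X2 Y1 Y2; set x := (u n).1; set y := (u n).2.
  have HK : H n + K n = (h0 + k0) / 2 ^+ n by rewrite /H /K -mulrDl.
  have := H_ge0 n; have := K_ge0 n; have := HK.
  have -> : M / 4 ^+ n = M / (2 ^+ n) ^+ 2.
    by rewrite -exprM mulnC exprM; congr (_ / _ ^+ _); ring.
  set h := H n; set k := K n => HKE k_0 h_0 g1 g2 g3 g4 X1 X2 Y1 Y2 gM.
  have hkd : h + k < del by rewrite HKE.
  have {}gM : M <= `|boundary_integral A B x (x + h) y (y + k)| * (2 ^+ n) ^+ 2.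
    by rewrite -ler_pdivrMr// exprn_gt0.
  have cAn t : a <= t <= b -> cont_on y (y + k) (A t).
    by move=> tab; apply: cont_onS (cA tab).
  have cBn t : c <= t <= d -> cont_on x (x + h) (B^~ t).
    by move=> tab; apply: cont_onS (cB tab).
  have x1ab : a <= x <= b by lra.
  have x2ab : a <= x + h <= b by lra.
  have y1cd : c <= y <= d by lra.
  have y2cd : c <= y + k <= d by lra.
  have hb : `|boundary_integral A B x (x + h) y (y + k)| <= 2 * e * (h + k) ^+ 2.
    apply: (@boundary_integral_affine _ _ _ _ _ _ X Y ax ay bx del) => //; try exact: ltW.
    - by rewrite X1.
    - by rewrite Y1.
    - by apply: cAn.
    - by apply: cAn.
    - by apply: cBn.
    - by apply: cBn.
    - by move=> s t; rewrite !lt_min => /andP[s1 _] /andP[t1 _]; exact: hd1.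
    - by move=> s t; rewrite !lt_min => /andP[_ s2] /andP[_ t2]; exact: hd2.
  apply: le_trans gM _; apply: le_trans (ler_wpM2r (sqr_ge0 _) hb) _.
  by rewrite -(mulrA (2 * e)) -exprMn HKE divfK// gt_eqF.
have M0 : M <= 0.
  apply/ler_addgt0Pr => e e0; rewrite add0r.
  have S0 : 0 <= S by exact: sqr_ge0.
  have q : 0 < e / (2 * (S + 1)) by rewrite divr_gt0// mulr_gt0// ltr_wpDl.
  apply: le_trans (key _ q) _.
  have -> : 2 * (e / (2 * (S + 1))) * S = e * (S / (S + 1)) by field; lra.
  apply: ler_piMr; first exact: ltW.
  by rewrite ler_pdivrMr ?mul1r ?ltr_wpDl// lerDl.
by apply/eqP; rewrite -normr_le0.
Qed.

End Bisection.
End Goursat.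

(** * Circular means and the mean value property *)

Section Average.
Variable R : realType.
Implicit Types f g : R -> R.

Definition avg f : R := (2 * pi)^-1 * itg f 0 (2 * pi).

Lemma twopi_gt0 : 0 < 2 * pi :> R.
Proof. by rewrite mulr_gt0 ?pi_gt0. Qed.

Lemma continuous_cont_on f a b : continuous f -> cont_on a b f.
Proof. by move=> cf x _; exact: cf. Qed.

Lemma eq_avg f g : f =1 g -> avg f = avg g.
Proof. by move=> fg; congr avg; exact/funext. Qed.

Lemma avgD f g : continuous f -> continuous g ->
  avg (fun t => f t + g t) = avg f + avg g.
Proof.
by move=> cf cg; rewrite /avg itgD ?mulrDr//; exact: continuous_cont_on.
Qed.

Lemma avgB f g : continuous f -> continuous g ->
  avg (fun t => f t - g t) = avg f - avg g.
Proof.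
by move=> cf cg; rewrite /avg itgB ?mulrBr//; exact: continuous_cont_on.
Qed.

Lemma avgZ k f : continuous f -> avg (fun t => k * f t) = k * avg f.
Proof. by move=> cf; rewrite /avg itgZ 1?mulrCA//; exact: continuous_cont_on. Qed.

Lemma avg_cst k : avg (fun=> k) = k.
Proof.
by rewrite /avg itg_cst ?ltW ?twopi_gt0// subr0 mulrCA mulVf ?mulr1// gt_eqF// twopi_gt0.
Qed.

Lemma le_avg f g : continuous f -> continuous g -> (forall t, f t <= g t) ->
  avg f <= avg g.
Proof.
move=> cf cg fg; rewrite /avg ler_wpM2l ?invr_ge0 ?(ltW twopi_gt0)//.
by apply: le_itg => //; exact: continuous_cont_on.
Qed.

Lemma continuous_cst (k : R) : continuous (fun _ : R => k).
Proof. by move=> x; exact: cvg_cst. Qed.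

Lemma avg_ge0 f : continuous f -> (forall t, 0 <= f t) -> 0 <= avg f.
Proof. by move=> cf f0; rewrite -[leLHS]avg_cst le_avg//; exact: continuous_cst. Qed.

Lemma avg_le_cst f k : continuous f -> (forall t, f t <= k) -> avg f <= k.
Proof. by move=> cf f0; rewrite -[leRHS]avg_cst le_avg//; exact: continuous_cst. Qed.

Lemma avg_ge_cst f k : continuous f -> (forall t, k <= f t) -> k <= avg f.
Proof. by move=> cf f0; rewrite -[leLHS]avg_cst le_avg//; exact: continuous_cst. Qed.

Lemma avg_norm_le f k e : continuous f -> (forall t, `|f t - k| <= e) ->
  `|avg f - k| <= e.
Proof.
move=> cf fe; rewrite ler_distl avg_ge_cst ?avg_le_cst// => t;
  by have := fe t; rewrite ler_distl => /andP[].
Qed.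

End Average.

Section ComplexExp.
Variable R : realType.

Definition cexp (w : Cplx R) : Cplx R := circle_pt (expR (complex.Re w)) (complex.Im w).

Lemma real_derive_eps (f : R -> R) (x l : R) : is_derive x 1 f l ->
  forall e : R, 0 < e -> exists2 d : R, 0 < d & forall h, `|h| < d ->
    `|f (x + h) - f x - l * h| <= e * `|h|.
Proof.
move=> df e e0.
have [dfx dfl] := df.
have hl : (h^-1 *: (f (h + x) - f x)) @[h --> 0^'] --> l.
  move: dfx dfl; rewrite /derivable /derive /= => /cvg_ex[/= k].
  under eq_fun do rewrite scaler1; move=> hk.
  by rewrite (cvg_lim _ hk)// => <-.
move/cvgrPdist_lt : hl => /(_ _ e0) [d /= d0 hd].
exists d => // h hd1; have [->|h0] := eqVneq h 0.
  by rewrite addr0 subrr mulr0 subr0 normr0 mulr0.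
have := hd h; rewrite /= sub0r normrN => /(_ hd1 h0) /ltW hh.
rewrite -[f (x + h) - f x](mulVKf h0) mulrC -mulrBl normrM ler_wpM2r//.
by rewrite distrC [x + h]addrC.
Qed.

Lemma cexpD z w : cexp (z + w) = cexp z * cexp w.
Proof.
case: z w => [a b] [c d].
rewrite -[(a +i* b)%C + (c +i* d)%C]/((a + c) +i* (b + d))%C /cexp /= expRD /circle_pt.
by rewrite cosD sinD; apply/eqP; rewrite eq_complex /=;
  apply/andP; split; apply/eqP; ring.
Qed.

Lemma cabs_cexp w : cabs (cexp w) = expR (complex.Re w).
Proof. by rewrite /cexp cabs_circle_pt gtr0_norm// expR_gt0. Qed.

(** Differentiability at the origin; by [cexpD] this is all that is needed
    elsewhere. *)
Lemma cexp_near0 (e : R) : 0 < e -> exists2 d : R, 0 < d & forall h, cabs h < d ->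
  cabs (cexp h - 1 - h) <= e * cabs h.
Proof.
move=> e0; pose e1 := Num.min (e / 12) (1 / 2).
have e10 : 0 < e1 by rewrite lt_min !divr_gt0.
have e1e : e1 <= e / 12 by rewrite ge_min lexx.
have e1h : e1 <= 1 / 2 by rewrite ge_min lexx orbT.
clearbody e1.
have [d1 d10 h1] := real_derive_eps (is_derive_expR (0 : R)) e10.
have [d2 d20 h2] := real_derive_eps (is_derive_cos (0 : R)) e10.
have [d3 d30 h3] := real_derive_eps (is_derive_sin (0 : R)) e10.
exists (Num.min (Num.min d1 d2) (Num.min d3 e1)).
  by rewrite !lt_min d10 d20 d30 e10.
move=> h; rewrite !lt_min => /andP[/andP[hd1 hd2] /andP[hd3 hd4]].
have := Re_le_cabs h; have := Im_le_cabs h; have := cabs_ge0 h.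
move: hd1 hd2 hd3 hd4; set n := cabs h.
case: h @n => x y n hd1 hd2 hd3 hd4 n0 hy0 hx0.
have {hy0} hy : `|y| <= n := hy0.
have {hx0} hx : `|x| <= n := hx0.
have := h1 x (le_lt_trans hx hd1); rewrite add0r expR0 mul1r => {}h1.
have := h2 y (le_lt_trans hy hd2); rewrite add0r cos0 sin0 oppr0 mul0r subr0 => {}h2.
have := h3 y (le_lt_trans hy hd3); rewrite add0r cos0 sin0 mul1r subr0 => {}h3.
have q1 : `|expR x - 1 - x| <= e1 * n.
  by apply: le_trans h1 _; rewrite ler_pM2l.
have q2 : `|cos y - 1| <= e1 * n by apply: le_trans h2 _; rewrite ler_pM2l.
have q3 : `|sin y - y| <= e1 * n by apply: le_trans h3 _; rewrite ler_pM2l.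
have n1 : n <= e1 by exact: ltW.
have e1n : e1 * n <= 1 / 2 * n by rewrite ler_wpM2r.
have q4 : `|expR x| <= 2.
  rewrite (_ : expR x = (expR x - 1 - x) + (1 + x)); last by ring.
  apply: le_trans (ler_normD _ _) _.
  by have := ler_normD 1 x; rewrite normr1; lra.
have q5 : `|expR x - 1| <= 2 * n.
  rewrite (_ : expR x - 1 = (expR x - 1 - x) + x); last by ring.
  apply: le_trans (ler_normD _ _) _; lra.
have q6 : `|sin y| <= 2 * n.
  rewrite (_ : sin y = (sin y - y) + y); last by ring.
  apply: le_trans (ler_normD _ _) _; lra.
apply: le_trans (cabs_le _) _ => /=. 
rewrite [X in `|X| + _](_ : _ = (expR x - 1 - x) + expR x * (cos y - 1)); last by ring.
rewrite [X in _ + `|X|](_ : _ = (expR x - 1) * sin y + (sin y - y)); last by ring.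
apply: le_trans (lerD (ler_normD _ _) (ler_normD _ _)) _.
rewrite !normrM.
have t1 : `|expR x| * `|cos y - 1| <= 2 * (e1 * n) by apply: ler_pM.
have t2 : `|expR x - 1| * `|sin y| <= (2 * n) * (2 * n) by apply: ler_pM.
have t3 : n * n <= e1 * n by rewrite ler_wpM2r.
have t4 : e1 * n <= e / 12 * n by rewrite ler_wpM2r.
have t5 : 0 <= e * n by rewrite mulr_ge0// ltW.
lra.
Qed.

Lemma cexp_derivable w : derivable cexp w 1.
Proof.
apply/cderivableP; exists (cexp w) => e e0.
have E0 := expR_gt0 (complex.Re w).
have [d d0 hd] := cexp_near0 (divr_gt0 e0 E0).
exists d => // v /hd hv.
rewrite -{1}(subrKC w v) cexpD.
rewrite (_ : _ - _ = cexp w * (cexp (v - w) - 1 - (v - w))); last by ring.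
rewrite cabsM cabs_cexp mulrC -ler_pdivlMr//.
by apply: le_trans hv _; rewrite mulrAC.
Qed.

End ComplexExp.

Section MeanValue.
Variable R : realType.

Lemma continuous_circle (T : topologicalType) (phi : Cplx R -> T) c r :
  (forall t, {for c + circle_pt r t, continuous phi}) ->
  continuous (fun t => phi (c + circle_pt r t)).
Proof.
move=> cphi t; apply: (@continuous_comp _ _ _ (fun t => c + circle_pt r t) phi); last exact:
  cphi.
apply: (@cvgD (R[i]) (R[i]^o)); [exact: cvg_cst|exact: continuous_circle_pt].
Qed.

Lemma circle_pt_2pi (r : R) : circle_pt r (2 * pi) = circle_pt r 0.
Proof. by rewrite /circle_pt mulr_natl cos2pi sin2pi cos0 sin0. Qed.

Lemma circle_ptB c (r t : R) : cabs (c + circle_pt r t - c) = `|r|.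
Proof. by rewrite addrC addKr cabs_circle_pt. Qed.

(** Goursat's lemma applied to [F (c + cexp w)] on a rectangle of height
    [2 * pi]: the horizontal sides cancel by periodicity, so the mean over a
    circle about [c] does not depend on the radius.  Small radii give [F c]. *)
Theorem mean_value (F : Cplx R -> Cplx R) c r : 0 <= r ->
  (forall z, cabs (z - c) <= r -> derivable F z 1) ->
  avg (fun t => complex.Re (F (c + circle_pt r t))) = complex.Re (F c).
Proof.
rewrite le_eqVlt => /predU1P[<- _|r0 dF].
  rewrite -[RHS]avg_cst; apply: eq_avg => t.
  by rewrite circle_ptE mul0r addr0.
have cR rho : 0 < rho -> rho <= r ->
    continuous (fun t => complex.Re (F (c + circle_pt rho t))).
  move=> rho0 rhor; apply: (@continuous_circle R (fun z => complex.Re (F z))) => t.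
  apply: (@continuous_comp _ _ _ F); last exact: continuous_Re.
  by apply: cderivable_continuous; apply: dF; rewrite circle_ptB gtr0_norm.
have indep rho : 0 < rho -> rho <= r ->
    avg (fun t => complex.Re (F (c + circle_pt rho t))) =
    avg (fun t => complex.Re (F (c + circle_pt r t))).
  move=> rho0 rhor.
  pose G w := F (c + cexp w).
  have dG w : complex.Re w <= ln r -> derivable G w 1.
    move=> wr; apply: (@cderivable_comp _ F (fun w => c + cexp w)).
      apply: (@derivableD _ _ _ (cst c)); first exact: derivable_cst.
      exact: cexp_derivable.
    apply: dF; rewrite addrC addKr cabs_cexp -[leRHS]lnK ?posrE//.
    by rewrite ler_expR.
  pose A x y := complex.Re (G (x +i* y)%C).
  pose B x y := complex.Im (G (x +i* y)%C).
  have contG x y : x <= ln r -> {for (x +i* y)%C : Cplx R, continuous G}.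
    by move=> xr; apply: cderivable_continuous; exact: dG.
  have g0 : boundary_integral A B (ln rho) (ln r) 0 (2 * pi) = 0.
    apply: goursat_rectangle.
    - move=> x /andP[_ xr] y _.
      apply: (@continuous_comp _ _ _ (fun y => G (x +i* y)%C) (@complex.Re R)); last exact:
        continuous_Re.
      apply: (@continuous_comp _ _ _ (fun y => (x +i* y)%C : Cplx R)); last exact: contG.
      by apply: (@continuous_Complex _ R (cst x) id); [exact: cvg_cst|exact: cvg_id].
    - move=> y _ x /andP[_ xr].
      apply: (@continuous_comp _ _ _ (fun x => G (x +i* y)%C) (@complex.Im R)); last exact:
        continuous_Im.
      apply: (@continuous_comp _ _ _ (fun x => (x +i* y)%C : Cplx R)); last exact: contG.
      by apply: (@continuous_Complex _ R id (cst y)); [exact: cvg_id|exact: cvg_cst].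
    - move=> x y /andP[_ xr] _.
      have /cderivableP[[l1 l2] hl] := dG (x +i* y)%C xr.
      exists l1, (- l2), l2; split => e e0; have [d d0 hd] := hl _ e0;
        (exists (d / 2); first by rewrite divr_gt0) => x' y' xd yd;
        have le1 := cabs_le ((x' +i* y')%C - (x +i* y)%C : Cplx R);
        rewrite /= in le1;
        (have /hd : cabs ((x' +i* y')%C - (x +i* y)%C : Cplx R) < d
          by apply: le_lt_trans le1 _; rewrite (splitr d) ltrD);
        move=> hh; apply: (@le_trans _ _ (e * cabs ((x' +i* y')%C - (x +i* y)%C : Cplx R)));
        rewrite ?ler_pM2l//; apply: le_trans hh.
      + apply: le_trans (Re_le_cabs _); rewrite /A.
        case: (G _) (G _) => [a1 a2] [b1 b2] /=.
        by rewrite le_eqVlt; apply/orP; left; apply/eqP; congr `|_|; ring.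
      + apply: le_trans (Im_le_cabs _); rewrite /B.
        case: (G _) (G _) => [a1 a2] [b1 b2] /=.
        by rewrite le_eqVlt; apply/orP; left; apply/eqP; congr `|_|; ring.
    - by rewrite ler_ln.
    - exact: ltW (twopi_gt0 _).
  have AE s : 0 < s -> A (ln s) = fun t => complex.Re (F (c + circle_pt s t)).
    by move=> s0; apply/funext => t; rewrite /A /G /cexp /= lnK.
  have BE : B^~ (2 * pi) = B^~ 0.
    by apply/funext => t; rewrite /B /G /cexp /= circle_pt_2pi.
  have eB : itg (B^~ (2 * pi)) (ln rho) (ln r) = itg (B^~ 0) (ln rho) (ln r).
    exact: (congr1 (fun f => itg f (ln rho) (ln r)) BE).
  have eA : itg (A (ln r)) 0 (2 * pi) = itg (A (ln rho)) 0 (2 * pi).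
    apply/eqP; rewrite -subr_eq0; apply/eqP.
    by rewrite -[RHS]g0 /boundary_integral eB (subrr (itg (B^~ 0) (ln rho) (ln r))) subr0.
  by rewrite /avg -(AE _ rho0) -(AE _ r0) eA.
apply/eqP; rewrite -subr_eq0 -normr_le0; apply/ler_addgt0Pr => e e0; rewrite add0r.
have cF : {for c, continuous (fun z => complex.Re (F z))}.
  apply: (@continuous_comp _ _ _ F); last exact: continuous_Re.
  by apply: cderivable_continuous; apply: dF; rewrite subrr cabs0 ltW.
have /continuous_cabsP /(_ _ e0) [d d0 hd] := cF.
pose rho := Num.min (d / 2) r.
have rho0 : 0 < rho by rewrite lt_min r0 divr_gt0.
have rhor : rho <= r by rewrite ge_min lexx orbT.
rewrite -(indep _ rho0 rhor); apply: avg_norm_le; first exact: cR.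
move=> t; apply/ltW/hd; rewrite circle_ptB gtr0_norm//.
apply: (@le_lt_trans _ _ (d / 2)); first by rewrite ge_min lexx.
by rewrite ltr_pdivrMr// ltr_pMr// ltrDl.
Qed.

End MeanValue.

(** * Exchanging two circular means *)

Section Tonelli.
Local Open Scope ereal_scope.

Lemma tonelli_restricted d1 d2 (T1 : measurableType d1) (T2 : measurableType d2)
    (R : realType) (m1 : {sigma_finite_measure set T1 -> \bar R})
    (m2 : {sigma_finite_measure set T2 -> \bar R})
    (D1 : set T1) (D2 : set T2) (K : T1 -> T2 -> R) :
  measurable D1 -> measurable D2 ->
  measurable_fun setT (fun u : T1 * T2 => K u.1 u.2) ->
  (forall s t, (0 <= K s t)%R) ->
  \int[m1]_(s in D1) \int[m2]_(t in D2) (K s t)%:E =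
  \int[m2]_(t in D2) \int[m1]_(s in D1) (K s t)%:E.
Proof.
move=> mD1 mD2 mK K0.
pose f : T1 * T2 -> \bar R := fun u => (K u.1 u.2 * \1_D1 u.1 * \1_D2 u.2)%:E.
have mf : measurable_fun setT f.
  apply/measurable_EFinP; apply: measurable_funM.
    apply: measurable_funM => //.
    by apply: measurableT_comp; [exact: measurable_indic|exact: measurable_fst].
  by apply: measurableT_comp; [exact: measurable_indic|exact: measurable_snd].
have f0 u : 0 <= f u by rewrite lee_fin !mulr_ge0.
have := fubini_tonelli (m1 := m1) (m2 := m2) f mf f0.
have restr d (T : measurableType d) (mu : {measure set T -> \bar R})
    (D : set T) (g : T -> \bar R) : measurable D ->
    \int[mu]_(x in D) g x = \int[mu]_x (g x * (\1_D x)%:E).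
  move=> mD; rewrite integral_mkcond; apply: eq_integral => x _.
  by rewrite patchE indicE; case: ifPn => _; rewrite ?mule1 ?mule0.
have e1 s : \int[m2]_y f (s, y) =
    (\int[m2]_(t in D2) (K s t)%:E) * (\1_D1 s)%:E.
  rewrite [in RHS]restr// /f /= [\1_D1 s]indicE; case: (s \in D1) => /=.
    by rewrite mule1; apply: eq_integral => y _; rewrite mulr1 EFinM.
  by rewrite mule0; apply: integral0_eq => y _; rewrite mulr0 mul0r.
have e2 t : \int[m1]_x f (x, t) =
    (\int[m1]_(s in D1) (K s t)%:E) * (\1_D2 t)%:E.
  rewrite [in RHS]restr// /f /= [\1_D2 t]indicE; case: (t \in D2) => /=.
    by rewrite mule1; apply: eq_integral => y _; rewrite mulr1 EFinM.
  by rewrite mule0; apply: integral0_eq => y _; rewrite mulr0.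
under eq_integral do rewrite e1.
under [in RHS]eq_integral do rewrite e2.
by rewrite -!restr.
Qed.

End Tonelli.

Section AverageSwap.
Variable R : realType.
Let mu := @lebesgue_measure R.
Let D : set (measurableTypeR R) := `[0, 2 * pi]%classic.

Lemma avg_swap (K : R -> R -> R) :
  measurable_fun setT
    (fun u : measurableTypeR R * measurableTypeR R => K u.1 u.2) ->
  (forall s t, 0 <= K s t) ->
  (forall s, continuous (K s)) -> (forall t, continuous (K^~ t)) ->
  avg (fun s => avg (K s)) = avg (fun t => avg (K^~ t)).
Proof.
move=> mK K0 cK1 cK2.
have fin1 (g : R -> R) : continuous g ->
    (\int[mu]_(t in D) (g t)%:E)%E \is a fin_num.
  move=> cg.
  have ig := cont_on_integrable (@continuous_cont_on _ g 0 (2 * pi) cg).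
  by apply: (integrable_fin_num _ ig); exact: measurable_itv.
pose c : R := (2 * pi)^-1.
have c0 : 0 <= c by rewrite invr_ge0 ltW// twopi_gt0.
have outer (H : R -> R -> R) : (forall s, continuous (H s)) ->
   avg (fun s => avg (H s)) =
   c * fine (\int[mu]_(s in D) \int[mu]_(t in D) (c * H s t)%:E)%E.
  move=> cH; rewrite {1}/avg -/c; congr (_ * fine _).
  apply: eq_integral => s _; rewrite /avg -itgZ; last exact: continuous_cont_on.
  rewrite /itg /Rintegral fineK//; apply: fin1 => t.
  by apply: cvgM; [exact: cvg_cst|exact: cH].
rewrite (outer K cK1) (outer (fun t s => K s t) cK2); congr (_ * fine _).
apply: (@tonelli_restricted _ _ _ _ _ mu mu D D (fun s t => c * K s t)) => //.
  exact: measurable_itv.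
  exact: measurable_itv.
  by apply: measurable_funM => //; exact: measurable_cst.
by move=> s t; rewrite mulr_ge0.
Qed.

End AverageSwap.

(** * The Poisson kernel *)

Arguments cabs : simpl never.

Section Poisson.
Variable R : realType.
Implicit Types (z w : Cplx R) (t s : R) (f : R -> R).

Definition poisson_kernel z t : R := (1 - cabs z ^+ 2) / cabs (eit t - z) ^+ 2.

Definition poisson f z : R := avg (fun t => poisson_kernel z t * f t).

Lemma eit_dist_ge z t : 1 - cabs z <= cabs (eit t - z).
Proof. by rewrite -(cabs_eit t); exact: cabsB. Qed.

Lemma eit_dist_gt0 z t : cabs z < 1 -> 0 < cabs (eit t - z).
Proof. by move=> z1; apply: lt_le_trans (eit_dist_ge _ _); rewrite subr_gt0. Qed.

Lemma eit_dist_le z t : cabs (eit t - z) <= 1 + cabs z.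
Proof. by rewrite -(cabs_eit t) -(cabsN z); exact: cabsD. Qed.

Lemma poisson_kernel_num_gt0 z : cabs z < 1 -> 0 < 1 - cabs z ^+ 2.
Proof. by move=> z1; rewrite subr_gt0 expr_lt1// cabs_ge0. Qed.

Lemma poisson_kernel_gt0 z t : cabs z < 1 -> 0 < poisson_kernel z t.
Proof.
move=> z1; rewrite /poisson_kernel divr_gt0// ?poisson_kernel_num_gt0// exprn_gt0//.
exact: eit_dist_gt0.
Qed.

Lemma poisson_kernel_ge0 z t : cabs z < 1 -> 0 <= poisson_kernel z t.
Proof. by move=> z1; rewrite ltW// poisson_kernel_gt0. Qed.

Lemma poisson_kernel_dist_sqr z t : cabs z < 1 ->
  poisson_kernel z t * cabs (eit t - z) ^+ 2 = 1 - cabs z ^+ 2.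
Proof.
by move=> z1; rewrite /poisson_kernel divfK// expf_eq0/= gt_eqF// eit_dist_gt0.
Qed.

Lemma poisson_kernel_dist z t : cabs z < 1 -> poisson_kernel z t * cabs (eit t - z) <= 2.
Proof.
move=> z1; have d0 := eit_dist_gt0 t z1.
rewrite -(ler_pM2r d0) -mulrA -expr2 poisson_kernel_dist_sqr//.
have := eit_dist_ge z t; have := cabs_ge0 z; nra.
Qed.

Lemma poisson_kernel_le z t : cabs z < 1 -> poisson_kernel z t <= 2 / (1 - cabs z).
Proof.
move=> z1; rewrite ler_pdivlMr ?subr_gt0//.
apply: le_trans (poisson_kernel_dist t z1); rewrite ler_wpM2l ?poisson_kernel_ge0//.
exact: eit_dist_ge.
Qed.

Lemma eit_distE z t : cabs (eit t - z) ^+ 2 =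
  (cos t - complex.Re z) ^+ 2 + (sin t - complex.Im z) ^+ 2.
Proof. by rewrite cabs_sqr; case: z. Qed.

Lemma continuous_eit : continuous (@eit R).
Proof.
move=> t; apply: (@continuous_Complex R R (@cos R) (@sin R));
  [exact: continuous_cos|exact: continuous_sin].
Qed.

Lemma continuous_distC (T : topologicalType) (a b : T -> Cplx R) (x : T) :
  {for x, continuous a} -> {for x, continuous b} ->
  {for x, continuous (fun y => cabs (a y - b y))}.
Proof.
move=> ca cb; apply: (@continuous_comp _ _ _ (fun y => a y - b y) (@cabs R)).
  apply: (@cvgB (R[i]) (R[i]^o)).
    exact: ca.
    exact: cb.
exact: continuous_cabs.
Qed.

Lemma continuous_sqr (T : topologicalType) (a : T -> R) (x : T) :
  {for x, continuous a} -> {for x, continuous (fun y => a y ^+ 2)}.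
Proof.
move=> ca; apply: (@continuous_comp _ _ _ a (fun a : R => a ^+ 2)) => //.
exact: exprn_continuous.
Qed.

Lemma continuous_poisson_kernel (T : topologicalType) (W : T -> Cplx R) (th : T -> R) (x : T) :
  {for x, continuous W} -> {for x, continuous th} -> cabs (W x) < 1 ->
  {for x, continuous (fun y => poisson_kernel (W y) (th y))}.
Proof.
move=> cW cth W1; apply: cvgM.
  apply: cvgB; first exact: cvg_cst.
  apply: (@continuous_sqr T (fun y => cabs (W y))).
  by apply: (@continuous_comp _ _ _ W) => //; exact: continuous_cabs.
apply: cvgV; first by rewrite expf_eq0/= gt_eqF// eit_dist_gt0.
apply: (@continuous_sqr T (fun y => cabs (eit (th y) - W y))).
apply: continuous_distC; last exact: cW.
apply: (@continuous_comp _ _ _ th); first exact: cth.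
exact: continuous_eit.
Qed.

Lemma continuous_poisson_kernel_t z : cabs z < 1 -> continuous (poisson_kernel z).
Proof.
move=> z1 t; apply: (@continuous_poisson_kernel _ (cst z) id) => //; exact: cvg_cst.
Qed.

Lemma continuous_poisson_kernelM z f : cabs z < 1 -> continuous f ->
  continuous (fun t => poisson_kernel z t * f t).
Proof. by move=> z1 cf t; apply: cvgM; [exact: continuous_poisson_kernel_t|exact: cf]. Qed.

Lemma Re_div (a b : Cplx R) : complex.Re (a / b) =
  (complex.Re a * complex.Re b + complex.Im a * complex.Im b) / cabs b ^+ 2.
Proof.
rewrite cabs_sqr; case: a b => [a1 a2] [b1 b2].
rewrite -[(a1 +i* a2)%C / _]/((a1 +i* a2)%C * (b1 / (b1 ^+ 2 + b2 ^+ 2) -i* (b2 / (b1 ^+ 2 +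
  b2 ^+ 2)))%C).
rewrite /= mulrN opprK !mulrA -mulrDl.
by [].
Qed.

(** This makes the kernel harmonic in the interior point [z]. *)
Lemma poisson_kernel_herglotz z t : poisson_kernel z t = complex.Re ((eit t + z) / (eit t - z)).
Proof.
rewrite Re_div /poisson_kernel; congr (_ / _); rewrite cabs_sqr.
have := cos2Dsin2 t; case: z => [a b] /= h.
by rewrite -[X in X - _]h; ring.
Qed.

(** The same kernel, as the real part of a function analytic in the boundary
    point; this is how its mean over the boundary is computed. *)
Lemma poisson_kernel_herglotz_conj z t :
  poisson_kernel z t = complex.Re ((1 + conjc z * eit t) / (1 - conjc z * eit t)).
Proof.
rewrite Re_div /poisson_kernel !cabs_sqr.
have := cos2Dsin2 t; case: z => [a b] /= h; congr (_ / _).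
  transitivity (1 - (a ^+ 2 + b ^+ 2) * (cos t ^+ 2 + sin t ^+ 2)); last by ring.
  by rewrite h mulr1.
transitivity ((cos t ^+ 2 + sin t ^+ 2) + (a ^+ 2 + b ^+ 2) - 2 * (a * cos t + b * sin t));
  first by ring.
transitivity (1 + (a ^+ 2 + b ^+ 2) * (cos t ^+ 2 + sin t ^+ 2) - 2 * (a * cos t + b * sin
  t)); last by ring.
by rewrite h mulr1.
Qed.

Lemma circle_pt1 t : circle_pt 1 t = eit t :> Cplx R.
Proof. by rewrite circle_ptE mul1r. Qed.

Lemma derivable_mobius (a b c d : Cplx R) w : c + d * w != 0 ->
  derivable (fun u : Cplx R => (a + b * u) / (c + d * u)) w 1.
Proof.
move=> h.
have dl (k l : Cplx R) : derivable (fun u : Cplx R => k + l * u) w 1.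
  apply: (@derivableD _ _ _ (cst k)); first exact: derivable_cst.
  by apply: (@derivableM _ _ (cst l)); [exact: derivable_cst|exact: derivable_id].
apply: (@derivableM _ _ (fun u => a + b * u)); first exact: dl.
by apply: derivableV => //; exact: dl.
Qed.

Lemma avg_poisson_kernel z : cabs z < 1 -> avg (poisson_kernel z) = 1.
Proof.
move=> z1.
pose F (u : Cplx R) : Cplx R := (1 + conjc z * u) / (1 + - conjc z * u).
have -> : avg (poisson_kernel z) = avg (fun t => complex.Re (F (0 + circle_pt 1 t))).
  by apply: eq_avg => t; rewrite add0r circle_pt1 poisson_kernel_herglotz_conj /F mulNr.
rewrite mean_value//; first by rewrite /F !mulr0 !addr0 divr1.
move=> u; rewrite subr0 => u1; apply: derivable_mobius.
rewrite mulNr subr_eq0; apply/eqP => /(congr1 (@cabs R)); rewrite cabs1 cabsM.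
have -> : cabs (conjc z) = cabs z by case: (z) => a b; rewrite !cabsE /= sqrrN.
have := cabs_ge0 z; have := cabs_ge0 u; nra.
Qed.

Lemma poisson_cst z k : cabs z < 1 -> poisson (fun=> k) z = k.
Proof.
move=> z1; rewrite /poisson -[RHS]mulr1 -(avg_poisson_kernel z1) -avgZ; last exact:
  continuous_poisson_kernel_t.
by apply: eq_avg => t; rewrite mulrC.
Qed.

Lemma le_poisson f g z : cabs z < 1 -> continuous f -> continuous g ->
  (forall t, f t <= g t) -> poisson f z <= poisson g z.
Proof.
move=> z1 cf cg fg; apply: le_avg; try exact: continuous_poisson_kernelM.
by move=> t; rewrite ler_wpM2l ?poisson_kernel_ge0.
Qed.

Lemma poisson_ge0 f z : cabs z < 1 -> continuous f -> (forall t, 0 <= f t) -> 0 <= poisson f z.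
Proof. by move=> z1 cf f0; rewrite -[leLHS](poisson_cst 0 z1) le_poisson//; exact:
  continuous_cst. Qed.

Lemma poissonD f g z : cabs z < 1 -> continuous f -> continuous g ->
  poisson (fun t => f t + g t) z = poisson f z + poisson g z.
Proof.
move=> z1 cf cg; rewrite /poisson -avgD; try exact: continuous_poisson_kernelM.
by apply: eq_avg => t; rewrite mulrDr.
Qed.

Lemma poissonZ k f z : cabs z < 1 -> continuous f -> poisson (fun t => k * f t) z =
  k * poisson f z.
Proof.
move=> z1 cf; rewrite /poisson -avgZ; last exact: continuous_poisson_kernelM.
by apply: eq_avg => t; rewrite mulrCA.
Qed.

Lemma poisson_le_avg f z : cabs z < 1 -> continuous f -> (forall t, 0 <= f t) ->
  poisson f z <= 2 / (1 - cabs z) * avg f.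
Proof.
move=> z1 cf f0; rewrite -avgZ//; apply: le_avg; first exact: continuous_poisson_kernelM.
  by move=> t; apply: cvgM; [exact: cvg_cst|exact: cf].
by move=> t; rewrite ler_wpM2r// poisson_kernel_le.
Qed.

Lemma poisson_dist_sqr z : cabs z < 1 -> poisson (fun t => cabs (eit t - z) ^+ 2) z =
  1 - cabs z ^+ 2.
Proof.
by move=> z1; rewrite -[RHS]avg_cst; apply: eq_avg => t; rewrite poisson_kernel_dist_sqr.
Qed.

End Poisson.

(** * Circular means of Poisson integrals *)

Section PoissonMean.
Variable R : realType.
Implicit Types (z w : Cplx R) (t s : R) (f : R -> R).

Lemma avg_poisson (gam : R -> Cplx R) f : continuous gam ->
  (forall s, cabs (gam s) < 1) -> continuous f -> (forall t, 0 <= f t) ->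
  avg (fun s => poisson f (gam s)) =
    avg (fun t => f t * avg (fun s => poisson_kernel (gam s) t)).
Proof.
move=> cg g1 cf f0.
have cPK t : continuous (fun s => poisson_kernel (gam s) t).
  by move=> s; apply: (@continuous_poisson_kernel R R gam (cst t)) => //; [exact: cg|exact:
    cvg_cst].
rewrite /poisson (@avg_swap R (fun s t => poisson_kernel (gam s) t * f t)); first last.
- by move=> t s; apply: cvgM; [exact: cPK|exact: cvg_cst].
- by move=> s; exact: continuous_poisson_kernelM.
- by move=> s t; rewrite mulr_ge0// poisson_kernel_ge0.
- have mcont (h : R -> R) : continuous h -> measurable_fun setT (h :
  measurableTypeR R -> measurableTypeR R).
    by move=> ch; exact: continuous_measurable_fun.
  have m1 (h : R -> R) : continuous h -> measurable_fun setT
      (fun u : measurableTypeR R * measurableTypeR R => h u.1).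
    by move=> ch; apply: measurableT_comp; [exact: mcont|exact: measurable_fst].
  have m2 (h : R -> R) : continuous h -> measurable_fun setT
      (fun u : measurableTypeR R * measurableTypeR R => h u.2).
    by move=> ch; apply: measurableT_comp; [exact: mcont|exact: measurable_snd].
  have cRe : continuous (fun s => complex.Re (gam s)).
    by move=> s; apply: (@continuous_comp _ _ _ gam); [exact: cg|exact: continuous_Re].
  have cIm : continuous (fun s => complex.Im (gam s)).
    by move=> s; apply: (@continuous_comp _ _ _ gam); [exact: cg|exact: continuous_Im].
  have ccs : continuous (fun s => 1 - cabs (gam s) ^+ 2).
    move=> s; apply: cvgB; first exact: cvg_cst.
    apply: (@continuous_sqr R R (fun y => cabs (gam y))).
    by apply: (@continuous_comp _ _ _ gam); [exact: cg|exact: continuous_cabs].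
  apply: measurable_funM; last exact: m2.
  pose Dn (u : measurableTypeR R * measurableTypeR R) :=
    (cos u.2 - complex.Re (gam u.1)) ^+ 2 + (sin u.2 - complex.Im (gam u.1)) ^+ 2.
  rewrite (_ : (fun _ => _) = (fun u => (1 - cabs (gam u.1) ^+ 2) * (Dn u `^ (-1))));
    last first.
    apply/funext => u; rewrite /poisson_kernel eit_distE powR_inv1//.
    by rewrite /Dn addr_ge0// sqr_ge0.
  apply: measurable_funM; first exact: (m1 (fun s => 1 - cabs (gam s) ^+ 2)).
  apply: (measurableT_comp (measurable_powR (-1))).
  apply: measurable_funD; apply: measurable_funX; apply: measurable_funB.
  + exact: m2 (@continuous_cos R).
  + exact: (m1 (fun s => complex.Re (gam s))).
  + exact: m2 (@continuous_sin R).
  + exact: (m1 (fun s => complex.Im (gam s))).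
apply: eq_avg => t; rewrite -avgZ; last exact: cPK.
by apply: eq_avg => s; rewrite mulrC.
Qed.

(** For a fixed boundary point the kernel is the real part of an analytic
    function of [W], so its mean over the circle is its value at the centre;
    Tonelli's theorem lets the two means be exchanged. *)
Lemma avg_poisson_analytic (W : Cplx R -> Cplx R) c r f : 0 <= r ->
  (forall z, cabs (z - c) <= r -> derivable W z 1) ->
  (forall z, cabs (z - c) <= r -> cabs (W z) < 1) ->
  continuous f -> (forall t, 0 <= f t) ->
  avg (fun s => poisson f (W (c + circle_pt r s))) = poisson f (W c).
Proof.
move=> r0 dW W1 cf f0.
have inr s : cabs (c + circle_pt r s - c) <= r by rewrite circle_ptB ger0_norm.
have cc : cabs (c - c) <= r by rewrite subrr cabs0.
rewrite avg_poisson//; first last.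
- by move=> s; apply: W1.
- by apply: continuous_circle => s; apply: cderivable_continuous; exact: dW.
apply: eq_avg => t; rewrite mulrC; congr (_ * _).
pose F (u : Cplx R) : Cplx R := (eit t + 1 * u) / (eit t + - 1 * u).
have eF u : poisson_kernel u t =
  complex.Re (F u) by rewrite poisson_kernel_herglotz /F mul1r mulN1r.
rewrite (eq_avg (g := fun s => complex.Re ((F \o W) (c + circle_pt r s)))); last first.
  by move=> s; rewrite eF.
rewrite eF; apply: (@mean_value R (F \o W) c r r0).
move=> z zr; apply: cderivable_comp; first exact: dW.
apply: derivable_mobius; rewrite mulN1r -cabs_gt0 eit_dist_gt0//; exact: W1.
Qed.

Lemma poisson_kernel_lip (b : R) z w t : b < 1 -> cabs z <= b -> cabs w <= b ->
  `|poisson_kernel z t - poisson_kernel w t| <= 12 / (1 - b) ^+ 4 * cabs (z - w).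
Proof.
move=> b1 zb wb.
have z1 : cabs z < 1 by exact: le_lt_trans b1.
have w1 : cabs w < 1 by exact: le_lt_trans b1.
have b01 : 0 < 1 - b by rewrite subr_gt0.
have := eit_dist_gt0 t z1; have := eit_dist_gt0 t w1.
have := eit_dist_ge z t; have := eit_dist_ge w t.
have := eit_dist_le z t; have := eit_dist_le w t.
have t1 := cabs_triangle z (eit t) w; have t2 := cabs_triangle w (eit t) z.
rewrite /poisson_kernel; rewrite (cabsBC w z) in t2.
move: t1 t2; set d1 := cabs (eit t - z); set d2 := cabs (eit t - w).
set D := cabs (z - w) => t1 t2 d2l d1l d2g d1g d20 d10.
have D0 : 0 <= D by exact: cabs_ge0.
have s1 := cabsB z w; have s2 := cabsB w z; rewrite (cabsBC w z) -/D in s2.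
rewrite -/D in s1.
have zz := cabs_ge0 z; have ww := cabs_ge0 w.
set x := cabs z in z1 zb d1l d1g s1 s2 zz *; set y := cabs w in w1 wb d2l d2g s1 s2 ww *.
have -> : (1 - x ^+ 2) / d1 ^+ 2 - (1 - y ^+ 2) / d2 ^+ 2 =
  ((1 - x ^+ 2) * (d2 ^+ 2 - d1 ^+ 2) + (y ^+ 2 - x ^+ 2) * d1 ^+ 2) / (d1 ^+ 2 * d2 ^+ 2).
  by field; rewrite !gt_eqF.
have dd0 : 0 < d1 ^+ 2 * d2 ^+ 2 by rewrite mulr_gt0 ?exprn_gt0.
rewrite normrM normfV (gtr0_norm dd0) ler_pdivrMr//.
have a1 : `|d2 ^+ 2 - d1 ^+ 2| <= 4 * D.
  rewrite subr_sqr normrM mulrC; apply: ler_pM => //; rewrite ler_norml; lra.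
have a2 : `|y ^+ 2 - x ^+ 2| <= 2 * D.
  rewrite subr_sqr normrM mulrC; apply: ler_pM => //; rewrite ler_norml; lra.
have a3 : `|1 - x ^+ 2| <= 1 by rewrite ler_norml; nra.
have a4 : d1 ^+ 2 <= 4 by nra.
have num : `|(1 - x ^+ 2) * (d2 ^+ 2 - d1 ^+ 2) + (y ^+ 2 - x ^+ 2) * d1 ^+ 2| <= 12 * D.
  apply: le_trans (ler_normD _ _) _;
    rewrite (normrM (1 - x ^+ 2)) (normrM (y ^+ 2 - x ^+ 2)) (ger0_norm (sqr_ge0 d1)).
  have b4 : `|1 - x ^+ 2| * `|d2 ^+ 2 - d1 ^+ 2| <= 1 * (4 * D) by apply: ler_pM.
  have b5 : `|y ^+ 2 - x ^+ 2| * d1 ^+ 2 <= 2 * D * 4.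
    by apply: ler_pM => //; exact: sqr_ge0.
  lra.
apply: le_trans num _.
have q0 : 0 < (1 - b) ^+ 4 by rewrite exprn_gt0.
have q1 : (1 - b) ^+ 4 <= d1 ^+ 2 * d2 ^+ 2.
  rewrite (_ : (1 - b) ^+ 4 = (1 - b) ^+ 2 * (1 - b) ^+ 2); last by ring.
  have sq d : 1 - b <= d -> (1 - b) ^+ 2 <= d ^+ 2.
    by move=> bd; rewrite ler_pXn2r ?nnegrE//; lra.
  by apply: ler_pM; rewrite ?sqr_ge0//; apply: sq; lra.
rewrite mulrAC -mulrA mulrAC -mulrA.
rewrite [leRHS](_ : _ = 12 * D * ((d1 ^+ 2 * d2 ^+ 2) / (1 - b) ^+ 4)); last by ring.
apply: ler_peMr; first by rewrite mulr_ge0.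
by rewrite ler_pdivlMr// mul1r.
Qed.

Lemma continuous_poisson f z : continuous f -> cabs z < 1 -> {for z, continuous (poisson f)}.
Proof.
move=> cf z1; apply/continuous_cabsP => e e0.
pose b := (1 + cabs z) / 2; pose L := 12 / (1 - b) ^+ 4; pose m := avg (fun t => `|f t|).
have cnf : continuous (fun t => `|f t|).
  by move=> t; apply: (@continuous_comp _ _ _ f (fun x => `|x|)); [exact: cf|exact:
    norm_continuous].
have m0 : 0 <= m by apply: avg_ge0.
have b1 : b < 1 by rewrite /b; lra.
have L0 : 0 <= L by rewrite divr_ge0// exprn_ge0// subr_ge0 ltW.
have Lm : 0 < L * m + 1 by rewrite ltr_wpDl// mulr_ge0.
exists (Num.min (b - cabs z) (e / (L * m + 1))).
  by rewrite lt_min divr_gt0// andbT /b; lra.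
move=> w; rewrite lt_min => /andP[w1 w2].
have zb : cabs z <= b by rewrite /b; lra.
have wb : cabs w <= b by have := cabsB w z; lra.
have w_1 : cabs w < 1 by exact: le_lt_trans b1.
rewrite /poisson -avgB; try exact: continuous_poisson_kernelM.
have cd : continuous (fun t => poisson_kernel w t * f t - poisson_kernel z t * f t).
  by move=> t; apply: cvgB; exact: continuous_poisson_kernelM.
have cg : continuous (fun t => L * cabs (w - z) * `|f t|).
  by move=> t; apply: cvgM; [exact: cvg_cst|exact: cnf].
have bd t : `|poisson_kernel w t * f t - poisson_kernel z t * f t| <= L * cabs (w - z) * `|f t|.
  by rewrite -mulrBl normrM ler_wpM2r// poisson_kernel_lip.
apply: (@le_lt_trans _ _ (L * cabs (w - z) * m)).
  rewrite -avgZ// ler_norml; apply/andP; split.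
    rewrite -[leLHS]mulN1r -avgZ//; apply: le_avg => //.
      by move=> t; apply: cvgM; [exact: cvg_cst|exact: cg].
    by move=> t; have := bd t; rewrite ler_norml mulN1r => /andP[].
  by apply: le_avg => // t; have := bd t; rewrite ler_norml => /andP[].
rewrite mulrAC; move: w2; rewrite ltr_pdivlMr// => w2.
apply: le_lt_trans w2; rewrite mulrC ler_wpM2l ?cabs_ge0//.
by rewrite lerDl.
Qed.

End PoissonMean.

(** * Subharmonicity and comparison with the Poisson integral *)

Section SqrtBranch.
Variable R : realType.
Implicit Types (z w : Cplx R).

Lemma Re_sqrtc_gt0 w : 0 < complex.Re w -> 0 < complex.Re (sqrtc w).
Proof.
case: w => a b /= a0; rewrite sqrtr_gt0 divr_gt0// ltr_wpDl// sqrtr_ge0.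
Qed.

(** [sqrtc v - sqrtc w = (v - w) / (sqrtc v + sqrtc w)], and on the right
    half-plane the real part of the denominator stays away from zero. *)
Lemma sqrtc_derivable w : 0 < complex.Re w -> derivable (@sqrtc R : Cplx R -> Cplx R) w 1.
Proof.
move=> w0.
have sum_ge v : 0 < complex.Re v ->
    complex.Re (sqrtc w) <= cabs (sqrtc v + sqrtc w : Cplx R).
  move=> v0; apply: le_trans (Re_le_cabs _); have := Re_sqrtc_gt0 v0.
  have := Re_sqrtc_gt0 w0; case: (sqrtc v) (sqrtc w) => [a b] [c d] /= c0 a0.
  by rewrite ger0_norm; lra.
set m := complex.Re (sqrtc w); have m0 : 0 < m by exact: Re_sqrtc_gt0.
have sw0 : sqrtc w != 0 :> Cplx R.
  by apply/eqP => h; move: m0; rewrite /m h ltxx.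
have diff v : 0 < complex.Re v ->
    sqrtc v - sqrtc w = (v - w) / (sqrtc v + sqrtc w) :> Cplx R.
  move=> v0; have s0 : sqrtc v + sqrtc w != 0 :> Cplx R.
    by rewrite -cabs_gt0; apply: lt_le_trans (sum_ge _ v0).
  apply: (mulIf s0); rewrite divfK//.
  by rewrite -subr_sqr !sqr_sqrtc.
have lips v : 0 < complex.Re v ->
    cabs (sqrtc v - sqrtc w : Cplx R) <= cabs (v - w) / m.
  move=> v0; rewrite diff// cabsM cabsV ler_wpM2l ?cabs_ge0//.
  by rewrite lef_pV2 ?posrE ?sum_ge//; apply: lt_le_trans (sum_ge _ v0).
apply/cderivableP; exists (2 * sqrtc w)^-1 => e e0.
exists (Num.min (complex.Re w) (e * (2 * m * m * m))).
  by rewrite lt_min w0 !mulr_gt0.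
move=> v; rewrite lt_min => /andP[v1 v2].
have v0 : 0 < complex.Re v.
  have := le_lt_trans (Re_le_cabs _) v1; case: (v) (w) => [a b] [c d] /=.
  by rewrite ltr_norml => /andP[]; lra.
have s0 : sqrtc v + sqrtc w != 0 :> Cplx R.
  by rewrite -cabs_gt0; apply: lt_le_trans (sum_ge _ v0).
have two0 : (2 : Cplx R) != 0 by rewrite pnatr_eq0.
rewrite [X in cabs X](_ : _ = (v - w) * ((sqrtc w - sqrtc v) / ((sqrtc v + sqrtc w) * (2 *
  sqrtc w)))); last first.
  by rewrite diff//; field; rewrite s0 sw0.
rewrite cabsM mulrC ler_wpM2r ?cabs_ge0// cabsM cabsV cabsM cabsBC.
have mm : m <= cabs (sqrtc w : Cplx R).
  by apply: le_trans (Re_le_cabs _); exact: ler_norm.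
have c2 : cabs (2 : Cplx R) = 2.
  by rewrite -[2 in LHS](rmorph_nat (real_complex R)) cabs_real normr_nat.
have den : 2 * m * m <= cabs (sqrtc v + sqrtc w : Cplx R) * cabs (2 * sqrtc w : Cplx R).
  rewrite cabsM c2 mulrAC mulrC; apply: ler_pM; [exact: ltW|by rewrite mulr_ge0// ltW|exact:
    sum_ge|].
  by rewrite ler_pM2l.
have den0 : 0 < 2 * m * m by rewrite !mulr_gt0.
rewrite ler_pdivrMr; last exact: lt_le_trans den.
apply: le_trans (lips _ v0) _; rewrite ler_pdivrMr//.
apply: le_trans (ltW v2) _; rewrite -(mulrA e) ler_pM2l//.
by apply: ler_wpM2r => //; exact: ltW.
Qed.

Lemma cabs_sqrtc w : cabs (sqrtc w : Cplx R) = Num.sqrt (cabs w).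
Proof.
have h := Normc.normcM (sqrtc w) (sqrtc w).
rewrite -expr2 sqr_sqrtc in h.
change (cabs w = cabs (sqrtc w : Cplx R) * cabs (sqrtc w : Cplx R)) in h.
by rewrite h -expr2 sqrtr_sqr ger0_norm// cabs_ge0.
Qed.

End SqrtBranch.

Section IteratedRoot.
Variable R : realType.

(** The power with exponent [2 ^- k], taken as an iterated square root because
    that lifts to analytic functions. *)
Definition dyadic_root k (x : R) : R := iter k Num.sqrt x.

Lemma dyadic_root_ge0 k x : 0 <= x -> 0 <= dyadic_root k x.
Proof. by case: k => //= k _; exact: sqrtr_ge0. Qed.

Lemma dyadic_root0 k : dyadic_root k 0 = 0.
Proof. by elim: k => //= k ->; rewrite sqrtr0. Qed.

Lemma dyadic_rootM k x y : 0 <= x -> 0 <= y -> dyadic_root k (x * y) =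
  dyadic_root k x * dyadic_root k y.
Proof. by move=> x0 y0; elim: k => //= k ->; rewrite sqrtrM// dyadic_root_ge0. Qed.

Lemma continuous_dyadic_root k : continuous (dyadic_root k).
Proof.
elim: k => [|k IH] x; first exact: cvg_id.
apply: (@continuous_comp _ _ _ (dyadic_root k) (@Num.sqrt R)); first exact: IH.
exact: sqrt_continuous.
Qed.

Lemma dyadic_rootE k x : 0 <= x -> dyadic_root k x = x `^ ((2^-1) ^+ k).
Proof.
move=> x0; elim: k => [|k /= ->]; first by rewrite expr0 powRr1.
by rewrite -powR12_sqrt ?powR_ge0// -powRrM exprSr.
Qed.

End IteratedRoot.

Section SubMean.
Variable R : realType.
Implicit Types (F : Cplx R -> Cplx R) (z : Cplx R).

Definition local_submean (g : Cplx R -> R) z := exists2 d : R, 0 < d &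
  forall r, 0 < r -> r < d -> g z <= avg (fun t => g (z + circle_pt r t)).

Lemma local_root F z (d : R) k : 0 < d -> F z = 1 ->
  (forall w, cabs (w - z) < d -> derivable F w 1 /\ 0 < complex.Re (F w)) ->
  exists G : Cplx R -> Cplx R, G z = 1 /\ forall w, cabs (w - z) < d ->
    [/\ derivable G w 1, 0 < complex.Re (G w) & cabs (G w) = dyadic_root k (cabs (F w))].
Proof.
move=> d0 Fz hF; elim: k => [|k [G [Gz hG]]].
  by exists F; split => // w /hF[].
exists ((@sqrtc R : Cplx R -> Cplx R) \o G); split; first by rewrite /= Gz sqrtc1.
move=> w /hG[dG G0 GF]; split.
- exact: (@cderivable_comp R (@sqrtc R : Cplx R -> Cplx R) G w dG (sqrtc_derivable G0)).
- exact: Re_sqrtc_gt0.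
- change (cabs (sqrtc (G w) : Cplx R) = Num.sqrt (dyadic_root k (cabs (F w)))).
  by rewrite -GF cabs_sqrtc.
Qed.

(** At a zero of [F] the left-hand side vanishes.  Elsewhere [F / F z] is close to
    one near [z] and has an analytic root [G] of order [2 ^ k] with [G z = 1];
    the mean of [Re (G w)] is one, and it is at most the mean of [cabs (G w)]. *)
Lemma dyadic_root_cabs_submean F z (d0 : R) k : 0 < d0 ->
  (forall w, cabs (w - z) < d0 -> derivable F w 1) ->
  local_submean (fun w => dyadic_root k (cabs (F w))) z.
Proof.
move=> d00 dF.
have cg w : cabs (w - z) < d0 -> {for w, continuous (fun w => dyadic_root k (cabs (F w)))}.
  move=> /dF /cderivable_continuous cF.
  apply: (@continuous_comp _ _ _ (fun w => cabs (F w)) (dyadic_root k)); last exact: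
    continuous_dyadic_root.
  by apply: (@continuous_comp _ _ _ F) => //; exact: continuous_cabs.
have cgc r : 0 < r -> r < d0 -> continuous (fun t => dyadic_root k (cabs (F (z + circle_pt r
  t)))).
  move=> r0 rd; apply: (@continuous_circle R R (fun w => dyadic_root k (cabs (F w)))) => t.
  by apply: cg; rewrite circle_ptB gtr0_norm.
have [Fz|Fz] := eqVneq (F z) 0.
  exists d0 => // r r0 rd; rewrite Fz cabs0 dyadic_root0; apply: avg_ge0; first exact: cgc.
  by move=> t; rewrite dyadic_root_ge0// cabs_ge0.
pose W w := F w / F z.
have dW w : cabs (w - z) < d0 -> derivable W w 1.
  by move=> /dF dFw; apply: (@derivableM _ _ F (cst (F z)^-1)); [exact: dFw|exact:
    derivable_cst].
have Wz : W z = 1 by rewrite /W divff.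
have cRW : {for z, continuous (fun w => complex.Re (W w))}.
  apply: (@continuous_comp _ _ _ W); last exact: continuous_Re.
  by apply: cderivable_continuous; apply: dW; rewrite subrr cabs0.
have /continuous_cabsP /(_ _ ltr01) [d1 d10 hd1] := cRW.
pose d := Num.min d0 d1.
have dd : 0 < d by rewrite lt_min d00.
have hW w : cabs (w - z) < d -> derivable W w 1 /\ 0 < complex.Re (W w).
  rewrite lt_min => /andP[/dW h /hd1]; rewrite Wz /= ltr_norml => /andP[h1 _].
  by split => //; move: h1; lra.
have [G [Gz hG]] := local_root k dd Wz hW.
exists d => // r r0 rd.
have inr w : cabs (w - z) <= r -> cabs (w - z) < d by move=> h; exact: le_lt_trans rd.
have circ t : cabs (z + circle_pt r t - z) < d by apply: inr; rewrite circle_ptB gtr0_norm.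
have := @mean_value R G z r (ltW r0) (fun w h => let: And3 p _ _ := hG w (inr w h) in p).
rewrite Gz /= => mv.
have rd0 : r < d0 by apply: lt_le_trans rd _; rewrite ge_min lexx.
have gE t : dyadic_root k (cabs (F (z + circle_pt r t))) =
    dyadic_root k (cabs (F z)) * cabs (G (z + circle_pt r t)).
  have [_ _ ->] := hG _ (circ t); rewrite -dyadic_rootM ?cabs_ge0//; congr (dyadic_root k _).
  by rewrite -cabsM /W mulrCA divff// mulr1.
rewrite (eq_avg gE) avgZ; last first.
  move=> t; apply: (@continuous_circle R R (fun w => cabs (G w))) => {}t.
  apply: (@continuous_comp _ _ _ G); last exact: continuous_cabs.
  by apply: cderivable_continuous; have [] := hG _ (circ t).
rewrite -[leLHS]mulr1 ler_wpM2l ?dyadic_root_ge0 ?cabs_ge0// -[leLHS]mv.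
apply: le_avg.
- apply: (@continuous_circle R R (fun w => complex.Re (G w))) => t.
  apply: (@continuous_comp _ _ _ G); last exact: continuous_Re.
  by apply: cderivable_continuous; have [] := hG _ (circ t).
- apply: (@continuous_circle R R (fun w => cabs (G w))) => t.
  apply: (@continuous_comp _ _ _ G); last exact: continuous_cabs.
  by apply: cderivable_continuous; have [] := hG _ (circ t).
- by move=> t; apply: le_trans (Re_le_cabs _); exact: ler_norm.
Qed.

End SubMean.

Section Comparison.
Variable R : realType.
Implicit Types (g : Cplx R -> R) (z : Cplx R).

(** The gain [r ^+ 2] is what makes a sub-mean property strict in the maximum
    principle below. *)
Lemma avg_sqr_circle z (r : R) : 0 <= r ->
  avg (fun t => cabs (z + circle_pt r t) ^+ 2) = cabs z ^+ 2 + r ^+ 2.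
Proof.
move=> r0.
have mv := @mean_value R (fun u : Cplx R => (conjc z : Cplx R) * u) 0 r r0.
have crc : continuous (fun t => complex.Re (conjc z * (0 + circle_pt r t))).
  apply: (@continuous_circle R R (fun u : Cplx R => complex.Re (conjc z * u))) => t.
  apply: (@continuous_comp _ _ _ (fun u : Cplx R => (conjc z : Cplx R) * u) (@complex.Re R :
    Cplx R -> R)); last exact: continuous_Re.
  apply: cderivable_continuous.
  by apply: (@derivableM _ _ (cst (conjc z : Cplx R))); [exact: derivable_cst|exact:
    derivable_id].
have {}mv := mv (fun u _ => @derivableM _ _ (cst (conjc z : Cplx R)) id u 1
  (@derivable_cst _ _ _ _ _ _) (@derivable_id _ _ _ _)).
rewrite (eq_avg (g := fun t => 2 * complex.Re (conjc z * (0 + circle_pt r t)) + (cabs z ^+ 2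
  + r ^+ 2))).
  rewrite avgD ?avgZ ?avg_cst ?mv//; first by rewrite mulr0 /= mulr0 add0r.
  - by move=> t; apply: cvgM; [exact: cvg_cst|exact: crc].
  - exact: continuous_cst.
clear mv crc; move=> t; rewrite add0r !cabs_sqr; case: z => a b /=.
have h : r ^+ 2 = r ^+ 2 * (cos t ^+ 2 + sin t ^+ 2) by rewrite cos2Dsin2 mulr1.
by rewrite [in RHS]h; ring.
Qed.

(** The maximum principle for the difference of the two sides.  A small multiple
    of [cabs w ^+ 2] is added so that an interior maximum contradicts the mean
    value inequality.  The argument runs on a disc of radius [a < 1], because
    the Poisson integral extends the boundary values only in the limit; on its
    boundary the difference is small by [continuous_quadratic]. *)
Lemma submean_le_poisson g : (forall z, 0 <= g z) ->
  (forall z, cabs z <= 1 -> {for z, continuous g}) ->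
  (forall z, cabs z < 1 -> local_submean g z) ->
  forall z, cabs z < 1 -> g z <= poisson (fun t => g (eit t)) z.
Proof.
move=> g0 cg sg z z1; pose f t := g (eit t).
have cf : continuous f.
  move=> t; apply: (@continuous_comp _ _ _ (@eit R) g); first exact: continuous_eit.
  by apply: cg; rewrite cabs_eit.
apply/ler_addgt0Pr => e e0.
have e4 : 0 < e / 3 by rewrite divr_gt0.
have [C C0 hC] := continuous_quadratic (@compact_cdisc R 1) cg e4.
have [a [za a1 Ca]] : exists a, [/\ cabs z < a, a < 1 & C * (1 - a ^+ 2) <= e / 3].
  pose x := Num.min ((1 - cabs z) / 2) (e / (6 * (C + 1))).
  have C1 : 0 < C + 1 by rewrite ltr_wpDl.
  have x0 : 0 < x by rewrite lt_min !divr_gt0 ?subr_gt0// mulr_gt0.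
  have x1 : x <= (1 - cabs z) / 2 by rewrite ge_min lexx.
  have x2 : x <= e / (6 * (C + 1)) by rewrite ge_min lexx orbT.
  have zz := cabs_ge0 z.
  exists (1 - x); split; [lra|lra|].
  have : x * (6 * (C + 1)) <= e by rewrite -ler_pdivlMr ?mulr_gt0.
  nra.
have a0 : 0 < a by apply: le_lt_trans za; exact: cabs_ge0.
pose h w := g w - poisson f w + e / 3 * cabs w ^+ 2.
have ch w : cabs w < 1 -> {for w, continuous h}.
  move=> w1; apply: (@continuousD R R (Cplx R) (fun w => g w - poisson f w)).
    apply: (@continuousB R R (Cplx R) g (poisson f)); first exact: (cg _ (ltW w1)).
    exact: continuous_poisson.
  apply: (@continuousM R (Cplx R) (cst (e / 3)) (fun w => cabs w ^+ 2)).
    exact: cst_continuous.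
  by apply: (@continuous_sqr _ (Cplx R) (@cabs R)); exact: continuous_cabs.
have [||/= z' z'a hmax] := @compact_EVT_max _ R h _ _ (@compact_cdisc R a).
- by exists z => /=; exact: ltW.
- apply: continuous_in_subspaceT => w; rewrite inE /= => wa.
  by apply: ch; exact: le_lt_trans a1.
rewrite inE /= in z'a.
have hz : h z <= h z' by apply: hmax; rewrite inE /= ltW.
have z'1 : cabs z' < 1 by exact: le_lt_trans a1.
have sq0 : 0 <= e / 3 * cabs z ^+ 2 by rewrite mulr_ge0 ?sqr_ge0// ltW.
suff hz' : h z' <= e by move: (le_trans hz hz'); rewrite /h; lra.
move: z'a; rewrite le_eqVlt => /orP[/eqP z'a|z'a].
  have sq1 : e / 3 * cabs z' ^+ 2 <= e / 3 
    by apply: ler_piMr; [exact: ltW|rewrite z'a; apply: exprn_ile1; exact: ltW].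
  suff : g z' <= poisson f z' + (e / 3 + C * (1 - a ^+ 2)) by rewrite /h; lra.
  rewrite -{1}(poisson_cst (g z') z'1) -(poisson_cst (e / 3) z'1) -z'a -poisson_dist_sqr//
    -poissonZ//; last first.
    move=> t; apply: (@continuous_sqr _ R (fun t => cabs (eit t - z'))).
    by apply: continuous_distC; [exact: continuous_eit|exact: cvg_cst].
  have cq : continuous (fun t => C * cabs (eit t - z') ^+ 2).
    move=> t; apply: cvgM; first exact: cvg_cst.
    apply: (@continuous_sqr _ R (fun t => cabs (eit t - z'))).
    by apply: continuous_distC; [exact: continuous_eit|exact: cvg_cst].
  have cq2 : continuous (fun t => e / 3 + C * cabs (eit t - z') ^+ 2).
    by move=> t; apply: cvgD; [exact: cvg_cst|exact: cq].
  rewrite -poissonD//; last exact: continuous_cst.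
  rewrite -poissonD//; apply: le_poisson => //; first exact: continuous_cst.
    by move=> t; apply: cvgD; [exact: cf|exact: cq2].
  move=> t; have := hC z' (eit t); rewrite /= cabs_eit ltW// cabsBC => /(_ isT (lexx _)).
  by rewrite ler_distl => /andP[_]; rewrite /f; lra.
exfalso.
have [d d0 hd] := sg z' z'1.
pose r := Num.min (d / 2) ((a - cabs z') / 2).
have r0 : 0 < r by rewrite lt_min !divr_gt0// subr_gt0.
have r1 : r <= d / 2 by rewrite ge_min lexx.
have r2 : r <= (a - cabs z') / 2 by rewrite ge_min lexx orbT.
have circ t : cabs (z' + circle_pt r t) <= a.
  apply: le_trans (cabsD _ _) _; rewrite cabs_circle_pt gtr0_norm//; lra.
have circ1 t : cabs (z' + circle_pt r t) < 1 by exact: le_lt_trans a1.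
have cgc : continuous (fun t => g (z' + circle_pt r t)).
  by apply: continuous_circle => t; apply: cg; exact: ltW.
have cPc : continuous (fun t => poisson f (z' + circle_pt r t)).
  by apply: continuous_circle => t; exact: continuous_poisson.
have csc : continuous (fun t => cabs (z' + circle_pt r t) ^+ 2).
  apply: (@continuous_circle R R (fun w => cabs w ^+ 2)) => t.
  by apply: (@continuous_sqr _ (Cplx R) (@cabs R)); exact: continuous_cabs.
have cd : continuous (fun t => g (z' + circle_pt r t) - poisson f (z' + circle_pt r t)).
  by move=> t; apply: cvgB; [exact: cgc|exact: cPc].
have cs : continuous (fun t => e / 3 * cabs (z' + circle_pt r t) ^+ 2).
  by move=> t; apply: cvgM; [exact: cvg_cst|exact: csc].
have : avg (fun t => h (z' + circle_pt r t)) <= h z'.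
  apply: avg_le_cst; first by move=> t; apply: cvgD; [exact: cd|exact: cs].
  by move=> t; apply: hmax; rewrite inE /=.
have A1 := avgD cd cs; have A2 := avgB cgc cPc; have A3 := avgZ (e / 3) csc.
have A4 := avg_sqr_circle z' (ltW r0).
have A5 : avg (fun t => poisson f (z' + circle_pt r t)) = poisson f z'.
  apply: (@avg_poisson_analytic R id z' r f (ltW r0)) => //.
  - by move=> w wr; apply: le_lt_trans a1; have := cabsB w z'; lra.
  - by move=> t; exact: g0.
rewrite /h A1 A2 A3 A4 A5.
have := hd r r0; have rd : r < d by lra.
move=> /(_ rd); have : 0 < e / 3 * r ^+ 2 by rewrite mulr_gt0// exprn_gt0.
lra.
Qed.

End Comparison.

(** * Powers with variable exponents and the key estimate *)

Section Powers.
Variable R : realType.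
Implicit Types (x y a b e Q k : R).

Lemma le_powR x y e : 0 <= e -> 0 <= x -> x <= y -> x `^ e <= y `^ e.
Proof. by move=> e0 x0 xy; apply: ge0_ler_powR; rewrite ?nnegrE// (le_trans x0). Qed.

Lemma powR2 x : 0 <= x -> x `^ 2 = x ^+ 2.
Proof. by move=> x0; rewrite powR_mulrn. Qed.

Lemma sqr_le_powR x e : 1 <= x -> 2 <= e -> x ^+ 2 <= x `^ e.
Proof. by move=> x1 e2; rewrite -powR2 ?(le_trans ler01)// ler_powR. Qed.

Lemma powR_le_sqr x e : 0 <= x <= 1 -> 2 <= e -> x `^ e <= x ^+ 2.
Proof.
move=> /andP[x0 x1] e2; move: x0; rewrite le_eqVlt => /predU1P[<-|x0].
  by rewrite powR0 ?sqr_ge0// gt_eqF//; lra.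
rewrite -powR2; last exact: ltW.
by apply: ger_powR => //; rewrite x0.
Qed.

Lemma powRD_le x y e Q : 0 <= x -> 0 <= y -> 0 <= e <= Q ->
  (x + y) `^ e <= 2 `^ Q * (x `^ e + y `^ e).
Proof.
wlog xy : x y / x <= y.
  move=> wl x0 y0 eQ; have [xy|/ltW yx] := leP x y; first exact: wl.
  by rewrite addrC [X in _ * X]addrC; exact: wl.
move=> x0 y0 /andP[e0 eQ].
apply: (@le_trans _ _ ((2 * y) `^ e)); first by apply: le_powR; lra.
rewrite powRM//; apply: ler_pM; rewrite ?powR_ge0//.
  by apply: ler_powR => //; lra.
by rewrite lerDr powR_ge0.
Qed.

Lemma powRD_ge x y e : 0 <= x -> 0 <= y -> 1 <= e ->
  x `^ e + y `^ e <= (x + y) `^ e.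
Proof.
move=> x0 y0 e1.
have e0 : 0 < e by lra.
have [xy0|xy0] := eqVneq (x + y) 0.
  have [-> ->] : x = 0 /\ y = 0 by split; lra.
  by rewrite addr0 powR0 ?addr0// gt_eqF.
have s0 : 0 < x + y by rewrite lt_def xy0 addr_ge0.
have bd u : 0 <= u -> u <= x + y -> u `^ e <= u * (x + y) `^ (e - 1).
  move=> u0 us; rewrite -mulr_powRB1// ler_wpM2l//; apply: le_powR => //; lra.
apply: le_trans (lerD (bd x x0 _) (bd y y0 _)) _; try lra.
by rewrite -mulrDl mulr_powRB1// ltW.
Qed.

(** Where [f] vanishes, the exponent stays above half its value, so that the
    power still tends to zero. *)
Lemma continuous_powR2 (T : topologicalType) (f e : T -> R) (x : T) :
  (forall v : T, 0 <= f v) -> 0 < e x ->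
  {for x, continuous f} -> {for x, continuous e} ->
  {for x, continuous (fun v : T => f v `^ e v)}.
Proof.
move=> f0 ex cf ce.
have [fx|fx] := eqVneq (f x) 0; last first.
  have fx0 : 0 < f x by rewrite lt_def fx f0.
  have c : {for x, continuous (fun v : T => expR (e v * ln (f v)))}.
    apply: (@continuous_comp _ _ _ (fun v : T => e v * ln (f v)) (@expR R)); last exact:
      continuous_expR.
    apply: (@continuousM R T e (fun v : T => ln (f v))) => //.
    by apply: (@continuous_comp _ _ _ f (@ln R)) => //; exact: continuous_ln.
  have nf : \forall y \near x, 0 < f y.
    by apply: (cf [set u | 0 < u]); exact: lt_nbhsr.
  have nE : \forall y \near x, expR (e y * ln (f y)) = f y `^ e y.
    by near=> y; rewrite /powR gt_eqF//; near: y.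
  move=> P; rewrite {1}/powR (negbTE fx) => /c h.
  by rewrite /nbhs/=; apply: filterS2 nE h => y /= ->.
apply/(@cvgrPdist_lt _ _ _ (nbhs x)) => eps eps0.
rewrite fx powR0 ?gt_eqF//.
pose c := e x / 2; have c0 : 0 < c by rewrite divr_gt0.
have ne : \forall y \near x, c < e y.
  by apply: (ce [set u | c < u]); apply: lt_nbhsr; rewrite /c ltr_pdivrMr// ltr_pMr// ltrDl.
pose d := Num.min 1 (eps `^ c^-1).
have d0 : 0 < d by rewrite lt_min ltr01 powR_gt0.
have nf : \forall y \near x, f y < d.
  by apply: (cf [set u | u < d]); apply: lt_nbhsl; rewrite fx.
near=> y.
have fy : f y < d by near: y.
have ey : c < e y by near: y.
rewrite sub0r normrN ger0_norm ?powR_ge0//.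
have [fy0|fy0] := eqVneq (f y) 0.
  by rewrite fy0 powR0// gt_eqF// (lt_trans c0).
have {}fy0 : 0 < f y by rewrite lt_def fy0 f0.
apply: (@le_lt_trans _ _ (f y `^ c)).
  apply: ger_powR; last exact: ltW.
  by rewrite fy0 ltW// (lt_le_trans fy)// ge_min lexx.
have -> : eps = (eps `^ c^-1) `^ c by rewrite -powRrM mulVf ?gt_eqF// powRr1// ltW.
apply: gt0_ltr_powR => //; rewrite ?nnegrE ?powR_ge0//.
by apply: (lt_le_trans fy); rewrite ge_min lexx orbT.
Unshelve. all: by end_near. Qed.

(** The factor [y `^ (e0 - e)] is at most [K] for [1 <= y <= D], and at most
    [k `^ (- Q)] for [k <= y <= 1]; the values below [k] contribute at most
    [k ^+ 2].  A small [k] keeps the estimate useful for small data. *)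
Lemma powR_change_exponent y e e0 Q D K k : 0 <= y -> y <= D ->
  2 <= e <= Q -> 2 <= e0 <= Q -> 0 < k <= 1 -> 1 <= D ->
  D `^ `|e - e0| <= K ->
  y `^ e0 <= k ^+ 2 + K / k `^ Q * y `^ e.
Proof.
move=> y0 yD /andP[e2 eQ] /andP[e02 e0Q] /andP[k0 k1] D1 DK.
have Q0 : 0 < Q by lra.
have kQ0 : 0 < k `^ Q by exact: powR_gt0.
have kQ1 : k `^ Q <= 1.
  by rewrite -[leRHS](powRr0 k); apply: ger_powR; [rewrite k0|exact: ltW].
have K1 : 1 <= K by apply: le_trans DK; rewrite -(powRr0 D) ler_powR.
have K0 : 0 < K by lra.
have [yk|yk] := ltP y k.
  apply: (@le_trans _ _ (k ^+ 2)).
    apply: le_trans (le_powR _ y0 (ltW yk)) _; first lra.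
    by apply: powR_le_sqr => //; rewrite ltW.
  by rewrite lerDl mulr_ge0 ?powR_ge0// divr_ge0// ltW.
have {}y0 : 0 < y by exact: lt_le_trans yk.
rewrite -[leLHS]add0r; apply: lerD; first exact: sqr_ge0.
have -> : y `^ e0 = y `^ (e0 - e) * y `^ e.
  by rewrite -powRD ?subrK// (gt_eqF y0) implybT.
apply: ler_wpM2r; first exact: powR_ge0.
have [y1|y1] := leP 1 y.
  apply: (@le_trans _ _ (y `^ `|e - e0|)).
    by apply: ler_powR => //; rewrite distrC ler_norm.
  apply: (@le_trans _ _ K).
    by apply: le_trans DK; apply: le_powR => //; exact: ltW.
  by rewrite ler_peMr ?(ltW K0)// invf_ge1.
apply: (@le_trans _ _ (y `^ (- Q))).
  by apply: ger_powR; [rewrite y0 ltW|lra].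
rewrite powRN; apply: (@le_trans _ _ (k `^ Q)^-1).
  rewrite lef_pV2 ?posrE ?powR_gt0//.
  by apply: le_powR => //; exact: ltW.
by apply: ler_peMl => //; rewrite invr_ge0 ltW.
Qed.

End Powers.

Section Jensen.
Variable R : realType.
Implicit Types (z : Cplx R) (f : R -> R).

Lemma continuous_powRr f (a : R) : 0 < a -> (forall t, 0 <= f t) -> continuous f ->
  continuous (fun t => f t `^ a).
Proof.
by move=> a0 f0 cf t; apply: (@continuous_powR2 R R f (cst a)) => //; [exact: cf|exact:
  cst_continuous].
Qed.

(** Young's inequality between [f t] and [m `^ (a - 1)], where [m] is the Poisson
    integral, integrated against the kernel; an approach to Jensen's inequality
    that only uses constants and linearity. *)
Lemma poisson_jensen f z (a : R) : cabs z < 1 -> continuous f -> (forall t, 0 <= f t) ->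
  1 < a -> poisson f z `^ a <= poisson (fun t => f t `^ a) z.
Proof.
move=> z1 cf f0 a1; set m := poisson f z.
have a0 : 0 < a by lra.
have cfa := continuous_powRr a0 f0 cf.
have m0 : 0 <= m by exact: poisson_ge0.
have a10 : 0 < a - 1 by lra.
have conj : a^-1 + (a / (a - 1))^-1 = 1 by field; rewrite !gt_eqF.
have young t : m `^ (a - 1) * f t <= a^-1 * f t `^ a + m `^ a * (1 - a^-1).
  have := @conjugate_powR R (f t) (m `^ (a - 1)) a (a / (a - 1)) (f0 t) (powR_ge0 _ _).
  move=> /(_ ltac:(lra) ltac:(by rewrite divr_gt0) conj).
  rewrite -powRrM (_ : (a - 1) * (a / (a - 1)) = a); last by field; rewrite gt_eqF.
  have -> : (a / (a - 1))^-1 = 1 - a^-1 by lra.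
  by rewrite mulrC [X in _ -> _ <= X + _]mulrC.
have c1 : continuous (fun t => m `^ (a - 1) * f t).
  by move=> t; apply: cvgM; [exact: cvg_cst|exact: cf].
have c2 : continuous (fun t => a^-1 * f t `^ a).
  by move=> t; apply: cvgM; [exact: cvg_cst|exact: cfa].
have c3 : continuous (fun t => a^-1 * f t `^ a + m `^ a * (1 - a^-1)).
  by move=> t; apply: cvgD; [exact: c2|exact: cvg_cst].
have := le_poisson z1 c1 c3 young.
rewrite (poissonZ _ z1 cf) (poissonD z1 c2 (@continuous_cst R _)) (poissonZ _ z1 cfa).
rewrite (poisson_cst _ z1) -/m mulrC mulr_powRB1// => h.
have ai : 0 < a^-1 by rewrite invr_gt0.
rewrite -(ler_pM2l ai); lra.
Qed.

End Jensen.

Section KeyEstimate.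
Variable R : realType.
Implicit Types (z : Cplx R) (f e : R -> R).

(** Write [f = y + (f - y)] with [y = min f D] and [D = max 1 (1 / d)], [d] being
    the distance from [z] to the boundary point.  The exponent of [y] can be
    changed, by [powR_change_exponent].  Where [f > D] one has
    [f <= d * f ^+ 2 <= d * f `^ e], and the kernel is at most [2 / d]. *)
Lemma key_estimate f e z (e0 Q K k : R) : cabs z < 1 ->
  continuous f -> (forall t, 0 <= f t) -> continuous e ->
  (forall t, 2 <= e t <= Q) -> 2 <= e0 <= Q -> 0 < k <= 1 ->
  (forall t, Num.max 1 (cabs (eit t - z))^-1 `^ `|e t - e0| <= K) ->
  poisson f z `^ e0 <= 2 `^ Q * (k ^+ 2 + K / k `^ Q * poisson (fun t => f t `^ e t) z +
                             (2 * avg (fun t => f t `^ e t)) `^ e0).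
Proof.
move=> z1 cf f0 ce eQ e0Q k01 hK.
pose D t := Num.max 1 (cabs (eit t - z))^-1.
have D1 t : 1 <= D t by rewrite le_max lexx.
have cD : continuous D.
  move=> t; apply: (@continuous_max R R (cst 1) (fun t => (cabs (eit t - z))^-1)).
    exact: cst_continuous.
  apply: cvgV; first by rewrite gt_eqF// eit_dist_gt0.
  by apply: continuous_distC; [exact: continuous_eit|exact: cst_continuous].
pose y t := Num.min (f t) (D t).
have cy : continuous y by move=> t; apply: (@continuous_min R R f D); [exact: cf|exact: cD].
have y0 t : 0 <= y t by rewrite le_min f0 (le_trans ler01).
have yf t : y t <= f t by rewrite ge_min lexx.
have yD t : y t <= D t by rewrite ge_min lexx orbT.
have cfe : continuous (fun t => f t `^ e t).
  move=> t; apply: continuous_powR2 => //; [|exact: cf|exact: ce].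
  by have /andP[h _] := eQ t; lra.
set m := avg (fun t => f t `^ e t).
have e0Q' := e0Q; case/andP: e0Q' => e02 e0Q1.
have cb : continuous (fun t => f t - y t) by move=> t; apply: cvgB; [exact: cf|exact: cy].
have hb : poisson (fun t => f t - y t) z <= 2 * m.
  rewrite /poisson /m -avgZ//; apply: le_avg; first exact: continuous_poisson_kernelM.
    by move=> t; apply: cvgM; [exact: cvg_cst|exact: cfe].
  move=> t; have [fD|Df] := leP (f t) (D t).
    by rewrite /y (min_idPl fD) subrr mulr0 mulr_ge0// powR_ge0.
  have f1 : 1 <= f t by rewrite (le_trans (D1 t))// ltW.
  have d0 := eit_dist_gt0 t z1.
  have df : (cabs (eit t - z))^-1 <= f t.
    by apply: le_trans (ltW Df); rewrite le_max lexx orbT.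
  have PKf : poisson_kernel z t <= 2 * f t.
    apply: (@le_trans _ _ (2 * (cabs (eit t - z))^-1)); last by rewrite ler_pM2l.
    by rewrite ler_pdivlMr// poisson_kernel_dist.
  apply: (@le_trans _ _ (2 * f t * f t)).
    by apply: ler_pM; rewrite ?poisson_kernel_ge0// ?subr_ge0// lerBlDr lerDl.
  rewrite -mulrA -expr2 ler_pM2l//; apply: sqr_le_powR => //.
  by have /andP[] := eQ t.
have hf : poisson f z = poisson y z + poisson (fun t => f t - y t) z.
  by rewrite -poissonD//; congr (poisson _ z); apply/funext => t; rewrite subrKC.
have PIy0 : 0 <= poisson y z by exact: poisson_ge0.
have m0 : 0 <= m by apply: avg_ge0 => // t; exact: powR_ge0.
have s1 : poisson f z `^ e0 <= (poisson y z + 2 * m) `^ e0.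
  apply: le_powR; [lra|exact: poisson_ge0|by rewrite hf lerD2l].
apply: le_trans s1 _; apply: le_trans (@powRD_le _ _ _ _ Q PIy0 _ _) _; [lra|lra|].
rewrite ler_pM2l ?powR_gt0// lerD2r.
have e01 : 1 < e0 by lra.
apply: le_trans (poisson_jensen z1 cy y0 e01) _.
have c1 : continuous (fun t => K / k `^ Q * f t `^ e t).
  by move=> t; apply: cvgM; [exact: cvg_cst|exact: cfe].
rewrite -[in leRHS]poissonZ// -[in leRHS](poisson_cst (k ^+ 2) z1) -poissonD//; last exact:
  continuous_cst.
apply: le_poisson => //.
- by apply: continuous_powRr => //; lra.
- by move=> t; apply: cvgD; [exact: cvg_cst|exact: c1].
move=> t; apply: le_trans (powR_change_exponent (y0 t) (yD t) (eQ t) e0Q k01 (D1 t) (hK t)) _.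
rewrite lerD2l; apply: ler_wpM2l.
  rewrite divr_ge0 ?powR_ge0//; apply: le_trans (hK t); exact: powR_ge0.
apply: le_powR => //; by have /andP[h _] := eQ t; lra.
Qed.

End KeyEstimate.

(** * Modulars of subharmonic functions *)

Section LimitAtOne.
Variable R : realType.

Definition cvg_at1 (E : R -> R) (L : R) := forall e : R, 0 < e ->
  exists2 r0 : R, 0 < r0 < 1 & forall r, r0 < r -> r < 1 -> `|E r - L| <= e.

(** The limit is the supremum of the eventual lower bounds. *)
Lemma cauchy_at1 (E : R -> R) :
  (forall e : R, 0 < e -> exists2 r0 : R, 0 < r0 < 1 &
     forall r s, r0 < r -> r < s -> s < 1 -> `|E s - E r| <= e) ->
  exists L, cvg_at1 E L.
Proof.
move=> hE.
pose S := [set x : R | exists2 r0, r0 < 1 & forall r, r0 < r -> r < 1 -> x <= E r].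
have low e r0 r1 : 0 < e -> r0 < r1 -> r1 < 1 ->
    (forall r s, r0 < r -> r < s -> s < 1 -> `|E s - E r| <= e) -> S (E r1 - e).
  move=> e0 h1 h2 h; exists r1 => // r h3 h4.
  by have := h _ _ h1 h3 h4; rewrite ler_norml => /andP[]; lra.
have up e r0 r1 : 0 < e -> r0 < r1 -> r1 < 1 ->
    (forall r s, r0 < r -> r < s -> s < 1 -> `|E s - E r| <= e) ->
    ubound S (E r1 + e).
  move=> e0 h1 h2 h x [r2 h3 hx].
  pose r := (Num.max r1 r2 + 1) / 2.
  have m1 : r1 <= Num.max r1 r2 by rewrite le_max lexx.
  have m2 : r2 <= Num.max r1 r2 by rewrite le_max lexx orbT.
  have m3 : Num.max r1 r2 < 1 by rewrite gt_max h2.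
  have q1 : r1 < r by rewrite /r; lra.
  have q2 : r2 < r by rewrite /r; lra.
  have q3 : r < 1 by rewrite /r; lra.
  have := h _ _ h1 q1 q3; have := hx _ q2 q3.
  by rewrite ler_norml => ? /andP[]; lra.
have supS : has_sup S.
  have [r0 /andP[r00 r01] h] := hE 1 ltr01.
  have q1 : r0 < (r0 + 1) / 2 by lra.
  have q2 : (r0 + 1) / 2 < 1 by lra.
  split; first by exists (E ((r0 + 1) / 2) - 1); exact: low h.
  by exists (E ((r0 + 1) / 2) + 1); exact: up h.
exists (sup S) => e e0; have [r0 r001 h] := hE e e0.
exists r0 => // r h1 h2; rewrite ler_distl; apply/andP; split.
  suff : sup S <= E r + e by lra.
  by apply: sup_le_ub; [exact: supS.1|exact: up h].
suff : E r - e <= sup S by lra.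
by apply: sup_upper_bound => //; exact: low h.
Qed.

Lemma increasing_at1 (J : R -> R) (B : R) :
  (forall r s, 0 < r -> r < s -> s < 1 -> J r <= J s) ->
  (forall r, 0 < r -> r < 1 -> J r <= B) ->
  forall e, 0 < e -> exists2 r0 : R, 0 < r0 < 1 &
     forall r s, r0 < r -> r < s -> s < 1 -> J s - J r <= e.
Proof.
move=> Jm JB e e0.
pose S := [set x : R | exists2 r : R, 0 < r < 1 & x = J r].
have supS : has_sup S.
  split; first by exists (J (1 / 2)), (1 / 2) => //; lra.
  by exists B => _ [r /andP[r0 r1] ->]; exact: JB.
have [_ [r0 r01 ->] hr] := sup_adherent e0 supS.
exists r0 => // r s h1 h2 h3; have /andP[r00 r0_1] := r01.
have : J s <= sup S.
  by apply: sup_upper_bound => //; exists s => //; lra.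
have : J r0 <= J r by apply: Jm => //; lra.
lra.
Qed.

End LimitAtOne.

Section SubharmonicModular.
Variable R : realType.
Implicit Types (z w : Cplx R) (r s t : R).

Lemma poisson_kernel0 t : poisson_kernel (0 : Cplx R) t = 1.
Proof. by rewrite /poisson_kernel cabs0 subr0 cabs_eit expr0n/= subr0 expr1n divr1. Qed.

Lemma poisson_at0 (f : R -> R) : poisson f (0 : Cplx R) = avg f.
Proof. by apply: eq_avg => t; rewrite poisson_kernel0 mul1r. Qed.

Lemma avg_poisson_circle (f : R -> R) a : 0 <= a < 1 -> continuous f ->
  (forall t, 0 <= f t) -> avg (fun s => poisson f (circle_pt a s)) = avg f.
Proof.
move=> /andP[a0 a1] cf f0.
have h : avg (fun s => poisson f (0 + circle_pt a s)) = poisson f 0.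
  apply: (@avg_poisson_analytic R id 0 a f a0) => //.
  by move=> z; rewrite subr0 => za; exact: le_lt_trans a1.
rewrite -[RHS]poisson_at0 -h; apply: eq_avg => s; by rewrite add0r.
Qed.

Lemma circle_pt_scale r s t : s != 0 ->
  circle_pt r t = ((s%:C)%C : Cplx R) * circle_pt (r / s) t.
Proof.
move=> s0; have e : s * (r / s) = r by rewrite mulrC divfK.
by rewrite !circle_ptE mulrA -rmorphM e.
Qed.

Lemma continuous_on_circle (h : Cplx R -> R) r :
  (forall z, cabs z < 1 -> {for z, continuous h}) -> 0 <= r < 1 ->
  continuous (fun t => h (circle_pt r t)).
Proof.
move=> ch /andP[r0 r1] t.
apply: (@continuous_comp _ _ _ (@circle_pt R r) h); first exact: continuous_circle_pt.
by apply: ch; rewrite cabs_circle_pt ger0_norm.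
Qed.

Variables (g q : Cplx R -> R) (Q K : R).
Hypothesis g_ge0 : forall z, 0 <= g z.
Hypothesis cg : forall z, cabs z < 1 -> {for z, continuous g}.
Hypothesis cq : forall z, cabs z < 1 -> {for z, continuous q}.
Hypothesis qQ : forall z, cabs z < 1 -> 2 <= q z <= Q.
Hypothesis g_sub : forall r z, 0 < r < 1 -> cabs z < 1 ->
  g ((r%:C)%C * z) <= poisson (fun t => g (circle_pt r t)) z.
Hypothesis q_log : forall r z t, 0 < r < 1 -> cabs z < 1 ->
  Num.max 1 (cabs (eit t - z))^-1 `^ `|q (circle_pt r t) - q ((r%:C)%C * z)| <= K.

Definition circle_modular r := avg (fun t => g (circle_pt r t) `^ q (circle_pt r t)).

Let circ1 r t : 0 < r < 1 -> cabs (circle_pt r t : Cplx R) < 1.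
Proof. by move=> /andP[r0 r1]; rewrite cabs_circle_pt gtr0_norm. Qed.

Let r_ge0 r : 0 < r < 1 -> 0 <= r < 1.
Proof. by move=> /andP[r0 ->]; rewrite ltW. Qed.

Let cgr r : 0 < r < 1 -> continuous (fun t => g (circle_pt r t)).
Proof. by move=> h; apply: continuous_on_circle => //; exact: r_ge0. Qed.

Let cqr r : 0 < r < 1 -> continuous (fun t => q (circle_pt r t)).
Proof. by move=> h; apply: continuous_on_circle => //; exact: r_ge0. Qed.

Let qr0 r t : 0 < r < 1 -> 0 < q (circle_pt r t).
Proof. by move=> h; have /andP[] := qQ (circ1 t h); lra. Qed.

Let cgq r : 0 < r < 1 -> continuous (fun t => g (circle_pt r t) `^ q (circle_pt r t)).
Proof.
move=> h t; apply: (@continuous_powR2 R R (fun t => g (circle_pt r t)) (fun t => q (circle_pt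
  r t))) => //.
- exact: qr0.
- exact: cgr.
- exact: cqr.
Qed.

Lemma scaled_disc r z : 0 < r < 1 -> cabs z < 1 -> cabs ((r%:C)%C * z) < 1.
Proof.
move=> /andP[r0 r1] z1; rewrite cabsM cabs_real gtr0_norm//.
have := cabs_ge0 z; nra.
Qed.

Let K_ge0 : 0 <= K.
Proof.
have h : 0 < (1 / 2 : R) < 1 by lra.
have z1 : cabs (0 : Cplx R) < 1 by rewrite cabs0.
by apply: le_trans (q_log 0 h z1); exact: powR_ge0.
Qed.

(** The key estimate bounds the integrand by a constant plus a multiple of the
    Poisson integral of [g `^ q], evaluated at [om / rho].  This composite has
    mean equal to its value at the origin, which is the modular on the circle
    of radius [rho]. *)
Lemma modular_subordination r rho (om : Cplx R -> Cplx R) :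
  0 <= r -> 0 < rho < 1 ->
  (forall z, cabs z <= r -> derivable om z 1) ->
  (forall z, cabs z <= r -> cabs (om z) < rho) -> om 0 = 0 ->
  circle_modular rho <= 1 ->
  avg (fun s => g (om (circle_pt r s)) `^ q (om (circle_pt r s))) <=
    2 `^ Q * (1 + K + 2 `^ Q).
Proof.
move=> r0 rho01 dom omr om0 m1.
have /andP[rho0 rho1] := rho01.
have rhoc : ((rho%:C)%C : Cplx R) != 0 by rewrite -cabs_gt0 cabs_real normr_gt0 gt_eqF.
pose W z := ((rho%:C)%C : Cplx R)^-1 * om z.
have omW z : om z = (rho%:C)%C * W z by rewrite /W mulVKf.
have dW z : cabs z <= r -> derivable W z 1.
  move=> zr; apply: (@derivableM _ _ (cst ((rho%:C)%C : Cplx R)^-1) om); first exact: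
    derivable_cst.
  exact: dom.
have W1 z : cabs z <= r -> cabs (W z) < 1.
  move=> zr; rewrite /W cabsM cabsV cabs_real gtr0_norm// mulrC ltr_pdivrMr// mul1r.
  exact: omr.
have cr s : cabs (circle_pt r s : Cplx R) <= r by rewrite cabs_circle_pt ger0_norm.
have om1 s : cabs (om (circle_pt r s)) < 1 by apply: lt_trans (omr _ (cr s)) _.
have com : continuous (fun s => om (circle_pt r s)).
  move=> s; apply: (@continuous_comp _ _ _ (@circle_pt R r) om); first exact:
    continuous_circle_pt.
  by apply: cderivable_continuous; exact: dom.
pose f t := g (circle_pt rho t) `^ q (circle_pt rho t).
have cf : continuous f by exact: cgq.
have f0 t : 0 <= f t by exact: powR_ge0.
pose m := avg f.
have m0 : 0 <= m by exact: avg_ge0.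
have mE : m <= 1 by exact: m1.
have bd s : g (om (circle_pt r s)) `^ q (om (circle_pt r s)) <=
   2 `^ Q * (1 + 2 `^ Q) + 2 `^ Q * K * poisson f (W (circle_pt r s)).
  set z := W (circle_pt r s); have z1 : cabs z < 1 by exact: W1.
  rewrite omW -/z.
  have qz := qQ (scaled_disc rho01 z1); have /andP[qz2 qzQ] := qz.
  apply: (@le_trans _ _ (poisson (fun t => g (circle_pt rho t)) z `^ q ((rho%:C)%C * z))).
    by apply: le_powR; [lra|exact: g_ge0|exact: g_sub].
  have := @key_estimate R (fun t => g (circle_pt rho t)) (fun t => q (circle_pt rho t))
    z (q ((rho%:C)%C * z)) Q K 1 z1 (cgr rho01) (fun t => g_ge0 _) (cqr rho01)
    (fun t => qQ (circ1 t rho01)) qz _ (fun t => q_log t rho01 z1).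
  move=> /(_ ltac:(rewrite ltr01 lexx//)) h; apply: le_trans h _.
  rewrite expr1n powR1 divr1 -/f -/m.
  have : (2 * m) `^ q ((rho%:C)%C * z) <= 2 `^ Q.
    apply: (@le_trans _ _ (2 `^ q ((rho%:C)%C * z))).
      by apply: le_powR; lra.
    by apply: ler_powR => //; lra.
  have : 0 < 2 `^ Q :> R by rewrite powR_gt0.
  set A := 2 `^ Q; set P := poisson f z; set X := _ `^ _ => A0 XA.
  have : A * X <= A * A by rewrite ler_pM2l.
  by lra.
have cP : continuous (fun s => poisson f (W (circle_pt r s))).
  move=> s; apply: (@continuous_comp _ _ _ (fun s => W (circle_pt r s)) (poisson f)).
    apply: (@continuous_comp _ _ _ (@circle_pt R r) W); first exact: continuous_circle_pt.
    by apply: cderivable_continuous; exact: dW.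
  by apply: continuous_poisson => //; exact: W1.
have cgo : continuous (fun s => g (om (circle_pt r s)) `^ q (om (circle_pt r s))).
  move=> s; apply: (@continuous_powR2 R R (fun s => g (om (circle_pt r s))) (fun s => q (om
    (circle_pt r s)))) => //.
  - by have /andP[] := qQ (om1 s); lra.
  - by apply: (@continuous_comp _ _ _ (fun s => om (circle_pt r s)) g); [exact: com|exact: cg].
  - by apply: (@continuous_comp _ _ _ (fun s => om (circle_pt r s)) q); [exact: com|exact: cq].
have cK : continuous (fun s => 2 `^ Q * K * poisson f (W (circle_pt r s))).
  by move=> s; apply: cvgM; [exact: cvg_cst|exact: cP].
apply: (@le_trans _ _ (avg (fun s => 2 `^ Q * (1 + 2 `^ Q) + 2 `^ Q * K * poisson f (W
  (circle_pt r s))))).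
  by apply: le_avg => // s; apply: cvgD; [exact: cvg_cst|exact: cK].
rewrite (avgD (@continuous_cst R _) cK) avg_cst (avgZ _ cP).
have -> : avg (fun s => poisson f (W (circle_pt r s))) = m.
  have h : avg (fun s => poisson f (W (0 + circle_pt r s))) = poisson f (W 0).
    apply: (@avg_poisson_analytic R W 0 r f r0) => //; move=> z; rewrite subr0.
      exact: dW.
    exact: W1.
  rewrite -(eq_avg (f := fun s => poisson f (W (0 + circle_pt r s)))); last by move=> s;
    rewrite add0r.
  by rewrite h /W om0 mulr0 poisson_at0.
have : 2 `^ Q * K * m <= 2 `^ Q * K.
  by rewrite ler_piMr// mulr_ge0// powR_ge0.
lra.
Qed.


Let scaleE r sg t : 0 < sg ->
  circle_pt r t = ((sg%:C)%C : Cplx R) * circle_pt (r / sg) t.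
Proof. by move=> sg0; apply: circle_pt_scale; rewrite gt_eqF. Qed.

Let ratio01 r sg : 0 < r -> r < sg -> 0 < r / sg < 1.
Proof.
move=> r0 rs; have sg0 : 0 < sg by exact: lt_trans rs.
by rewrite divr_gt0//= ltr_pdivrMr// mul1r.
Qed.

Let cg2 r : 0 < r < 1 -> continuous (fun t => g (circle_pt r t) ^+ 2).
Proof.
by move=> h t; apply: (@continuous_sqr _ R (fun t => g (circle_pt r t))); exact: cgr.
Qed.

Let J r := avg (fun t => g (circle_pt r t) ^+ 2).

Let g_le_poisson r sg s : 0 < r -> r < sg -> sg < 1 ->
  g (circle_pt r s) <= poisson (fun t => g (circle_pt sg t)) (circle_pt (r / sg) s).
Proof.
move=> r0 rs s1; have sg0 : 0 < sg by exact: lt_trans rs.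
rewrite (scaleE _ _ sg0); apply: g_sub; first by rewrite sg0.
by apply: circ1; exact: ratio01.
Qed.

(** Expanding the square, the cross term has the right sign because [g] is at
    most its Poisson integral. *)
Let poisson_variance r sg s : 0 < r -> r < sg -> sg < 1 ->
  poisson (fun t => (g (circle_pt sg t) - g (circle_pt r s)) ^+ 2) (circle_pt (r / sg) s) <=
  poisson (fun t => g (circle_pt sg t) ^+ 2) (circle_pt (r / sg) s) - g (circle_pt r s) ^+ 2.
Proof.
move=> r0 rs s1; have sg01 : 0 < sg < 1 by rewrite (lt_trans r0 rs).
set z := circle_pt (r / sg) s; set c := g (circle_pt r s).
have z1 : cabs z < 1 by apply: circ1; exact: ratio01.
have cf := cgr sg01; have cf2 := cg2 sg01.
have cl : continuous (fun t => - (2 * c) * g (circle_pt sg t)).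
  by move=> t; apply: cvgM; [exact: cvg_cst|exact: cf].
have cl2 : continuous (fun t => - (2 * c) * g (circle_pt sg t) + c ^+ 2).
  by move=> t; apply: cvgD; [exact: cl|exact: cvg_cst].
have -> : (fun t => (g (circle_pt sg t) - c) ^+ 2) =
    (fun t => g (circle_pt sg t) ^+ 2 + (- (2 * c) * g (circle_pt sg t) + c ^+ 2)).
  by apply/funext => t; ring.
rewrite (poissonD z1 cf2 cl2) (poissonD z1 cl (@continuous_cst R _)) (poissonZ _ z1 cf)
  (poisson_cst _ z1).
have c0 : 0 <= c by exact: g_ge0.
have : c * c <= c * poisson (fun t => g (circle_pt sg t)) z.
  by rewrite ler_wpM2l//; exact: g_le_poisson.
rewrite -expr2; lra.
Qed.

Let J_variance r sg : 0 < r -> r < sg -> sg < 1 ->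
  avg (fun s => poisson (fun t => g (circle_pt sg t) ^+ 2) (circle_pt (r / sg) s)
                - g (circle_pt r s) ^+ 2) = J sg - J r.
Proof.
move=> r0 rs s1; have sg01 : 0 < sg < 1 by rewrite (lt_trans r0 rs).
have r01 : 0 < r < 1 by rewrite r0 (lt_trans rs).
have a01 := ratio01 r0 rs.
have cP : continuous (fun s => poisson (fun t => g (circle_pt sg t) ^+ 2) (circle_pt (r / sg)
  s)).
  by apply: continuous_on_circle; [move=> z z1; apply: continuous_poisson => //; exact:
    cg2|exact: r_ge0].
rewrite (avgB cP (cg2 r01)) avg_poisson_circle//; first exact: r_ge0.
  exact: cg2.
by move=> t; exact: sqr_ge0.
Qed.

Let J_mono r sg : 0 < r -> r < sg -> sg < 1 -> J r <= J sg.
Proof.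
move=> r0 rs s1; rewrite -subr_ge0 -J_variance//.
have sg01 : 0 < sg < 1 by rewrite (lt_trans r0 rs).
have r01 : 0 < r < 1 by rewrite r0 (lt_trans rs).
have a01 := ratio01 r0 rs.
apply: avg_ge0.
  move=> s; apply: cvgB; last exact: cg2.
  by apply: continuous_on_circle; [move=> z z1; apply: continuous_poisson => //; exact:
    cg2|exact: r_ge0].
move=> s; apply: le_trans (poisson_variance _ r0 rs s1).
have cd : continuous (fun t => g (circle_pt sg t) - g (circle_pt r s)).
  by move=> t; apply: cvgB; [exact: cgr|exact: cvg_cst].
apply: poisson_ge0; first exact: circ1.
  by move=> t; apply: (@continuous_sqr _ R (fun t => g (circle_pt sg t) - g (circle_pt r
    s))); exact: cd.
by move=> t; exact: sqr_ge0.
Qed.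

Hypothesis q_unif : forall e, 0 < e -> exists2 C : R, 0 <= C &
  forall z w, cabs z < 1 -> cabs w < 1 -> `|q z - q w| <= e + C * cabs (z - w) ^+ 2.

Let truncated_modular tau r := avg (fun t => Num.min (g (circle_pt r t)) tau `^ q (circle_pt
  r t)).

Let cmin tau r : 0 < r < 1 -> continuous (fun t => Num.min (g (circle_pt r t)) tau).
Proof.
move=> h t; apply: (@continuous_min R R (fun t => g (circle_pt r t)) (cst tau)).
  exact: cgr.
exact: cst_continuous.
Qed.

Let min_ge0 tau r t : 0 <= tau -> 0 <= Num.min (g (circle_pt r t)) tau.
Proof. by move=> h; rewrite le_min g_ge0. Qed.

Let cEmod tau r : 0 <= tau -> 0 < r < 1 ->
  continuous (fun t => Num.min (g (circle_pt r t)) tau `^ q (circle_pt r t)).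
Proof.
move=> tau0 h t.
apply: (@continuous_powR2 R R (fun t => Num.min (g (circle_pt r t)) tau) (fun t => q
  (circle_pt r t))).
- by move=> v; exact: min_ge0.
- exact: qr0.
- exact: cmin.
- exact: cqr.
Qed.

(** Continuity on the rectangle of truncated values and exponents, which is
    placed in the complex plane to reuse [continuous_quadratic]; truncation does
    not increase distances. *)
Let min_powR_quadratic tau eps : 0 <= tau -> 0 < eps -> exists2 C : R, 0 <= C &
  forall x y a b, 0 <= x -> 0 <= y -> 2 <= a <= Q -> 2 <= b <= Q ->
  `|Num.min x tau `^ a - Num.min y tau `^ b| <= eps + C * ((x - y) ^+ 2 + (a - b) ^+ 2).
Proof.
move=> tau0 eps0.
pose S := @plane_pt R @` (`[0, tau] `*` `[2, Q]).
have cS : compact S.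
  apply: continuous_compact.
    apply: continuous_subspaceT => u.
    by apply: (@continuous_Complex R (R * R)%type fst snd); [exact: cvg_fst|exact: cvg_snd].
  by apply: compact_setX; exact: segment_compact.
pose phi (z : Cplx R) := `|complex.Re z| `^ complex.Im z.
have cphi z : S z -> {for z, continuous phi}.
  move=> [[u v] [/= _ hv] <-]; rewrite /= in_itv /= in hv.
  apply: (@continuous_powR2 R (Cplx R) (fun z => `|complex.Re z|) (@complex.Im R)).
  - by move=> v1; exact: normr_ge0.
  - by rewrite /=; lra.
  - apply: (@continuous_comp _ _ _ (@complex.Re R : Cplx R -> R) (fun x : R => `|x|)).
      exact: continuous_Re.
    exact: norm_continuous.
  - exact: continuous_Im.
have [C C0 hC] := continuous_quadratic cS cphi eps0.
exists C => // x y a b x0 y0 ha hb.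
have m0 u : 0 <= u -> 0 <= Num.min u tau <= tau.
  by move=> u0; rewrite le_min u0 tau0 ge_min lexx orbT.
have := hC (plane_pt (Num.min x tau, a)) (plane_pt (Num.min y tau, b)).
have i1 : S (plane_pt (Num.min x tau, a)).
  by exists (Num.min x tau, a) => //; split; rewrite /= in_itv//=; exact: m0.
have i2 : S (plane_pt (Num.min y tau, b)).
  by exists (Num.min y tau, b) => //; split; rewrite /= in_itv//=; exact: m0.
move=> /(_ i1 i2); rewrite /phi /=.
have /andP[mx _] := m0 _ x0; have /andP[my _] := m0 _ y0.
rewrite (ger0_norm mx) (ger0_norm my) => h; apply: le_trans h _; rewrite lerD2l ler_wpM2l//.
rewrite cabs_sqr /= lerD2r -[leLHS]real_normK ?num_real// -[leRHS]real_normK ?num_real//.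
rewrite ler_pXn2r ?nnegrE//.
have n1 := ler_norm (x - y).
have n2 := ler_norm (- (x - y)); rewrite normrN in n2.
by rewrite /Num.min; case: ltP => h1; case: ltP => h2 //; rewrite ler_norml; lra.
Qed.

Variable B : R.
Hypothesis circle_modular_le : forall r, 0 < r < 1 -> circle_modular r <= B.

Let J_le r : 0 < r -> r < 1 -> J r <= 1 + B.
Proof.
move=> r0 r1; have r01 : 0 < r < 1 by rewrite r0.
apply: (@le_trans _ _ (1 + circle_modular r)); last by rewrite lerD2l circle_modular_le.
rewrite -[X in X + _]avg_cst /circle_modular -(avgD (@continuous_cst R _) (cgq r01)).
apply: le_avg; first exact: cg2.
  by move=> t; apply: cvgD; [exact: cvg_cst|exact: cgq].
move=> t; have [g1|/ltW g1] := leP 1 (g (circle_pt r t)).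
  have /andP[q2 _] := qQ (circ1 t r01).
  by apply: le_trans (sqr_le_powR g1 q2) _; rewrite lerDr.
apply: (@le_trans _ _ 1); first exact: exprn_ile1.
by rewrite lerDl powR_ge0.
Qed.

(** The two circles are compared through the Poisson kernel.  The differences of
    values of [g] are controlled in mean square by [J sg - J r], and those of
    the exponents by the closeness of the circles, since the Poisson integral
    of the squared distance is [1 - (r / sg) ^+ 2]. *)
Let truncated_modular_cauchy tau : 0 <= tau -> exists L, cvg_at1 (truncated_modular tau) L.
Proof.
move=> tau0; apply: cauchy_at1 => eps eps0.
have e4 : 0 < eps / 4 by rewrite divr_gt0.
have [C C0 hC] := min_powR_quadratic tau0 e4.
have Q0 : 0 < Q by have z1 : cabs (0 : Cplx R) < 1; [rewrite cabs0|have /andP[] := qQ z1; lra].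
pose d := eps / (4 * (C + 1)).
have C1 : 0 < C + 1 by lra.
have d0 : 0 < d by rewrite divr_gt0// mulr_gt0.
have Cd : C * d <= eps / 4.
  rewrite /d (_ : C * _ = eps / 4 * (C / (C + 1))); last by field; rewrite gt_eqF.
  by apply: ler_piMr; [exact: ltW|rewrite ler_pdivrMr// mul1r; lra].
have [r1 r101 hJ] := increasing_at1 J_mono J_le d0.
have dQ : 0 < d / Q by rewrite divr_gt0.
have [C' C'0 hq] := q_unif dQ.
(* 1 - x bounds r, hence r / sg, from below; it makes the term in C' small *)
pose x := Num.min (1 / 2) (d / (2 * (C' + 1) * Q)).
have C'1 : 0 < C' + 1 by lra.
have x0 : 0 < x by rewrite lt_min !divr_gt0// !mulr_gt0.
have x1 : x <= 1 / 2 by rewrite ge_min lexx.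
have x2 : x * (2 * (C' + 1) * Q) <= d.
  by rewrite -ler_pdivlMr ?mulr_gt0// ge_min lexx orbT.
exists (Num.max r1 (1 - x)).
  have /andP[r10 r11] := r101.
  by rewrite lt_max r10 gt_max r11 /=; lra.
move=> r sg; rewrite gt_max => /andP[h1 h2] h3 h4.
have /andP[r10 r11] := r101.
have r0 : 0 < r by exact: lt_trans h1.
have sg0 : 0 < sg by exact: lt_trans h3.
have sg01 : 0 < sg < 1 by rewrite sg0.
have r01 : 0 < r < 1 by rewrite r0 (lt_trans h3).
have a01 := ratio01 r0 h3; have /andP[a0 a1] := a01.
have ra : r <= r / sg by rewrite ler_pdivlMr// ler_piMr// ltW.
have jv := hJ _ _ h1 h3 h4.
pose V s := poisson (fun t => g (circle_pt sg t) ^+ 2) (circle_pt (r / sg) s) - g (circle_pt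
  r s) ^+ 2.
have cV : continuous V.
  move=> s; apply: cvgB; last exact: cg2.
  by apply: continuous_on_circle; [move=> z z1; apply: continuous_poisson => //; exact:
    cg2|exact: r_ge0].
pose psi t := Num.min (g (circle_pt sg t)) tau `^ q (circle_pt sg t).
have cpsi : continuous psi by exact: cEmod.
have psi0 t : 0 <= psi t by exact: powR_ge0.
have cpsir : continuous (fun t => Num.min (g (circle_pt r t)) tau `^ q (circle_pt r t)) by
  exact: cEmod.
have cPpsi : continuous (fun s => poisson psi (circle_pt (r / sg) s)).
  by apply: continuous_on_circle; [move=> z z1; exact: continuous_poisson|exact: r_ge0].
have D2 : Q * (d / Q + C' * (1 - (r / sg) ^+ 2)) <= 2 * d.
  have : 1 - (r / sg) ^+ 2 <= 2 * x by nra.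
  move=> h; have : C' * (1 - (r / sg) ^+ 2) <= C' * (2 * x) by rewrite ler_wpM2l.
  move=> h'; have h'' : Q * (C' * (1 - (r / sg) ^+ 2)) <=
    Q * (C' * (2 * x)) by rewrite ler_pM2l.
  rewrite mulrDr (mulrC Q (d / Q)) divfK ?gt_eqF//.
  have : 0 <= x * Q by rewrite mulr_ge0// ltW.
  nra.
have bd s : `|poisson psi (circle_pt (r / sg) s) - Num.min (g (circle_pt r s)) tau `^ q
  (circle_pt r s)|
    <= C * V s + (eps / 4 + C * (2 * d)).
  set z := circle_pt (r / sg) s; have z1 : cabs z < 1 by exact: circ1.
  set c := _ `^ _; have qr := qQ (circ1 s r01).
  have cgs := cgr sg01.
  have cdif : continuous (fun t => (g (circle_pt sg t) - g (circle_pt r s)) ^+ 2).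
    move=> t; apply: (@continuous_sqr _ R (fun t => g (circle_pt sg t) - g (circle_pt r s))).
    by apply: cvgB; [exact: cgs|exact: cvg_cst].
  have cdist : continuous (fun t => cabs (eit t - z) ^+ 2).
    move=> t; apply: (@continuous_sqr _ R (fun t => cabs (eit t - z))).
    by apply: continuous_distC; [exact: continuous_eit|exact: cst_continuous].
  pose up t := C * (g (circle_pt sg t) - g (circle_pt r s)) ^+ 2 +
     (C * Q * C' * cabs (eit t - z) ^+ 2 + (eps / 4 + C * d)).
  have cu1 : continuous (fun t => C * (g (circle_pt sg t) - g (circle_pt r s)) ^+ 2).
    by move=> t; apply: cvgM; [exact: cvg_cst|exact: cdif].
  have cu2 : continuous (fun t => C * Q * C' * cabs (eit t - z) ^+ 2).
    by move=> t; apply: cvgM; [exact: cvg_cst|exact: cdist].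
  have cu3 : continuous (fun t => C * Q * C' * cabs (eit t - z) ^+ 2 + (eps / 4 + C * d)).
    by move=> t; apply: cvgD; [exact: cu2|exact: cvg_cst].
  have cup : continuous up by move=> t; apply: cvgD; [exact: cu1|exact: cu3].
  have PIup : poisson up z <= C * V s + (eps / 4 + C * (2 * d)).
    rewrite (poissonD z1 cu1 cu3) (poissonD z1 cu2 (@continuous_cst R _)) (poissonZ _ z1
      cdif) (poissonZ _ z1 cdist).
    rewrite (poisson_cst _ z1) poisson_dist_sqr//.
    have := poisson_variance s r0 h3 h4; rewrite -/z -/(V s) => hv.
    have : C * poisson (fun t => (g (circle_pt sg t) - g (circle_pt r s)) ^+ 2) z <=
      C * V s by rewrite ler_wpM2l.
    have zE : cabs z = r / sg by rewrite cabs_circle_pt gtr0_norm.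
    rewrite zE; have := ler_wpM2l C0 D2; rewrite mulrDr (mulrC Q (d / Q)) divfK ?gt_eqF//.
    lra.
  have ptw t : `|psi t - c| <= up t.
    have qs := qQ (circ1 t sg01).
    apply: le_trans (hC _ _ _ _ (g_ge0 _) (g_ge0 _) qs qr) _.
    rewrite /up.
    have hqd : `|q (circle_pt sg t) - q (circle_pt r s)| <= d / Q + C' * cabs (eit t - z) ^+ 2.
      apply: le_trans (hq _ _ (circ1 t sg01) (circ1 s r01)) _.
      rewrite lerD2l ler_wpM2l// (scaleE r s sg0) -/z circle_ptE -mulrBr cabsM cabs_real.
      rewrite gtr0_norm// exprMn; apply: ler_piMl; first exact: sqr_ge0.
      by apply: exprn_ile1; exact: ltW.
    have hqQ : `|q (circle_pt sg t) - q (circle_pt r s)| <= Q.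
      by case/andP: qs => ? ?; case/andP: qr => ? ?; rewrite ler_norml; lra.
    have sqd : (q (circle_pt sg t) - q (circle_pt r s)) ^+ 2 <=
      d + Q * C' * cabs (eit t - z) ^+ 2.
      rewrite -[leLHS]real_normK ?num_real// expr2.
      apply: le_trans (ler_pM _ _ hqQ hqd) _ => //.
      by rewrite mulrDr (mulrC Q (d / Q)) divfK ?gt_eqF// mulrA.
    have := ler_wpM2l C0 sqd; lra.
  have p1 := poissonD z1 cpsi (@continuous_cst R (- c)).
  have p2 : poisson psi z - c = poisson (fun t => psi t + - c) z by rewrite p1 (poisson_cst _
    z1).
  have cpc : continuous (fun t => psi t + - c).
    by move=> t; apply: cvgD; [exact: cpsi|exact: cvg_cst].
  have cnup : continuous (fun t => -1 * up t).
    by move=> t; apply: cvgM; [exact: cvg_cst|exact: cup].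
  apply: le_trans PIup; rewrite p2 ler_norml; apply/andP; split.
    rewrite -[leLHS]mulN1r -(poissonZ _ z1 cup); apply: le_poisson => // t.
    by have := ptw t; rewrite ler_norml mulN1r => /andP[].
  by apply: le_poisson => // t; have := ptw t; rewrite ler_norml => /andP[].
have c2 : continuous (fun s => C * V s).
  by move=> s; apply: cvgM; [exact: cvg_cst|exact: cV].
have c3 : continuous (fun s => C * V s + (eps / 4 + C * (2 * d))).
  by move=> s; apply: cvgD; [exact: c2|exact: cvg_cst].
have Esg : truncated_modular tau sg = avg (fun s => poisson psi (circle_pt (r / sg) s)).
  by rewrite avg_poisson_circle//; exact: r_ge0.
have cN : continuous (fun s => -1 * (C * V s + (eps / 4 + C * (2 * d)))).
  by move=> s; apply: cvgM; [exact: cvg_cst|exact: c3].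
have fin : avg (fun s => C * V s + (eps / 4 + C * (2 * d))) <= eps.
  rewrite (avgD c2 (@continuous_cst R _)) (avgZ _ cV) avg_cst /V J_variance//.
  have := ler_wpM2l C0 jv; lra.
apply: le_trans fin; rewrite Esg /truncated_modular -(avgB cPpsi cpsir).
have cdd : continuous (fun s => poisson psi (circle_pt (r / sg) s) -
    Num.min (g (circle_pt r s)) tau `^ q (circle_pt r s)).
  by move=> s; apply: cvgB; [exact: cPpsi|exact: cpsir].
rewrite ler_norml; apply/andP; split.
  rewrite -[leLHS]mulN1r -(avgZ _ c3); apply: le_avg => // s.
  by have := bd s; rewrite ler_norml mulN1r => /andP[].
by apply: le_avg => // s; have := bd s; rewrite ler_norml => /andP[].
Qed.


Let excess tau0 tau r t := Num.min (g (circle_pt r t)) tau - Num.min (g (circle_pt r t)) tau0.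

Let cexc tau0 tau r : 0 < r < 1 -> continuous (excess tau0 tau r).
Proof. by move=> h t; apply: cvgB; exact: cmin. Qed.

Let excess_ge0 tau0 tau r t : tau0 <= tau -> 0 <= excess tau0 tau r t.
Proof.
move=> h; rewrite /excess subr_ge0 /Num.min; case: ltP => h1; case: ltP => h2 //; lra.
Qed.

Let cexcq tau0 tau r : tau0 <= tau -> 0 < r < 1 ->
  continuous (fun t => excess tau0 tau r t `^ q (circle_pt r t)).
Proof.
move=> h h1 t.
apply: (@continuous_powR2 R R (excess tau0 tau r) (fun t => q (circle_pt r t))).
- by move=> v; exact: excess_ge0.
- exact: qr0.
- exact: cexc.
- exact: cqr.
Qed.

(** Powers with exponent at least one are superadditive. *)
Let avg_excess tau0 tau r : 0 <= tau0 -> tau0 <= tau -> 0 < r < 1 ->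
  avg (fun t => excess tau0 tau r t `^ q (circle_pt r t)) <=
    truncated_modular tau r - truncated_modular tau0 r.
Proof.
move=> t0 tt h; have t1 := le_trans t0 tt.
rewrite /truncated_modular -(avgB (cEmod t1 h) (cEmod t0 h)); apply: le_avg.
- exact: cexcq.
- by move=> t; apply: cvgB; exact: cEmod.
move=> t; have /andP[q2 _] := qQ (circ1 t h).
have := @powRD_ge R (excess tau0 tau r t) (Num.min (g (circle_pt r t)) tau0) (q (circle_pt r
  t)).
rewrite {3}/excess subrK => /(_ (excess_ge0 _ _ tt) (min_ge0 _ _ t0)); lra.
Qed.

(** The part of [g] above [tau] is at most [g ^+ 2 / tau], of mean at most
    [(1 + B) / tau]; for large [tau] this outweighs the maximum of the kernel,
    which depends on [r] only. *)
Let g_le_split r rho tau0 tau s : 0 < r -> (1 + r) / 2 <= rho -> rho < 1 ->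
  0 <= tau0 -> tau0 <= tau -> 0 < tau -> 4 * (1 + B) / (1 - r) <= tau ->
  g (circle_pt r s) <= (tau0 + 1) + poisson (excess tau0 tau rho) (circle_pt (r / rho) s).
Proof.
move=> r0 rr rho1 t0 tt tau_gt0 tB.
have r_rho : r < rho by lra.
have rho0 : 0 < rho by lra.
have rho01 : 0 < rho < 1 by rewrite rho0.
have a01 := ratio01 r0 r_rho; have /andP[a0 a1] := a01.
set z := circle_pt (r / rho) s; have z1 : cabs z < 1 by exact: circ1.
have zE : cabs z = r / rho by rewrite cabs_circle_pt gtr0_norm.
have cf := cgr rho01.
have c1 : continuous (fun t => Num.min (g (circle_pt rho t)) tau0) by exact: cmin.
have c2 : continuous (excess tau0 tau rho) by exact: cexc.
have c3 : continuous (fun t => tau^-1 * g (circle_pt rho t) ^+ 2).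
  by move=> t; apply: cvgM; [exact: cvg_cst|exact: cg2].
have c23 : continuous (fun t => excess tau0 tau rho t + tau^-1 * g (circle_pt rho t) ^+ 2).
  by move=> t; apply: cvgD; [exact: c2|exact: c3].
have c123 : continuous (fun t => Num.min (g (circle_pt rho t)) tau0 +
    (excess tau0 tau rho t + tau^-1 * g (circle_pt rho t) ^+ 2)).
  by move=> t; apply: cvgD; [exact: c1|exact: c23].
apply: le_trans (g_le_poisson s r0 r_rho rho1) _; rewrite -/z.
apply: (@le_trans _ _ (poisson (fun t => Num.min (g (circle_pt rho t)) tau0 +
    (excess tau0 tau rho t + tau^-1 * g (circle_pt rho t) ^+ 2)) z)).
  apply: le_poisson => // t; rewrite /excess addrA subrKC.
  set u := g _; have u0 : 0 <= u by exact: g_ge0.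
  rewrite /Num.min; case: ltP => h1.
    by rewrite lerDl mulr_ge0 ?sqr_ge0// invr_ge0 ltW.
  suff : u <= tau^-1 * u ^+ 2 by lra.
  rewrite mulrC ler_pdivlMr//; nra.
rewrite (poissonD z1 c1 c23) (poissonD z1 c2 c3).
have p1 : poisson (fun t => Num.min (g (circle_pt rho t)) tau0) z <= tau0.
  rewrite -[leRHS](poisson_cst tau0 z1); apply: le_poisson => //; first exact: continuous_cst.
  by move=> t; rewrite ge_min lexx orbT.
suff : poisson (fun t => tau^-1 * g (circle_pt rho t) ^+ 2) z <= 1 by lra.
apply: le_trans (poisson_le_avg z1 c3 _) _.
  by move=> t; rewrite mulr_ge0 ?sqr_ge0// invr_ge0 ltW.
rewrite (avgZ _ (cg2 rho01)) -/(J rho) zE.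
have J0 : 0 <= J rho by apply: avg_ge0; [exact: cg2|move=> t; exact: sqr_ge0].
have JB := J_le rho0 rho1.
have da : (1 - r) / 2 <= 1 - r / rho.
  have : r / rho <= r / ((1 + r) / 2).
    by rewrite ler_pM2l// lef_pV2 ?posrE//; lra.
  have : r / ((1 + r) / 2) <= (1 + r) / 2 by rewrite ler_pdivrMr; [nra|lra].
  lra.
have q1 : 2 / (1 - r / rho) <= 4 / (1 - r).
  have -> : 4 / (1 - r) = 2 / ((1 - r) / 2) by field; lra.
  by rewrite ler_pM2l// lef_pV2 ?posrE//; lra.
have B0 : 0 <= 1 + B by lra.
apply: (@le_trans _ _ (4 / (1 - r) * (tau^-1 * (1 + B)))).
  apply: ler_pM => //.
  - by rewrite divr_ge0//; lra.
  - by rewrite mulr_ge0// invr_ge0 ltW.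
  - by rewrite ler_pM2l// invr_gt0.
by rewrite mulrCA mulrC ler_pdivrMr// mul1r; lra.
Qed.

Let truncated_modular_le tau r :
  0 <= tau -> 0 < r < 1 -> truncated_modular tau r <= circle_modular r.
Proof.
move=> t0 h; apply: le_avg; [exact: cEmod|exact: cgq|] => t.
by apply: le_powR; [exact: ltW (qr0 _ h)|exact: min_ge0|rewrite ge_min lexx].
Qed.

(** The limits of the truncated modulars increase with the level towards their
    supremum.  So beyond a suitable level [tau0] the excess has small modular on
    the circles close to the boundary, whatever the upper level, and the key
    estimate, used with a small [k], carries this over to every smaller circle
    through [g_le_split]. *)
Let uniformly_integrable eps : 0 < eps -> exists2 tau1, 0 <= tau1 &
  forall r, 0 < r < 1 -> circle_modular r <= truncated_modular tau1 r + eps.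
Proof.
move=> eps0.
have close_diff (u0 u1 l0 l1 m d : R) : m - d / 3 < l0 -> l1 <= m ->
    `|u1 - l1| <= d / 3 -> `|u0 - l0| <= d / 3 -> u1 - u0 <= d.
  by rewrite !ler_norml => ? ? /andP[? ?] /andP[? ?]; lra.
have Q2 : 2 <= Q by have z1 : cabs (0 : Cplx R) < 1; [rewrite cabs0|have /andP[] := qQ z1; lra].
pose A : R := 2 `^ Q.
have A1 : 1 <= A by rewrite -(powRr0 2) ler_powR//; [lra|lra].
have A0 : 0 < A by lra.
have AA0 : 0 < A * A by rewrite mulr_gt0.
pose k := Num.min 1 (eps / (3 * (A * A))).
have k0 : 0 < k by rewrite lt_min ltr01 divr_gt0// mulr_gt0.
have k1 : k <= 1 by rewrite ge_min lexx.
have k01 : 0 < k <= 1 by rewrite k0.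
have hk : A * A * k ^+ 2 <= eps / 3.
  apply: (@le_trans _ _ (A * A * k)).
    by rewrite ler_pM2l// expr2 ler_piMr// ltW.
  apply: (@le_trans _ _ (A * A * (eps / (3 * (A * A))))).
    by rewrite ler_pM2l// ge_min lexx orbT.
  by rewrite (_ : A * A * _ = eps / 3)//; field; rewrite gt_eqF.
pose K' := K / k `^ Q.
have K'0 : 0 <= K' by rewrite divr_ge0// powR_ge0.
pose m0 := Num.min (1 / 2) (eps / (3 * (A * A * (K' + 2)))).
have K'2 : 0 < K' + 2 by lra.
have AK0 : 0 < A * A * (K' + 2) by rewrite mulr_gt0.
have m00 : 0 < m0 by rewrite lt_min !divr_gt0// mulr_gt0.
have m01 : m0 <= 1 / 2 by rewrite ge_min lexx.
have hm : A * A * (K' + 2) * m0 <= eps / 3.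
  apply: (@le_trans _ _ (A * A * (K' + 2) * (eps / (3 * (A * A * (K' + 2)))))).
    by rewrite ler_pM2l// ge_min lexx orbT.
  by rewrite (_ : A * A * (K' + 2) * _ = eps / 3)//; field; rewrite !gt_eqF.
have /choice[ell hell] : forall tau, exists L, 0 <= tau -> cvg_at1 (truncated_modular tau) L.
  move=> tau; have [t0|t0] := leP 0 tau; last first.
    by exists 0.
  by have [L hL] := truncated_modular_cauchy t0; exists L.
pose S := [set x | exists2 tau, 0 <= tau & x = ell tau].
have supS : has_sup S.
  split; first by exists (ell 0), 0.
  exists (B + 1) => _ [tau t0 ->].
  have [r1 /andP[r10 r11] h] := hell _ t0 1 ltr01.
  have h1 : r1 < (1 + r1) / 2 by lra.
  have h2 : (1 + r1) / 2 < 1 by lra.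
  have h3 : 0 < (1 + r1) / 2 < 1 by lra.
  have := h _ h1 h2; have := truncated_modular_le t0 h3; have := circle_modular_le h3.
  by rewrite ler_norml => ? ? /andP[]; lra.
have m03 : 0 < m0 / 3 by rewrite divr_gt0.
have [_ [tau0 t00 ->] htau0] := sup_adherent m03 supS.
pose T := A * (tau0 + 1) `^ Q.
have T1 : 1 <= T.
  have : 1 <= (tau0 + 1) `^ Q by rewrite -[leLHS](powRr0 (tau0 + 1)); apply: ler_powR; lra.
  rewrite /T; nra.
exists T; first lra.
move=> r r01; have /andP[r0 r1] := r01.
pose tau := Num.max (Num.max tau0 1) (4 * (1 + B) / (1 - r)).
have tt0 : tau0 <= tau by rewrite !le_max lexx.
have t1 : 1 <= tau by rewrite !le_max lexx orbT.
have tB : 4 * (1 + B) / (1 - r) <= tau by rewrite !le_max lexx orbT.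
have tau_ge0 : 0 <= tau by lra.
have tau_gt0 : 0 < tau by lra.
have [r2 /andP[r20 r21] h2] := hell _ t00 (m0 / 3) m03.
have [r3 /andP[r30 r31] h3] := hell _ tau_ge0 (m0 / 3) m03.
pose x := Num.max r (Num.max r2 r3); pose rho := (1 + x) / 2.
have x1 : x < 1 by rewrite !gt_max r1 r21.
have xr : r <= x by rewrite le_max lexx.
have xr2 : r2 <= x by rewrite !le_max lexx orbT.
have xr3 : r3 <= x by rewrite !le_max lexx !orbT.
have rho1 : rho < 1 by rewrite /rho; lra.
have rrho : (1 + r) / 2 <= rho by rewrite /rho; lra.
have rho0 : 0 < rho by rewrite /rho; lra.
have rho01 : 0 < rho < 1 by rewrite rho0.
have r_rho : r < rho by rewrite /rho; lra.
have lt2 : r2 < rho by rewrite /rho; lra.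
have lt3 : r3 < rho by rewrite /rho; lra.
pose m := avg (fun t => excess tau0 tau rho t `^ q (circle_pt rho t)).
have ceq : continuous (fun t => excess tau0 tau rho t `^ q (circle_pt rho t)) by exact: cexcq.
have mm0 : m <= m0.
  apply: le_trans (avg_excess t00 tt0 rho01) _.
  apply: close_diff htau0 _ (h3 _ lt3 rho1) (h2 _ lt2 rho1).
  by apply: sup_upper_bound => //; exists tau.
have m_ge0 : 0 <= m by apply: avg_ge0 => // t; exact: powR_ge0.
have a01 := ratio01 r0 r_rho.
pose P s := poisson (excess tau0 tau rho) (circle_pt (r / rho) s).
have ce : continuous (excess tau0 tau rho) by exact: cexc.
have e0 t : 0 <= excess tau0 tau rho t by exact: excess_ge0.
have P0 s : 0 <= P s by apply: poisson_ge0 => //; exact: circ1.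
pose h s := poisson (fun t => excess tau0 tau rho t `^ q (circle_pt rho t)) (circle_pt (r /
  rho) s).
have hP s : P s `^ q (circle_pt r s) <= A * (k ^+ 2 + K' * h s + 2 * m).
  have z1 : cabs (circle_pt (r / rho) s : Cplx R) < 1 by exact: circ1.
  have qr := qQ (circ1 s r01); have /andP[qr2 _] := qr.
  have ql t := q_log t rho01 z1; rewrite -(scaleE r s rho0) in ql.
  apply: le_trans (key_estimate z1 ce e0 (cqr rho01) (fun t => qQ (circ1 t rho01)) qr k01 ql) _.
  rewrite ler_pM2l// lerD2l -/m.
  have m21 : 0 <= 2 * m <= 1 by lra.
  apply: le_trans (powR_le_sqr m21 qr2) _; nra.
have gP s : g (circle_pt r s) `^ q (circle_pt r s) <=
    Num.min (g (circle_pt r s)) T `^ q (circle_pt r s) + A * (A * (k ^+ 2 + K' * h s + 2 * m)).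
  have /andP[qr2 qrQ] := qQ (circ1 s r01).
  have X0 : 0 <= A * (A * (k ^+ 2 + K' * h s + 2 * m)).
    rewrite mulr_ge0 ?(ltW A0)//; apply: le_trans (hP s); exact: powR_ge0.
  have [gT|Tg] := leP (g (circle_pt r s)) T; first by rewrite lerDl.
  apply: (@le_trans _ _ ((tau0 + 1 + P s) `^ q (circle_pt r s))).
    by apply: le_powR; [lra|exact: g_ge0|exact: g_le_split].
  apply: le_trans (@powRD_le _ _ _ _ Q _ (P0 s) _) _; [lra|lra|].
  rewrite mulrDr; apply: lerD; last by rewrite ler_pM2l.
  apply: (@le_trans _ _ T).
    by rewrite ler_pM2l//; apply: ler_powR => //; lra.
  by apply: le1r_powR; lra.
have ch : continuous h.
  by apply: continuous_on_circle; [move=> z z1; exact: continuous_poisson|exact: r_ge0].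
have avgh : avg h = m.
  by apply: avg_poisson_circle => //; [exact: r_ge0|move=> t; exact: powR_ge0].
have T0 : 0 <= T by lra.
have cE := cEmod T0 r01.
have ch2 : continuous (fun s => A * A * K' * h s).
  by move=> s; apply: cvgM; [exact: cvg_cst|exact: ch].
have ch3 : continuous (fun s => A * A * K' * h s + A * A * (k ^+ 2 + 2 * m)).
  by move=> s; apply: cvgD; [exact: ch2|exact: cvg_cst].
apply: (@le_trans _ _ (avg (fun s => Num.min (g (circle_pt r s)) T `^ q (circle_pt r s) +
    (A * A * K' * h s + A * A * (k ^+ 2 + 2 * m))))).
  apply: le_avg; [exact: cgq| |].
    by move=> s; apply: cvgD; [exact: cE|exact: ch3].
  by move=> s; have := gP s; lra.
rewrite (avgD cE ch3) -/(truncated_modular T r) lerD2l (avgD ch2 (@continuous_cst R _)) (avgZ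
  _ ch) avg_cst avgh.
have : A * A * (K' + 2) * m <= A * A * (K' + 2) * m0 by rewrite ler_pM2l.
lra.
Qed.

(** Truncation at a high level makes the modulars Cauchy and changes them little,
    uniformly in the radius. *)
Theorem circle_modular_cvg : exists L, cvg_at1 circle_modular L.
Proof.
have close (u v u' v' L e : R) : `|u' - L| <= e / 6 -> `|v' - L| <= e / 6 ->
    u' <= u -> v' <= v -> u <= u' + e / 3 -> v <= v' + e / 3 -> `|v - u| <= e.
  by rewrite !ler_norml => /andP[? ?] /andP[? ?] ? ? ? ?; apply/andP; split; lra.
apply: cauchy_at1 => e e0; have e3 : 0 < e / 3 by rewrite divr_gt0.
have [tau t0 hU] := uniformly_integrable e3.
have [L hL] := truncated_modular_cauchy t0.
have e6 : 0 < e / 6 by rewrite divr_gt0.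
have [r0 /andP[r00 r01] h] := hL _ e6.
exists r0; first by rewrite r00.
move=> r s h1 h2 h3.
have r_01 : 0 < r < 1 by lra.
have s_01 : 0 < s < 1 by lra.
have h4 : r < 1 by lra.
have h5 : r0 < s by lra.
exact: close (h _ h1 h4) (h _ h5 h3) (truncated_modular_le t0 r_01) (truncated_modular_le t0
  s_01)
  (hU _ r_01) (hU _ s_01).
Qed.

End SubharmonicModular.

(** * Log-Hoelder exponents *)

Section Exponent.
Variable R : realType.
Implicit Types (z w : Cplx R) (p : Cplx R -> R).

(** Two steps of length at most one half join any point to the origin. *)
Lemma log_holder_bounded p : log_holder p ->
  exists M : R, forall z, cabs z <= 1 -> `|p z| <= M.
Proof.
move=> [C0 hC].
have zero1 : closed_disc (0 : Cplx R) by rewrite /closed_disc /= cabs0.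
pose L := `|C0| / ln 2.
have ln2 : 0 < ln 2 :> R by rewrite ln_gt0// ltr1n.
have L0 : 0 <= L by rewrite divr_ge0// ltW.
have near12 z w : cabs z <= 1 -> cabs w <= 1 -> cabs (z - w) <= 1 / 2 -> `|p z - p w| <= L.
  move=> z1 w1 zw; apply: le_trans (hC z w z1 w1 _) _; first by lra.
  have [e|e] := eqVneq (cabs (z - w)) 0.
    by rewrite e invr0 ln0// invr0 mulr0.
  have d0 : 0 < cabs (z - w) by rewrite lt_def e cabs_ge0.
  have l2 : ln 2 <= ln (cabs (z - w))^-1.
    rewrite ler_ln ?posrE ?invr_gt0//.
    by rewrite -[leLHS]invrK lef_pV2 ?posrE ?invr_gt0//; lra.
  apply: (@le_trans _ _ (`|C0| / ln (cabs (z - w))^-1)).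
    by rewrite ler_wpM2r ?ler_norm// invr_ge0; lra.
  by rewrite ler_wpM2l// lef_pV2 ?posrE//; lra.
exists (`|p 0| + 2 * L) => z z1.
pose h : Cplx R := ((1 / 2 : R)%:C)%C * z.
have zh : cabs h <= 1 / 2.
  by rewrite /h cabsM cabs_real ger0_norm ?divr_ge0//; have := cabs_ge0 z; lra.
have e1 : `|p h - p 0| <= L.
  by apply: near12; rewrite ?cabs0 ?subr0//; lra.
have e2 : `|p z - p h| <= L.
  apply: near12 => //; first by lra.
  rewrite /h -{1}[z]mul1r -mulrBl cabsM -[1 in X in X * _](rmorph1 (real_complex R)) -rmorphB.
  by rewrite cabs_real (_ : 1 - 1 / 2 = 1 / 2) ?ger0_norm; have := cabs_ge0 z; lra.
have -> : p z = (p z - p h) + ((p h - p 0) + p 0) by ring.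
apply: le_trans (ler_normD _ _) _; have := ler_normD (p h - p 0) (p 0); lra.
Qed.

Lemma log_holder_quadratic p (e : R) : log_holder p -> 0 < e ->
  exists2 C : R, 0 <= C & forall z w, cabs z <= 1 -> cabs w <= 1 ->
    `|p z - p w| <= e + C * cabs (z - w) ^+ 2.
Proof.
move=> lh e0; have [M hM] := log_holder_bounded lh.
have [C0 hC] := lh.
pose l := (`|C0| + 1) / e; pose d := expR (- l).
have l0 : 0 < l by rewrite divr_gt0// ltr_wpDl.
have d0 : 0 < d by exact: expR_gt0.
have d1 : d < 1 by rewrite expR_lt1 oppr_lt0.
have M0 : 0 <= M by apply: le_trans (normr_ge0 (p 0)) (hM 0 _); rewrite cabs0.
exists (2 * M / d ^+ 2); first by rewrite divr_ge0 ?exprn_ge0 ?(ltW d0)//; lra.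
move=> z w z1 w1.
have [zw|zw] := leP d (cabs (z - w)).
  apply: (@le_trans _ _ (2 * M)).
    apply: le_trans (ler_normB _ _) _; have := hM z z1; have := hM w w1; lra.
  apply: (@le_trans _ _ (2 * M / d ^+ 2 * cabs (z - w) ^+ 2)); last by rewrite lerDr ltW.
  rewrite -mulrA ler_peMr//; first lra.
  rewrite mulrC ler_pdivlMr ?exprn_gt0// mul1r ler_pXn2r ?nnegrE ?cabs_ge0//.
  exact: ltW.
apply: (@le_trans _ _ e); last by rewrite lerDl mulr_ge0 ?sqr_ge0// divr_ge0 ?exprn_ge0 ?(ltW
  d0)//; lra.
have [z_w|z_w] := eqVneq (cabs (z - w)) 0.
  apply: le_trans (hC z w z1 w1 _) _; first by rewrite z_w.
  by rewrite z_w invr0 ln0// invr0 mulr0 ltW.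
have q0 : 0 < cabs (z - w) by rewrite lt_def z_w cabs_ge0.
apply: le_trans (hC z w z1 w1 (lt_trans zw d1)) _.
have ll : l < ln (cabs (z - w))^-1.
  rewrite lnV ?posrE// ltrNr -(expRK (- l)) ltr_ln ?posrE ?expR_gt0//.
have lp : 0 < ln (cabs (z - w))^-1 by exact: lt_trans ll.
rewrite ler_pdivrMr//; apply: (@le_trans _ _ (`|C0| + 1)).
  by have := ler_norm C0; lra.
by rewrite mulrC -ler_pdivrMr// ltW.
Qed.

Lemma log_holder_continuous p z : log_holder p -> cabs z < 1 -> {for z, continuous p}.
Proof.
move=> lh z1; apply/continuous_cabsP => e e0.
have e2 : 0 < e / 4 by rewrite divr_gt0.
have [C C0 hC] := log_holder_quadratic lh e2.
pose d := Num.min (1 - cabs z) (Num.min 1 (e / (4 * (C + 1)))).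
have C1 : 0 < C + 1 by lra.
have d0 : 0 < d by rewrite !lt_min subr_gt0 z1 ltr01 divr_gt0// mulr_gt0.
exists d => // w wd.
have d1 : d <= 1 - cabs z by rewrite ge_min lexx.
have d2 : d <= 1 by rewrite !ge_min lexx orbT.
have d3 : d * (4 * (C + 1)) <= e.
  by rewrite -ler_pdivlMr ?mulr_gt0// !ge_min lexx !orbT.
have w1 : cabs w <= 1 by have := cabsB w z; lra.
apply: le_lt_trans (hC w z w1 (ltW z1)) _.
have q : cabs (w - z) ^+ 2 <= d by have := cabs_ge0 (w - z); nra.
have := ler_wpM2l C0 q; lra.
Qed.

(** By continuity, a violation of the essential lower bound would occur on a
    whole square, which has positive area. *)
Lemma variable_exponent_lower p : variable_exponent p -> log_holder p ->
  exists2 c : R, 0 < c & forall z, cabs z < 1 -> c <= p z.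
Proof.
move=> [pm _] lh.
have [c c0 hc] : exists2 c : R, 0 < c &
    \forall x \ae (@disc_area R), (c%:E <= (p (plane_pt x))%:E)%E.
  move: pm; rewrite /p_minus /ess_inf => /ereal_sup_gt[y hy y0].
  case: y hy y0 => [c hc|h _|//].
    by rewrite lte_fin => c0; exists c.
  by exists 1 => //; apply: filterS h => x /=; rewrite leye_eq => /eqP.
exists c => // z z1; rewrite leNgt; apply/negP => pz.
have [N [mN N0 hN]] := hc.
have cp := log_holder_continuous lh z1.
have e0 : 0 < c - p z by rewrite subr_gt0.
have /continuous_cabsP /(_ _ e0) [d d0 hd] := cp.
pose h := Num.min (d / 4) ((1 - cabs z) / 4).
have h0 : 0 < h by rewrite lt_min !divr_gt0// subr_gt0.
have h1 : h <= d / 4 by rewrite ge_min lexx.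
have h2 : h <= (1 - cabs z) / 4 by rewrite ge_min lexx orbT.
pose a := complex.Re z; pose b := complex.Im z.
pose Sq : set (measurableTypeR R * measurableTypeR R) :=
  `[a, a + h]%classic `*` `[b, b + h]%classic.
have sub : Sq `<=` N `&` (@plane_pt R @^-1` @disc R).
  move=> [x y] [/=]; rewrite !in_itv /= => hx hy.
  have zxy : cabs ((plane_pt (x, y) : Cplx R) - z) <= 2 * h.
    apply: le_trans (cabs_le _) _; rewrite /plane_pt /a /b in hx hy *.
    move: hx hy; case: (z) => u v /= hx hy.
    by rewrite !ger0_norm; lra.
  split.
    apply: hN => /=; rewrite lee_fin => cp'.
    have zd : cabs ((plane_pt (x, y) : Cplx R) - z) < d by lra.
    by have := hd _ zd; rewrite ltr_norml => /andP[_]; lra.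
  rewrite /disc /=; have := cabsB (plane_pt (x, y)) z; lra.
have mSq : measurable Sq by apply: measurableX; exact: measurable_itv.
have : ((@lebesgue_measure R \x @lebesgue_measure R) Sq <= @disc_area R N)%E.
  rewrite /disc_area /mrestr; apply: le_measure; rewrite ?inE//.
  by apply: measurableI => //; exact: measurable_disc.
rewrite N0 product_measure1E//.
rewrite /= !lebesgue_measure_itv /= !lte_fin !ltrDl h0 -!EFinD -EFinM lee_fin.
by rewrite !(addrC _ h) !addrK leNgt mulr_gt0.
Qed.

(** If the distance [d] is below one half, the logarithm of [1 / d] is at most the
    denominator of the log-Hoelder bound for the two dilated points, which are
    at distance [r * d]; otherwise the base is at most two. *)
Lemma log_holder_kernel p (s Q : R) : log_holder p -> 0 < s ->
  (forall z, cabs z < 1 -> 0 <= p z / s <= Q) ->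
  exists K : R, forall r z t, 0 < r < 1 -> cabs z < 1 ->
    Num.max 1 (cabs (eit t - z))^-1 `^ `|p (circle_pt r t) / s - p ((r%:C)%C * z) / s| <= K.
Proof.
move=> [C0 hC] s0 hQ.
pose C1 := `|C0| / s.
exists (Num.max (expR C1) (2 `^ Q)) => r z t r01 z1; have /andP[r0 r1] := r01.
set d := cabs (eit t - z); have d0 : 0 < d by exact: eit_dist_gt0.
set D := `|_ - _|.
have c1 : cabs (circle_pt r t : Cplx R) < 1 by rewrite cabs_circle_pt gtr0_norm.
have c2 : cabs ((r%:C)%C * z) < 1 by exact: scaled_disc.
have [d2|d2] := ltP d (1 / 2); last first.
  rewrite le_max; apply/orP; right.
  apply: (@le_trans _ _ (2 `^ D)).
    apply: le_powR; [exact: normr_ge0|by rewrite le_max ler01|].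
    rewrite ge_max ler1n /= -[leRHS]invrK lef_pV2 ?posrE ?invr_gt0//; lra.
  apply: ler_powR; first by rewrite ler1n.
  have := hQ _ c1; have := hQ _ c2; rewrite /D ler_norml; lra.
rewrite le_max; apply/orP; left.
have di : 1 < d^-1 by rewrite -[ltLHS]invr1 ltf_pV2 ?posrE//; lra.
rewrite (max_idPr (ltW di)) /powR gt_eqF ?invr_gt0// ler_expR.
have distE : cabs (circle_pt r t - (r%:C)%C * z) = r * d.
  by rewrite circle_ptE -mulrBr cabsM cabs_real gtr0_norm.
have rd0 : 0 < r * d by rewrite mulr_gt0.
have rdd : r * d <= d by rewrite ger_pMl// ltW.
have rd1 : r * d < 1 by lra.
have := hC _ _ (ltW c1) (ltW c2); rewrite distE => /(_ rd1) hh.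
have lnd : 0 < ln d^-1 by rewrite ln_gt0.
have lnrd : ln d^-1 <= ln (r * d)^-1.
  by rewrite ler_ln ?posrE ?invr_gt0// lef_pV2 ?posrE.
have lnrd0 : 0 < ln (r * d)^-1 by lra.
rewrite /D -mulrBl normrM (gtr0_norm (x := s^-1)) ?invr_gt0//.
rewrite mulrAC /C1 ler_pM2r ?invr_gt0//.
apply: (@le_trans _ _ (C0 / ln (r * d)^-1 * ln d^-1)); first by rewrite ler_pM2r.
apply: (@le_trans _ _ (`|C0| / ln (r * d)^-1 * ln d^-1)).
  by rewrite ler_pM2r// ler_pM2r ?invr_gt0// ler_norm.
rewrite -mulrA ler_piMr// mulrC ler_pdivrMr// mul1r.
exact: lnrd.
Qed.

End Exponent.

(** * Modulars of analytic functions *)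

Section AnalyticModular.
Variable R : realType.
Implicit Types (F om : Cplx R -> Cplx R) (z w : Cplx R) (r t : R).

Variables (p : Cplx R -> R) (c : R).
Hypotheses (c_gt0 : 0 < c) (p_ge : forall z, cabs z < 1 -> c <= p z).
Hypothesis p_lh : log_holder p.

Definition analytic_modular F r := avg (fun t => cabs (F (circle_pt r t)) `^ p (circle_pt r t)).

(** Dividing by a small power of one half brings the exponent above two and keeps
    the other hypotheses of the previous parts, with new constants. *)
Lemma exponent_setup : exists k Q K, let q := fun z => p z / (2^-1) ^+ k in
  [/\ forall z, cabs z < 1 -> 2 <= q z <= Q,
      forall r z t, 0 < r < 1 -> cabs z < 1 ->
        Num.max 1 (cabs (eit t - z))^-1 `^
          `|q (circle_pt r t) - q ((r%:C)%C * z)| <= K,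
      forall z, cabs z < 1 -> {for z, continuous q} &
      forall e, 0 < e -> exists2 C : R, 0 <= C & forall z w, cabs z < 1 ->
        cabs w < 1 -> `|q z - q w| <= e + C * cabs (z - w) ^+ 2].
Proof.
have [M hM] := log_holder_bounded p_lh.
have [k hk] : exists k : nat, (2^-1 : R) ^+ k <= c / 2.
  exists (Num.bound (2 / c)); set n := Num.bound _.
  have : 2 / c < n%:R by apply: archi_boundP; rewrite divr_ge0// ltW.
  rewrite exprVn => h; rewrite -[leRHS]invrK lef_pV2 ?posrE ?invr_gt0 ?exprn_gt0 ?divr_gt0//.
  rewrite invf_div; apply: le_trans (ltW h) _.
  by rewrite -natrX ler_nat ltnW// ltn_expl.
pose s : R := (2^-1) ^+ k; have s0 : 0 < s by rewrite exprn_gt0// invr_gt0.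
have hq z : cabs z < 1 -> 2 <= p z / s <= M / s.
  move=> z1; apply/andP; split.
    rewrite ler_pdivlMr//; have := p_ge z1; rewrite -/s in hk; lra.
  rewrite ler_pM2r ?invr_gt0//; apply: le_trans (ler_norm _) _.
  by apply: hM; exact: ltW.
have hq0 z : cabs z < 1 -> 0 <= p z / s <= M / s.
  by move=> /hq /andP[? ?]; apply/andP; split => //; lra.
have [K hK] := log_holder_kernel p_lh s0 hq0.
exists k, (M / s), K; split => //.
- move=> z z1; apply: (@continuousM R (Cplx R) p (cst s^-1)).
    exact: log_holder_continuous.
  exact: cst_continuous.
move=> e e0; have es : 0 < e * s by rewrite mulr_gt0.
have [C C0 hC] := log_holder_quadratic p_lh es.
exists (C / s); first by rewrite divr_ge0// ltW.
move=> z w z1 w1; rewrite -/s -mulrBl normrM (gtr0_norm (x := s^-1)) ?invr_gt0//.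
rewrite ler_pdivrMr//; apply: le_trans (hC z w (ltW z1) (ltW w1)) _.
by rewrite mulrDl lerD2l mulrAC divfK// gt_eqF.
Qed.

Lemma dyadic_root_powR k (x a : R) : 0 <= x -> dyadic_root k x `^ (a / (2^-1) ^+ k) = x `^ a.
Proof.
by move=> x0; rewrite dyadic_rootE// -powRrM mulrC divfK// expf_neq0// invr_eq0.
Qed.

Let cF F : analytic_on (@disc R) F -> forall z, cabs z < 1 -> {for z, continuous F}.
Proof. by move=> aF z z1; apply: cderivable_continuous; exact: aF. Qed.

Lemma continuous_dyadic_root_cabs k F z : {for z, continuous F} ->
  {for z, continuous (fun w => dyadic_root k (cabs (F w)))}.
Proof.
move=> h; apply: (@continuous_comp _ _ _ (fun w => cabs (F w)) (dyadic_root k)); last exact: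
  continuous_dyadic_root.
by apply: (@continuous_comp _ _ _ F); [exact: h|exact: continuous_cabs].
Qed.

Lemma dyadic_root_cabs_subharmonic k F r z : analytic_on (@disc R) F -> 0 < r < 1 ->
  cabs z < 1 ->
  dyadic_root k (cabs (F ((r%:C)%C * z))) <=
    poisson (fun t => dyadic_root k (cabs (F (circle_pt r t)))) z.
Proof.
move=> aF r01 z1; have /andP[r0 r1] := r01.
pose G w := F ((r%:C)%C * w).
have rw w : cabs w <= 1 -> cabs ((r%:C)%C * w) < 1.
  move=> w1; rewrite cabsM cabs_real gtr0_norm//; have := cabs_ge0 w; nra.
have dG w : cabs w <= 1 -> derivable G w 1.
  move=> w1; apply: (@cderivable_comp R F (fun w => (r%:C)%C * w)).
    by apply: (@derivableM _ _ (cst ((r%:C)%C : Cplx R)) id); [exact: derivable_cst|exact: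
      derivable_id].
  by apply: aF; exact: rw.
have -> : (fun t => dyadic_root k (cabs (F (circle_pt r t)))) =
  (fun t => dyadic_root k (cabs (G (eit t)))).
  by apply/funext => t; rewrite /G circle_ptE.
apply: (@submean_le_poisson R (fun w => dyadic_root k (cabs (G w)))) => //.
- by move=> w; rewrite dyadic_root_ge0// cabs_ge0.
- by move=> w w1; apply: continuous_dyadic_root_cabs; apply: cderivable_continuous; exact: dG.
- move=> w w1; apply: (@dyadic_root_cabs_submean R G w (1 - cabs w)); first by rewrite subr_gt0.
  by move=> v vw; apply: dG; have := cabsB v w; lra.
Qed.

Theorem analytic_modular_subordination : exists2 A : R, 0 < A &
  forall F om r rho, analytic_on (@disc R) F -> analytic_on (@disc R) om ->
    (forall z, cabs z < 1 -> cabs (om z) <= cabs z) ->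
    0 <= r -> r < rho -> rho < 1 -> analytic_modular F rho <= 1 ->
    avg (fun t => cabs (F (om (circle_pt r t))) `^ p (om (circle_pt r t))) <= A.
Proof.
have [k [Q [K [hq hK cq uq]]]] := exponent_setup.
exists (Num.max 1 (2 `^ Q * (1 + K + 2 `^ Q))); first by rewrite lt_max ltr01.
move=> F om r rho aF aom omz r0 rrho rho1 m1; rewrite le_max; apply/orP; right.
have rho01 : 0 < rho < 1 by rewrite rho1 andbT; lra.
have cg z : cabs z < 1 -> {for z, continuous (fun w => dyadic_root k (cabs (F w)))}.
  by move=> z1; apply: continuous_dyadic_root_cabs; exact: cF.
have g0 z : 0 <= dyadic_root k (cabs (F z)) by rewrite dyadic_root_ge0// cabs_ge0.
have := @modular_subordination R (fun w => dyadic_root k (cabs (F w)))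
  (fun z => p z / (2^-1) ^+ k) Q K g0 cg cq hq
  (fun r z h1 h2 => dyadic_root_cabs_subharmonic k aF h1 h2) hK r rho om r0 rho01.
have zr1 z : cabs z <= r -> cabs z < 1 by move=> h; lra.
have om0 : om 0 = 0.
  apply/eqP; rewrite -cabs_eq0 eq_le cabs_ge0 andbT.
  by have := omz 0; rewrite cabs0; apply.
move=> /(_ (fun z h => aom z (zr1 z h)) _ om0).
move=> /(_ (fun z h => le_lt_trans (le_trans (omz z (zr1 z h)) h) rrho)).
rewrite /circle_modular.
under eq_avg do rewrite dyadic_root_powR ?cabs_ge0//.
move=> /(_ m1).
by under eq_avg do rewrite dyadic_root_powR ?cabs_ge0//.
Qed.

Theorem analytic_modular_cvg F (B : R) : analytic_on (@disc R) F ->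
  (forall r, 0 < r < 1 -> analytic_modular F r <= B) ->
    exists L, cvg_at1 (analytic_modular F) L.
Proof.
move=> aF FB.
have [k [Q [K [hq hK cq uq]]]] := exponent_setup.
have cg z : cabs z < 1 -> {for z, continuous (fun w => dyadic_root k (cabs (F w)))}.
  by move=> z1; apply: continuous_dyadic_root_cabs; exact: cF.
have g0 z : 0 <= dyadic_root k (cabs (F z)) by rewrite dyadic_root_ge0// cabs_ge0.
have ME r : circle_modular (fun w => dyadic_root k (cabs (F w))) (fun z => p z / (2^-1) ^+ k)
  r = analytic_modular F r.
  by apply: eq_avg => t; rewrite dyadic_root_powR ?cabs_ge0.
have := @circle_modular_cvg R (fun w => dyadic_root k (cabs (F w)))
  (fun z => p z / (2^-1) ^+ k) Q K g0 cg cq hq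
  (fun r z h1 h2 => dyadic_root_cabs_subharmonic k aF h1 h2) hK uq B.
move=> /(_ (fun r h => eq_ind_r (fun x => x <= B) (FB r h) (ME r))) [L hL].
exists L => e e0; have [r0 r001 h] := hL e e0.
exists r0; first exact: r001.
by move=> r h1 h2; move: (h r h1 h2); rewrite (ME r).
Qed.

End AnalyticModular.

(** * Luxemburg means and the theorem *)

Section Luxemburg.
Variable R : realType.
Implicit Types (F : Cplx R -> Cplx R) (s : Cplx R -> R) (r l : R).

Lemma modularE s r F l :
  continuous (fun t => (cabs (F (circle_pt r t)) / l) `^ s (circle_pt r t)) ->
  modular s r F l = (avg (fun t => (cabs (F (circle_pt r t)) / l) `^ s (circle_pt r t)))%:E.
Proof.
move=> cphi; rewrite /modular /avg EFinM; congr (_ * _)%E.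
rewrite /itg /Rintegral fineK//.
have ig := cont_on_integrable (continuous_cont_on cphi (a := 0) (b := 2 * pi)).
by apply: (integrable_fin_num _ ig); exact: measurable_itv.
Qed.

Definition rescale l F (z : Cplx R) : Cplx R := ((l^-1)%:C)%C * F z.

Lemma cabs_rescale l F z : 0 < l -> cabs (rescale l F z) = cabs (F z) / l.
Proof. by move=> l0; rewrite cabsM cabs_real gtr0_norm ?invr_gt0// mulrC. Qed.

Lemma analytic_rescale l F D : analytic_on D F -> analytic_on D (rescale l F).
Proof.
move=> aF z Dz; apply: (@derivableM _ _ (cst (((l^-1)%:C)%C : Cplx R)) F).
  exact: derivable_cst.
exact: aF.
Qed.

Lemma modular_rescale (p : Cplx R -> R) r F l :
  analytic_on (@disc R) F -> 0 < l -> 0 <= r < 1 ->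
  (forall z, cabs z < 1 -> 0 < p z) ->
  (forall z, cabs z < 1 -> {for z, continuous p}) ->
  modular p r F l = (analytic_modular p (rescale l F) r)%:E.
Proof.
move=> aF l0 r01 p0 cp.
have c1 : continuous (fun t => cabs (rescale l F (circle_pt r t))).
  apply: (@continuous_on_circle R (fun z => cabs (rescale l F z))) => // z z1.
  apply: (@continuous_comp _ _ _ (rescale l F)); last exact: continuous_cabs.
  by apply: cderivable_continuous; exact: (analytic_rescale aF).
have e t : (cabs (F (circle_pt r t)) / l) `^ p (circle_pt r t) =
    cabs (rescale l F (circle_pt r t)) `^ p (circle_pt r t) by rewrite cabs_rescale.
rewrite modularE; first by congr (_%:E); apply: eq_avg.
under [X in continuous X]eq_fun do rewrite e.
move=> t.
apply: (@continuous_powR2 R R (fun t => cabs (rescale l F (circle_pt r t))) (fun t => p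
  (circle_pt r t))).
- by move=> v; exact: cabs_ge0.
- by apply: p0; rewrite cabs_circle_pt; case/andP: r01 => ? ?; rewrite ger0_norm.
- exact: c1.
- exact: continuous_on_circle.
Qed.

End Luxemburg.

Section Radius.
Variable R : realType.
Implicit Types (F : Cplx R -> Cplx R) (p : Cplx R -> R) (r l : R).

(** The integrand is uniformly continuous on a slightly larger closed disc. *)
Lemma analytic_modular_right_open p F r : analytic_on (@disc R) F -> 0 <= r < 1 ->
  (forall z, cabs z < 1 -> 0 < p z) ->
  (forall z, cabs z < 1 -> {for z, continuous p}) ->
  analytic_modular p F r < 1 -> exists rho, [/\ r < rho, rho < 1 & analytic_modular p F rho
    <= 1].
Proof.
move=> aF /andP[r0 r1] p0 cp m1.
pose phi (z : Cplx R) := cabs (F z) `^ p z.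
pose b := (1 + r) / 2.
have b1 : b < 1 by rewrite /b; lra.
have rb : r < b by rewrite /b; lra.
have cphi z : cabs z < 1 -> {for z, continuous phi}.
  move=> z1; apply: (@continuous_powR2 R (Cplx R) (fun z => cabs (F z)) p).
  - by move=> v; exact: cabs_ge0.
  - exact: p0.
  - apply: (@continuous_comp _ _ _ F); last exact: continuous_cabs.
    by apply: cderivable_continuous; exact: aF.
  - exact: cp.
have e0 : 0 < (1 - analytic_modular p F r) / 2 by rewrite divr_gt0// subr_gt0.
set e := (1 - analytic_modular p F r) / 2 in e0.
have [C C0 hC] := continuous_quadratic (@compact_cdisc R b) (fun z h => cphi z (le_lt_trans h
  b1)) e0.
pose x := Num.min ((1 - r) / 4) (Num.min 1 (e / (C + 1))).
have C1 : 0 < C + 1 by lra.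
have x0 : 0 < x by rewrite !lt_min !divr_gt0// ?subr_gt0// ltr01.
have x1 : x <= (1 - r) / 4 by rewrite ge_min lexx.
have x2 : x <= 1 by rewrite !ge_min lexx orbT.
have x3 : x * (C + 1) <= e by rewrite -ler_pdivlMr// !ge_min lexx !orbT.
exists (r + x); split; [lra|lra|].
have rx0 : 0 <= r + x by lra.
have c1 : continuous (fun t => phi (circle_pt r t)).
  by apply: continuous_on_circle; rewrite ?r0.
have c2 : continuous (fun t => phi (circle_pt (r + x) t)).
  by apply: continuous_on_circle => //; apply/andP; split; lra.
have c3 : continuous (fun t => phi (circle_pt r t) + (e + C * x ^+ 2)).
  by move=> t; apply: cvgD; [exact: c1|exact: cvg_cst].
have : analytic_modular p F (r + x) <= analytic_modular p F r + (e + C * x ^+ 2).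
  have eP y : analytic_modular p F y = avg (fun t => phi (circle_pt y t)) by [].
  rewrite (eP (r + x)) (eP r) -(avg_cst (e + C * x ^+ 2)) -(avgD c1 (@continuous_cst R _)).
  apply: le_avg => // t.
  have i1 : cabs (circle_pt (r + x) t :
    Cplx R) <= b by rewrite cabs_circle_pt ger0_norm// /b; lra.
  have i2 : cabs (circle_pt r t : Cplx R) <= b by rewrite cabs_circle_pt ger0_norm// ltW.
  have := hC _ _ i1 i2.
  have -> : cabs (circle_pt (r + x) t - circle_pt r t) = x.
    rewrite !circle_ptE -mulrBl -rmorphB cabsM cabs_eit mulr1 cabs_real.
    by rewrite (_ : r + x - r = x) ?gtr0_norm//; ring.
  by rewrite ler_distl => /andP[_]; rewrite -/(phi _); lra.
have : C * x ^+ 2 <= e.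
  apply: le_trans x3; rewrite mulrC expr2 mulrDr mulr1.
  have : x * x * C <= x * C by rewrite ler_wpM2r// ler_piMr// ltW.
  lra.
have eE : e + e = 1 - analytic_modular p F r by rewrite /e -splitr.
move=> Cx h; apply: le_trans h _; apply: (@le_trans _ _ (analytic_modular p F r + (e + e))).
  by rewrite lerD2l lerD2l.
by rewrite eE subrKC.
Qed.

End Radius.

Section ModularLimit.
Variable R : realType.
Implicit Types (r l t a : R).
Variables (p : Cplx R -> R) (c M : R).
Hypotheses (c_gt0 : 0 < c) (p_bd : forall z, cabs z < 1 -> c <= p z <= M).
Hypothesis p_lh : log_holder p.
Variable F : Cplx R -> Cplx R.
Hypothesis aF : analytic_on (@disc R) F.

Let p0 z : cabs z < 1 -> 0 < p z.
Proof. by move=> /p_bd /andP[h _]; exact: lt_le_trans h. Qed.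

Let cp z : cabs z < 1 -> {for z, continuous p}.
Proof. exact: log_holder_continuous. Qed.

Let m r l := analytic_modular p (rescale l F) r.

Let circ1 r t : 0 <= r < 1 -> cabs (circle_pt r t : Cplx R) < 1.
Proof. by move=> /andP[r0 r1]; rewrite cabs_circle_pt ger0_norm. Qed.

Let cm r l : 0 <= r < 1 ->
  continuous (fun t => cabs (rescale l F (circle_pt r t)) `^ p (circle_pt r t)).
Proof.
move=> r01 t.
apply: (@continuous_powR2 R R (fun t => cabs (rescale l F (circle_pt r t))) (fun t => p
  (circle_pt r t))).
- by move=> v; exact: cabs_ge0.
- by apply: p0; exact: circ1.
- apply: (@continuous_on_circle R (fun z => cabs (rescale l F z))) => // z z1.
  apply: (@continuous_comp _ _ _ (rescale l F)); last exact: continuous_cabs.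
  by apply: cderivable_continuous; exact: (analytic_rescale aF).
- exact: continuous_on_circle.
Qed.

Lemma analytic_modular_rescale_le r l a : 0 <= r < 1 -> 0 < l -> 1 <= a ->
  a `^ c * m r (a * l) <= m r l.
Proof.
move=> r01 l0 a1; have a0 : 0 < a by lra.
rewrite -(avgZ _ (cm (l := a * l) r01)); apply: le_avg; [|exact: cm|].
  by move=> t; apply: cvgM; [exact: cvg_cst|exact: cm].
move=> t; have /andP[pc _] := p_bd (circ1 t r01).
rewrite !cabs_rescale ?mulr_gt0// -[X in _ <= X `^ _](_ :
  a * (cabs (F (circle_pt r t)) / (a * l)) = _); last first.
  by field; rewrite !gt_eqF.
rewrite [in leRHS]powRM ?(ltW a0)// ?divr_ge0 ?cabs_ge0// ?mulr_ge0 ?(ltW a0) ?(ltW l0)//.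
by apply: ler_wpM2r; [exact: powR_ge0|exact: ler_powR].
Qed.

Lemma analytic_modular_rescale_ge r l a : 0 <= r < 1 -> 0 < l -> 1 <= a ->
  m r l <= a `^ M * m r (a * l).
Proof.
move=> r01 l0 a1; have a0 : 0 < a by lra.
rewrite -(avgZ _ (cm (l := a * l) r01)); apply: le_avg; [exact: cm| |].
  by move=> t; apply: cvgM; [exact: cvg_cst|exact: cm].
move=> t; have /andP[_ pM] := p_bd (circ1 t r01).
rewrite !cabs_rescale ?mulr_gt0// -[X in X `^ _ <= _](_ :
  a * (cabs (F (circle_pt r t)) / (a * l)) = _); last first.
  by field; rewrite !gt_eqF.
rewrite [in leLHS]powRM ?(ltW a0)// ?divr_ge0 ?cabs_ge0// ?mulr_ge0 ?(ltW a0) ?(ltW l0)//.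
by apply: ler_wpM2r; [exact: powR_ge0|exact: ler_powR].
Qed.

Lemma analytic_modular_ge0 r l : 0 <= r < 1 -> 0 <= m r l.
Proof. by move=> r01; apply: avg_ge0; [exact: cm|move=> t; exact: powR_ge0]. Qed.

Lemma analytic_modular_antimono r l l' : 0 <= r < 1 -> 0 < l -> l <= l' -> m r l' <= m r l.
Proof.
move=> r01 l0 ll; have l'0 : 0 < l' by lra.
have a1 : 1 <= l' / l by rewrite ler_pdivlMr// mul1r.
have e : l' / l * l = l' by rewrite divfK// gt_eqF.
have h := analytic_modular_rescale_le r01 l0 a1; rewrite e in h; apply: le_trans h.
by apply: ler_peMl; [exact: analytic_modular_ge0|rewrite -[leLHS](powRr0 (l' / l)) ler_powR//
  ltW].
Qed.

Lemma Mmean_le r l : 0 <= r < 1 -> 0 < l -> m r l < 1 -> (Mmean p r F <= l%:E)%E.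
Proof.
move=> r01 l0 ml; apply: ereal_inf_lbound; exists l => //; split => //.
by rewrite (modular_rescale aF l0 r01 p0 cp) lte_fin.
Qed.

Lemma Mmean_ge r l : 0 <= r < 1 -> 0 < l -> 1 <= m r l -> (l%:E <= Mmean p r F)%E.
Proof.
move=> r01 l0 ml; apply: le_ereal_inf_tmp => _ [x [x0 mx] <-].
move: mx; rewrite (modular_rescale aF x0 r01 p0 cp) !lte_fin lee_fin => mx.
rewrite leNgt; apply/negP => xl.
have h := analytic_modular_antimono r01 x0 (ltW xl).
by have := le_lt_trans (le_trans ml h) mx; rewrite ltxx.
Qed.

Lemma Mmean_ge0 r : (0 <= Mmean p r F)%E.
Proof.
by apply: le_ereal_inf_tmp => _ [x [x0 mx] <-]; rewrite lee_fin ltW.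
Qed.

Hypothesis F_Hardy : (supnorm p F < +oo)%E.

Let Hardy_modular_lt1 : exists2 l : R, 0 < l & forall r, 0 <= r < 1 -> m r l < 1.
Proof.
have [b b0 hb] : exists2 b : R, 0 < b & (supnorm p F < b%:E)%E.
  move: F_Hardy; case: (supnorm p F) => [x _|//|_].
    exists (`|x| + 1); first by rewrite ltr_wpDl.
    by rewrite lte_fin; have := ler_norm x; lra.
  by exists 1 => //; rewrite ltNyr.
exists b => // r r01.
have : (Mmean p r F < b%:E)%E.
  by apply: le_lt_trans hb; apply: ereal_sup_ubound; exists r.
move=> /ereal_inf_lt[_ [x [x0 mx] <-]]; rewrite lte_fin => xb.
move: mx; rewrite (modular_rescale aF x0 r01 p0 cp) lte_fin => mx.
exact: le_lt_trans (analytic_modular_antimono r01 x0 (ltW xb)) mx.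
Qed.

(** The limit [L] is the infimum of the [l] whose limit modular is below one.
    Above [L] the modulars are eventually below one.  Below [L] they eventually
    exceed one, since decreasing [l] multiplies a modular by a factor bounded
    away from one ([analytic_modular_rescale_le]).  The last clause, finding
    large circles with modular below one, is the form in which the limit
    is used. *)
Theorem Mmean_cvg : exists L : R,
  [/\ limnorm p F = L%:E, 0 <= L & forall l, L < l -> forall r0, r0 < 1 ->
    exists r, [/\ r0 < r, r < 1, 0 < r & m r l < 1]].
Proof.
have ar1 (u v w : R) : w < 1 -> - ((1 - w) / 2) <= u - v -> u <= w -> v < 1 by lra.
have ar2 (u v : R) : v < 1 -> u - v <= (1 - v) / 2 -> u < 1 by lra.
have ar3 (u v w : R) : 1 <= v -> - (1 - w) <= u - v -> w <= u by lra.
have [b b0 hb] := Hardy_modular_lt1.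
have bdd l : 0 < l -> forall r, 0 < r < 1 -> m r l <= (Num.max 1 (b / l)) `^ M.
  move=> l0 r /andP[r0 r1]; have r01 : 0 <= r < 1 by rewrite ltW.
  have a1 : 1 <= Num.max 1 (b / l) by rewrite le_max lexx.
  apply: le_trans (analytic_modular_rescale_ge r01 l0 a1) _.
  apply: ler_piMr; first exact: powR_ge0.
  apply: le_trans (ltW (hb _ r01)); apply: analytic_modular_antimono => //.
  by rewrite -ler_pdivrMr// le_max lexx orbT.
have /choice[mm hmm] : forall l, exists x, 0 < l -> cvg_at1 (fun r => m r l) x.
  move=> l; have [l0|l0] := ltP 0 l; last by exists 0.
  have [x hx] := analytic_modular_cvg c_gt0 (fun z h => proj1 (andP (p_bd h))) p_lh
    (analytic_rescale aF (l := l)) (bdd l l0).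
  by exists x.
(* mm l is the limit of the modulars of F / l *)
pose S := [set l : R | 0 < l /\ mm l < 1].
have S0 : lbound S 0 by move=> l [l0 _]; exact: ltW.
have S2 : S (2 * b).
  have b20 : 0 < 2 * b by rewrite mulr_gt0.
  split=> //; have q1 : (2 `^ c)^-1 < 1.
    rewrite invf_lt1 ?powR_gt0//.
    rewrite -[ltLHS](powRr0 2) /powR gt_eqF// ltr_expR mul0r mulr_gt0// ln_gt0//.
    by rewrite ltr1n.
  have d0 : 0 < (1 - (2 `^ c)^-1) / 2 by rewrite divr_gt0// subr_gt0.
  have [r1 /andP[r10 r11] h] := hmm _ b20 _ d0.
  have x1 : r1 < (1 + r1) / 2 by lra.
  have x2 : (1 + r1) / 2 < 1 by lra.
  have x3 : 0 <= (1 + r1) / 2 < 1 by rewrite x2 andbT; lra.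
  have two : 1 <= 2 :> R by rewrite ler1n.
  have := h _ x1 x2; rewrite /= ler_norml => /andP[h1 _].
  have := analytic_modular_rescale_le x3 b0 two; have := hb _ x3.
  have q0 : 0 < 2 `^ c :> R by rewrite powR_gt0.
  move=> g1 g2; have : m ((1 + r1) / 2) (2 * b) <= (2 `^ c)^-1.
    by rewrite -(ler_pM2l q0) divff ?gt_eqF//; exact: le_trans g2 (ltW g1).
  exact: ar1 q1 h1.
have infS : has_inf S by split; [exists (2 * b)|exists 0].
pose L := inf S.
have L0 : 0 <= L by apply: lb_le_inf => //; exists (2 * b).
have above l : L < l -> exists2 r0 : R, 0 < r0 < 1 & forall r, r0 < r -> r < 1 -> m r l < 1.
  move=> Ll; have dl : 0 < l - L by rewrite subr_gt0.
  have [l' [l'0 ml'] h'] := inf_adherent dl infS; rewrite -/L subrKC in h'.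
  have e0 : 0 < (1 - mm l') / 2 by rewrite divr_gt0// subr_gt0.
  have [r0 r001 h] := hmm _ l'0 _ e0.
  exists r0 => // r h1 h2; have /andP[r00 r01] := r001.
  have r_01 : 0 <= r < 1 by rewrite h2 andbT; lra.
  apply: le_lt_trans (analytic_modular_antimono r_01 l'0 (ltW h')) _.
  have := h _ h1 h2; rewrite /= ler_norml => /andP[_]; exact: ar2.
have below l : 0 < l -> l < L -> exists2 r0 :
  R, 0 < r0 < 1 & forall r, r0 < r -> r < 1 -> 1 <= m r l.
  move=> l0 lL; pose l' := (l + L) / 2.
  have ll' : l < l' by rewrite /l'; lra.
  have l'L : l' < L by rewrite /l'; lra.
  have l'0 : 0 < l' by lra.
  have ml' : 1 <= mm l'.
    rewrite leNgt; apply/negP => h.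
    have : L <= l' by apply: ge_inf; [exists 0|split].
    lra.
  pose a := l' / l; have a1 : 1 < a by rewrite /a ltr_pdivlMr// mul1r.
  have ac1 : 1 < a `^ c.
    have a0 : 0 < a := lt_trans ltr01 a1.
    by rewrite -[ltLHS](powRr0 a) /powR gt_eqF// ltr_expR mul0r mulr_gt0// ln_gt0.
  have ac0 : 0 < a `^ c := lt_trans ltr01 ac1.
  have e0 : 0 < 1 - (a `^ c)^-1 by rewrite subr_gt0 invf_lt1.
  have [r0 r001 h] := hmm _ l'0 _ e0.
  exists r0 => // r h1 h2; have /andP[r00 r01] := r001.
  have r_01 : 0 <= r < 1 by rewrite h2 andbT; lra.
  have ea : a * l = l' by rewrite /a divfK// gt_eqF.
  have h5 := analytic_modular_rescale_le r_01 l0 (ltW a1); rewrite ea in h5.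
  have := h _ h1 h2; rewrite /= ler_norml => /andP[h3 _].
  have h4 : (a `^ c)^-1 <= m r l' by exact: ar3 h3.
  apply: le_trans h5; have := ler_wpM2l (ltW ac0) h4.
  by rewrite divff// gt_eqF.
exists L; split => //; last first.
  move=> l /above[r1 /andP[r10 r11] h] r0 r01.
  have m1 : Num.max r0 r1 < 1 by rewrite gt_max r01.
  have m2 : r0 <= Num.max r0 r1 by rewrite le_max lexx.
  have m3 : r1 <= Num.max r0 r1 by rewrite le_max lexx orbT.
  exists ((1 + Num.max r0 r1) / 2); split; try lra.
  by apply: h; lra.
have close e : 0 < e -> \forall r \near (1 : R)^'-,
    ((L - e)%:E <= Mmean p r F <= (L + e)%:E)%E.
  move=> e0.
  have [r1 /andP[r10 r11] h1] := above (L + e) ltac:(lra).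
  have [r2 /andP[r20 r21] h2] : exists2 r2 : R, 0 < r2 < 1 & forall r, r2 < r -> r < 1 ->
      ((L - e)%:E <= Mmean p r F)%E.
    have [Le|Le] := leP (L - e) 0.
      exists (1 / 2); first by lra.
      by move=> r _ _; apply: le_trans (Mmean_ge0 r); rewrite lee_fin.
    have [r2 r201 h2] := below (L - e) Le ltac:(lra).
    have /andP[r20 r21] := r201.
    exists r2 => // r h3 h4; apply: Mmean_ge => //; last exact: h2.
    by rewrite h4 andbT; lra.
  near=> r.
  have a1 : r1 < r by near: r; exact: nbhs_left_gt.
  have a2 : r2 < r by near: r; exact: nbhs_left_gt.
  have a3 : r < 1 by near: r; exact: nbhs_left_lt.
  rewrite h2//=; apply: Mmean_le; [|lra|exact: h1].
  by rewrite a3 andbT; lra.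
apply: cvg_lim; first exact: ereal_hausdorff.
apply/fine_cvgP; split.
  apply: filterS (close 1 ltr01) => r /andP[h1 h2].
  rewrite fin_numE; apply/andP; split; apply/eqP => h.
    by rewrite h in h1.
  by rewrite h in h2.
apply/cvgrPdist_le => e e0.
apply: filterS (close e e0) => r /=.
case: (Mmean p r F) => [x|//|//]; last first.
  by rewrite ?andbF.
by rewrite !lee_fin /= distrC ler_distl => /andP[h1 h2]; apply/andP; split; lra.
Unshelve. all: by end_near. Qed.

End ModularLimit.

Theorem theorem3p7 (R : realType) (p : Cplx R -> R) (omega : Cplx R -> Cplx R)
    (p_exponent : variable_exponent p)
    (p_harmonic : harmonic_on (@disc R) p)
    (p_log_holder : log_holder_bounded_conjugate p)
    (omega_disc : forall z, disc z -> disc (omega z))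
    (omega_analytic : analytic_on (@disc R) omega)
    (omega_le : forall z, disc z -> cabs (omega z) <= cabs z) :
  exists C : R, forall F : Cplx R -> Cplx R, Hardy p F ->
    [/\ Hardy (p \o omega) (F \o omega),
        (supnorm (p \o omega) (F \o omega) <= C%:E * limnorm p F)%E &
        forall r : R, 0 <= r < 1 ->
          (Mmean (p \o omega) r (F \o omega) <= C%:E * Mmean p r F)%E].
Proof.
have lh := p_log_holder.1.
have [c c0 pc] := variable_exponent_lower p_exponent lh.
have [M hM] := log_holder_bounded lh.
have pcM z : cabs z < 1 -> c <= p z <= M.
  move=> z1; rewrite pc//=; apply: le_trans (ler_norm _) _; apply: hM; exact: ltW.
have p0 z : cabs z < 1 -> 0 < p z by move=> /pc; exact: lt_le_trans.
have cp z : cabs z < 1 -> {for z, continuous p} by exact: log_holder_continuous.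
have [A A0 hA] := analytic_modular_subordination c0 pc lh.
(* dividing by C, where C `^ c = A + 1, divides every modular by A + 1 or more *)
pose C := (A + 1) `^ c^-1.
have A1 : 0 < A + 1 by lra.
have C0 : 0 < C by exact: powR_gt0.
have Cc : C `^ c = A + 1 by rewrite /C -powRrM mulVf ?gt_eqF// powRr1// ltW.
have C1 : 1 <= C.
  rewrite /C -[leLHS](powRr0 (A + 1)); apply: ler_powR; first by lra.
  by rewrite invr_ge0 ltW.
exists C => F [aF hF].
have aFo : analytic_on (@disc R) (F \o omega).
  move=> z z1; apply: (@cderivable_comp R F omega); first exact: omega_analytic.
  by apply: aF; exact: omega_disc.
have po0 z : cabs z < 1 -> 0 < (p \o omega) z by move=> z1; apply: p0; exact: omega_disc.
have cpo z : cabs z < 1 -> {for z, continuous (p \o omega)}.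
  move=> z1; apply: (@continuous_comp _ _ _ omega p).
    by apply: cderivable_continuous; exact: omega_analytic.
  by apply: cp; exact: omega_disc.
have step l r rho : 0 < l -> 0 <= r -> r < rho -> rho < 1 ->
    analytic_modular p (rescale l F) rho <= 1 ->
    (Mmean (p \o omega) r (F \o omega) <= (C * l)%:E)%E.
  move=> l0 r0 rr rho1 m1; have r1 : r < 1 by lra.
  have r01 : 0 <= r < 1 by rewrite r0.
  have Cl0 : 0 < C * l by rewrite mulr_gt0.
  apply: ereal_inf_lbound; exists (C * l) => //; split => //.
  rewrite (modular_rescale aFo Cl0 r01 po0 cpo) lte_fin.
  have sub := hA _ _ _ _ (analytic_rescale aF (l := l)) omega_analytic omega_le r0 rr rho1 m1.
  have ci l1 : 0 < l1 -> continuous (fun t => cabs (rescale l1 (F \o omega) (circle_pt r t))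
      `^ (p \o omega) (circle_pt r t)).
    move=> l10 t.
    have ct : cabs (circle_pt r t : Cplx R) < 1 by rewrite cabs_circle_pt ger0_norm.
    apply: (@continuous_powR2 R R (fun t => cabs (rescale l1 (F \o omega) (circle_pt r t)))
      (fun t => (p \o omega) (circle_pt r t))).
    - by move=> v; exact: cabs_ge0.
    - exact: po0.
    - apply: (@continuous_on_circle R (fun z => cabs (rescale l1 (F \o omega) z))) => // z z1.
      apply: (@continuous_comp _ _ _ (rescale l1 (F \o omega))); last exact: continuous_cabs.
      by apply: cderivable_continuous; exact: (analytic_rescale aFo).
    - exact: continuous_on_circle.
  have c2 := ci _ l0.
  apply: (@le_lt_trans _ _ ((A + 1)^-1 * A)); last by rewrite mulrC ltr_pdivrMr// mul1r; lra.
  apply: (@le_trans _ _ ((A + 1)^-1 * analytic_modular (p \o omega) (rescale l (F \o omega))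
    r)); last first.
    by rewrite ler_pM2l ?invr_gt0.
  rewrite /analytic_modular -(avgZ _ c2); apply: le_avg; first exact: ci.
    by move=> t; apply: cvgM; [exact: cvg_cst|exact: c2].
  move=> t; have ct : cabs (circle_pt r t : Cplx R) < 1 by rewrite cabs_circle_pt ger0_norm.
  rewrite (cabs_rescale _ _ Cl0) (cabs_rescale _ _ l0).
  set x := cabs _; have x0 : 0 <= x by exact: cabs_ge0.
  have -> : x / (C * l) = C^-1 * (x / l) by rewrite invfM mulrCA.
  have Ci0 : 0 <= C^-1 by rewrite invr_ge0 ltW.
  have xl0 : 0 <= x / l by rewrite divr_ge0// ltW.
  rewrite (powRM _ Ci0 xl0).
  apply: ler_wpM2r; first exact: powR_ge0.
  have pw q : C^-1 `^ q = (C `^ q)^-1.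
    by rewrite -(powR_inv1 (ltW C0)) -powRrM mulN1r powRN.
  rewrite (pw _) -Cc lef_pV2 ?posrE ?powR_gt0//.
  by apply: ler_powR => //; apply: pc; exact: omega_disc.
have [L [limE L0 hL]] := Mmean_cvg c0 pcM lh aF hF.
have supL : (supnorm (p \o omega) (F \o omega) <= (C * L)%:E)%E.
  apply: ge_ereal_sup => _ [r /= /andP[r0 r1] <-].
  apply/lee_addgt0Pr => e e0.
  have Ce : 0 < e / C by rewrite divr_gt0.
  have [rho [h1 h2 h3 h4]] := hL (L + e / C) ltac:(lra) r r1.
  have -> : ((C * L)%:E + e%:E)%E = (C * (L + e / C))%:E.
    by rewrite -EFinD mulrDr mulrCA divff ?mulr1// gt_eqF.
  by apply: (@step _ _ rho) => //; [lra|exact: ltW].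
split.
- split; first exact: aFo.
  by apply: (le_lt_trans supL); rewrite ltry.
- by rewrite limE -EFinM.
move=> r r01; have /andP[r0 r1] := r01.
rewrite -lee_pdivrMl//; apply: le_ereal_inf_tmp => _ [l [l0 ml] <-].
rewrite lee_pdivrMl// -EFinM.
move: ml; rewrite (modular_rescale aF l0 r01 p0 cp) lte_fin => ml.
have [rho [h1 h2 h3]] := analytic_modular_right_open (analytic_rescale aF (l := l)) r01 p0 cp
  ml.
exact: step h3.
Qed.
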